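(* Let $n>2$ be an integer, let $i,j\in\{1,\dots,n\}$, and let $q\in(-1,0)$ be the number such that $q+q^{-1}=-n$. Then the circular density of the variable $w=\sqrt{n+2}\,u_{ij}\in A_o(n)$ (with respect to the Haar functional of $A_o(n)$) is given by $F(z)=\frac12\left(G(z)+G(z^{-1})\right)$, $z\in\mathbb T$, with $$G(z)=\frac{1+q}{1-q}\left(1-z^2+2(1-z^4)\sum_{k=1}^\infty(-1)^k\frac{q^k}{1+q^kz^2}\right)$$ $$\phantom{G(z)}=1+2\sum_{r=1}^\infty(-1)^r\frac{q^{r-1}(1+q)^2}{(1+q^{r+1})(1+q^{r-1})}\,z^{2r}.$$
   Context: $A_o(n)$ is the universal unital $C^*$-algebra generated by $n^2$ self-adjoint elements $u_{ij}$ ($1\le i,j\le n$) subject to the relations $uu^t=u^tu=1$, where $u=(u_{ij})$ and $u^t=(u_{ji})$. It is a compact quantum group algebra in the sense of Woronowicz, with comultiplication $\Delta(u_{ij})=\sum_k u_{ik}\otimes u_{kj}$. The Haar functional, denoted $\int$, is the unique state on $A_o(n)$ that is left and right invariant: $(\mathrm{id}\otimes\int)\Delta(a)=(\int\otimes\,\mathrm{id})\Delta(a)=\left(\int a\right)1$ for all $a$. $\mathbb T$ is the unit circle in $\mathbb C$. A (self-adjoint) variable $w$ is said to have circular density $F$ if $\int\phi(w)=\int_{\mathbb T}F(z)\,\phi(z+z^{-1})\,\frac{dz}{2\pi i z}$ for any continuous function $\phi$, and $F(z)=F(z^{-1})$ for all $z\in\mathbb T$. With $z=e^{it}$ this reads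 $\int\phi(w)=\frac1\pi\int_0^\pi F(e^{it})\phi(2\cos t)\,dt$. *)

(* Defs.v *)
From HB Require Import structures.
From mathcomp Require Import all_boot all_order all_algebra.
From mathcomp Require Import complex.
From mathcomp Require Import all_classical all_reals all_analysis.

Set Implicit Arguments.
Unset Strict Implicit.
Unset Printing Implicit Defensive.

Import Order.TTheory GRing.Theory Num.Theory.
Import numFieldNormedType.Exports.

Local Open Scope complex_scope.
Local Open Scope classical_set_scope.
Local Open Scope ring_scope.

(* Unital C*-algebras.  HB does not allow a structure joining normed modules
   and rings above numDomainType, so the norm is a field of the mixin, with
   values in R, and completeness is stated for Cauchy sequences. *)
HB.mixin Record Algebra_isCStarAlgebra (R : realType) A
    of GRing.Algebra R[i] A := {
  star : A -> A ;
  cnorm : A -> R ;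
  starD : forall a b : A, star (a + b) = star a + star b ;
  starZ : forall (k : R[i]) (a : A), star (k *: a) = k^* *: star a ;
  starM : forall a b : A, star (a * b) = star b * star a ;
  starK : forall a : A, star (star a) = a ;
  cnorm_ge0 : forall a : A, 0 <= cnorm a ;
  cnorm0_eq0 : forall a : A, cnorm a = 0 -> a = 0 ;
  ler_cnormD : forall a b : A, cnorm (a + b) <= cnorm a + cnorm b ;
  cnormZ : forall (k : R[i]) (a : A), (cnorm (k *: a))%:C = `|k| * (cnorm a)%:C ;
  ler_cnormM : forall a b : A, cnorm (a * b) <= cnorm a * cnorm b ;
  cnorm_starM : forall a : A, cnorm (star a * a) = cnorm a ^+ 2 ;
  cnorm_complete : forall a : nat -> A,
    (forall e : R, 0 < e -> exists N : nat, forall m n : nat,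
       (N <= m)%N -> (N <= n)%N -> cnorm (a m - a n) < e) ->
    exists l : A, cnorm (a n - l) @[n --> \oo] --> (0 : R)
}.

#[short(type="cstarAlgType")]
HB.structure Definition CStarAlgebra (R : realType) :=
  {A of Algebra_isCStarAlgebra R A & GRing.Algebra R[i] A}.

Definition is_star_map (R : realType) (A B : cstarAlgType R) (f : A -> B) :=
  forall a : A, f (star a) = star (f a).

Definition is_bounded (R : realType) (A B : cstarAlgType R) (f : A -> B) :=
  exists M : R, forall a : A, cnorm (f a) <= M * cnorm a.

(* S is a norm-closed unital *-subalgebra. *)
Record is_sub_cstar (R : realType) (A : cstarAlgType R) (S : set A) : Prop := {
  sub_cstar1 : S 1 ;
  sub_cstarD : forall a b : A, S a -> S b -> S (a + b) ;
  sub_cstarZ : forall (k : R[i]) (a : A), S a -> S (k *: a) ;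
  sub_cstarM : forall a b : A, S a -> S b -> S (a * b) ;
  sub_cstar_star : forall a : A, S a -> S (star a) ;
  sub_cstar_closed : forall (a : nat -> A) (l : A), (forall n, S (a n)) ->
    cnorm (a n - l) @[n --> \oo] --> (0 : R) -> S l
}.

Definition Ao_relations (R : realType) (n : nat) (B : cstarAlgType R)
    (v : 'M[B]_n) : Prop :=
  [/\ forall i j, star (v i j) = v i j,
      v *m v^T = 1%:M & v^T *m v = 1%:M].

(* (A, u) is A_o(n): A is generated by the u i j, and every solution of the
   relations in a unital C*-algebra B is the image of u under a unital
   *-homomorphism A -> B, necessarily unique. *)
Record is_Ao (R : realType) (n : nat) (A : cstarAlgType R) (u : 'M[A]_n) : Prop := {
  Ao_rel : Ao_relations u ;
  Ao_generated : forall S : set A,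
    is_sub_cstar S -> (forall i j, S (u i j)) -> forall a, S a ;
  Ao_universal : forall (B : cstarAlgType R) (v : 'M[B]_n), Ao_relations v ->
    exists f : {lrmorphism A -> B}, is_star_map f /\ forall i j, f (u i j) = v i j
}.

(* T, with elementary tensors tens a b, is the completion of the algebraic
   tensor product *-algebra of A and B for some C*-norm; tensor_inj says that
   the canonical map from the algebraic tensor product to T is injective. *)
Record is_cstar_tensor (R : realType) (A B T : cstarAlgType R)
    (tens : A -> B -> T) : Prop := {
  tensor_linearl : forall b : B, linear (tens^~ b) ;
  tensor_linearr : forall a : A, linear (tens a) ;
  tensor1 : tens 1 1 = 1 ;
  tensorM : forall (a a' : A) (b b' : B),
    tens a b * tens a' b' = tens (a * a') (b * b') ;
  tensor_star : forall (a : A) (b : B), star (tens a b) = tens (star a) (star b) ;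
  tensor_inj : forall (m : nat) (a : 'I_m -> A) (b : 'I_m -> B),
    (forall c : 'I_m -> R[i], \sum_k c k *: b k = 0 -> forall k, c k = 0) ->
    \sum_k tens (a k) (b k) = 0 -> forall k, a k = 0 ;
  tensor_dense : forall (t : T) (e : R), 0 < e ->
    exists (m : nat) (a : 'I_m -> A) (b : 'I_m -> B),
      cnorm (t - \sum_k tens (a k) (b k)) < e
}.

(* The minimal (spatial) tensor product: the one given by the least C*-norm. *)
Definition is_min_tensor (R : realType) (A B T : cstarAlgType R)
    (tens : A -> B -> T) : Prop :=
  is_cstar_tensor tens /\
  forall (T' : cstarAlgType R) (tens' : A -> B -> T'), is_cstar_tensor tens' ->
    forall (m : nat) (a : 'I_m -> A) (b : 'I_m -> B),
      cnorm (\sum_k tens (a k) (b k)) <= cnorm (\sum_k tens' (a k) (b k)).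

(* The comultiplication of A_o(n). *)
Definition is_comul (R : realType) (n : nat) (A T : cstarAlgType R)
    (u : 'M[A]_n) (tens : A -> A -> T) (Delta : {lrmorphism A -> T}) : Prop :=
  is_star_map Delta /\
  forall i j, Delta (u i j) = \sum_k tens (u i k) (u k j).

(* Positive functional of norm one; for z in R[i], 0 <= z means that z is a
   nonnegative real. *)
Definition is_state (R : realType) (A : cstarAlgType R) (h : {scalar A}) : Prop :=
  [/\ forall a : A, 0 <= h (star a * a),
      h 1 = 1 & forall a : A, `|h a| <= (cnorm a)%:C].

(* Er and El are the slice maps id (x) h and h (x) id, determined by their
   values on elementary tensors. *)
Definition is_Haar (R : realType) (A T : cstarAlgType R)
    (tens : A -> A -> T) (Delta : A -> T) (h : {scalar A}) : Prop :=
  [/\ is_state h,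
      exists Er : {linear T -> A},
        [/\ is_bounded Er, forall a b, Er (tens a b) = h b *: a
          & forall a, Er (Delta a) = h a *: 1]
    & exists El : {linear T -> A},
        [/\ is_bounded El, forall a b, El (tens a b) = h a *: b
          & forall a, El (Delta a) = h a *: 1]].

Definition spectrum (R : realType) (A : cstarAlgType R) (a : A) : set R[i] :=
  [set z | ~ exists b : A, b * (z *: 1 - a) = 1 /\ (z *: 1 - a) * b = 1].

Definition real_spectrum (R : realType) (A : cstarAlgType R) (a : A) : set R :=
  [set x | spectrum a x%:C].

(* Phi is the continuous functional calculus f |-> f(w) of the self-adjoint
   element w, i.e. the unital *-homomorphism from the continuous functions on
   the spectrum of w (which is real) to A mapping the identity function to w.
   Elements of this function algebra are represented by functions R -> R[i],
   identified when they agree on the spectrum.  The alias R[i]^o carries the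
   topology of R[i]. *)
Record is_cfc (R : realType) (A : cstarAlgType R) (w : A)
    (Phi : (R -> R[i]^o) -> A) : Prop := {
  cfc_eq : forall f g : R -> R[i]^o,
    {within real_spectrum w, continuous f} ->
    {within real_spectrum w, continuous g} ->
    (forall x, real_spectrum w x -> f x = g x) -> Phi f = Phi g ;
  cfcD : forall f g : R -> R[i]^o,
    {within real_spectrum w, continuous f} ->
    {within real_spectrum w, continuous g} ->
    Phi (fun x => f x + g x) = Phi f + Phi g ;
  cfcZ : forall (k : R[i]) (f : R -> R[i]^o),
    {within real_spectrum w, continuous f} ->
    Phi (fun x => k * f x) = k *: Phi f ;
  cfcM : forall f g : R -> R[i]^o,
    {within real_spectrum w, continuous f} ->
    {within real_spectrum w, continuous g} ->
    Phi (fun x => f x * g x) = Phi f * Phi g ;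
  cfc_star : forall f : R -> R[i]^o,
    {within real_spectrum w, continuous f} ->
    Phi (fun x => (f x : R[i])^*) = star (Phi f) ;
  cfc1 : Phi (fun=> 1) = 1 ;
  cfc_id : Phi (fun x => x%:C) = w
}.

Definition expi (R : realType) (t : R) : R[i] := cos t +i* sin t.

Definition circle_integrable (R : realType) (f : R[i] -> R[i]) : Prop :=
  (lebesgue_measure.-integrable `[0, 2 * pi]
     (fun t : R => (complex.Re (f (expi t)))%:E)) /\
  (lebesgue_measure.-integrable `[0, 2 * pi]
     (fun t : R => (complex.Im (f (expi t)))%:E)).

(* The integral of f(z) dz / (2 pi i z) over the unit circle. *)
Definition circle_integral (R : realType) (f : R[i] -> R[i]) : R[i] :=
  ((2 * pi)^-1 *
     \int[lebesgue_measure]_(t in `[0, 2 * pi]) complex.Re (f (expi t))) +i*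
  ((2 * pi)^-1 *
     \int[lebesgue_measure]_(t in `[0, 2 * pi]) complex.Im (f (expi t))).

(* Only the values of F on the unit circle matter; there z + z^-1 is real. *)
Definition has_circular_density (R : realType) (A : cstarAlgType R)
    (h : {scalar A}) (w : A) (F : R[i] -> R[i]) : Prop :=
  [/\ star w = w,
      forall z, `|z| = 1 -> F z = F z^-1,
      circle_integrable F
    & forall Phi, is_cfc w Phi ->
        forall phi : R -> R[i]^o, continuous phi ->
          h (Phi phi) =
          circle_integral (fun z => F z * phi (complex.Re (z + z^-1)))].

(* Sums over k >= 1. *)
Definition csummable (R : realType) (f : nat -> R[i]) : Prop :=
  cvgn (fun N => \sum_(1 <= k < N.+1) f k : R[i]^o).

Definition csum (R : realType) (f : nat -> R[i]) : R[i] :=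
  limn (fun N => \sum_(1 <= k < N.+1) f k : R[i]^o).

Definition G1_term (R : realType) (q : R) (z : R[i]) (k : nat) : R[i] :=
  (-1) ^+ k * (q%:C ^+ k / (1 + q%:C ^+ k * z ^+ 2)).

Definition G1 (R : realType) (q : R) (z : R[i]) : R[i] :=
  ((1 + q) / (1 - q))%:C *
  (1 - z ^+ 2 + 2 * (1 - z ^+ 4) * csum (G1_term q z)).

Definition G2_term (R : realType) (q : R) (z : R[i]) (r : nat) : R[i] :=
  (-1) ^+ r *
  ((q ^+ r.-1 * (1 + q) ^+ 2) / ((1 + q ^+ r.+1) * (1 + q ^+ r.-1)))%:C *
  z ^+ (2 * r)%N.

Definition G2 (R : realType) (q : R) (z : R[i]) : R[i] :=
  1 + 2 * csum (G2_term q z).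

(* Main.v *)
(* On the Fock space F = (+)_k H_k, where H_k is the space of tensors of degree k
   over C^n killed by every contraction of adjacent factors, let a_i be the
   annihilation operators.  They satisfy sum_i a_i a_i = 0 and
   a_i a_j^* = delta_ij - ([k]/[k+1]) a_i^* a_j on H_k, [k] being the q-number
   with [2] = n.  Hence on (+)_k H_k (x) H_k the operators
   v_ij = W (a_i (x) a_j) + (W (a_i (x) a_j))^*, with the weights
   W = ([k+1]/[k+2])^(1/2), are self-adjoint and form an orthogonal matrix; this
   gives a representation of A_o(n).  By the commutation relation, the vacuum
   expectations of the words in the v_ij are the coefficients of a projection onto
   fixed vectors of the tensor powers of u, and the invariance of the Haar
   functional then forces the Haar moments of u to be these expectations.

   On the vacuum, (n+2)^(1/2) v_ij acts as a Jacobi matrix with coefficients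
   beta_k = (1-q^k)(1-q^(k+1)) / ((1+q^k)(1+q^(k+1))), the one of the continuous
   q-ultraspherical polynomials with parameter -q.  The coordinates of the
   polynomials z^m + z^-m of z + z^-1 in the corresponding basis have a product
   formula, and their vacuum coordinate is twice the Fourier coefficient of F.
   Uniform approximation by polynomials on an interval containing the spectrum
   extends the equality to continuous functions. *)

Require Import Defs.
From HB Require Import structures.
From mathcomp Require Import all_boot all_order all_algebra.
From mathcomp Require Import complex.
From mathcomp Require Import all_classical all_reals all_analysis.
From mathcomp Require Import ring lra.

Set Implicit Arguments.
Unset Strict Implicit.
Unset Printing Implicit Defensive.

Import Order.TTheory GRing.Theory Num.Theory.
Import numFieldNormedType.Exports.

Local Open Scope complex_scope.
Local Open Scope classical_set_scope.
Local Open Scope ring_scope.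

(** * Bounded operators on a Hilbert space *)

(** The hypotheses on A_o(n) give values of words in the u_ij only through universality, and the
    Haar functional is known only through invariance. One concrete model answers both: the bounded
    operators on the Fock space form a C*-algebra, so universality pulls the vacuum state back to a
    state psi of A_o(n). Convolving the Haar functional with psi and evaluating at u_ij^m gives the
    Haar moment by invariance, and the vacuum moment because the vacuum expectations form a fixed
    vector. This replaces Gram matrices of noncrossing pairings and the classification of
    corepresentations. The ratios lam_k = [k]/[k+1] are handled through lam_0 = 0 and lam_(k+1) (n -
    lam_k) = 1 alone. This recursion says that the row of annihilation operators of each level is a
    multiple of a coisometry; the projection defining the next level then has a closed form, and
    this closed form is the commutation relation. The spectrum of the variable is not known
    beforehand to lie in [-2, 2], so the final approximation runs over a larger interval. *)

Section ComplexFacts.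
Variable R : realType.
Implicit Types z : R[i].

Lemma normc_Re z : `|z| = (complex.Re `|z|)%:C.
Proof. by rewrite normc_def. Qed.

Lemma ReD z z' : complex.Re (z + z') = complex.Re z + complex.Re z'.
Proof. by case: z; case: z'. Qed.

Lemma ImD z z' : complex.Im (z + z') = complex.Im z + complex.Im z'.
Proof. by case: z; case: z'. Qed.

Lemma ReN z : complex.Re (- z) = - complex.Re z.
Proof. by case: z. Qed.

Lemma ReZ (r : R) z : complex.Re (r%:C * z) = r * complex.Re z.
Proof. by case: z => a b /=; rewrite mul0r subr0. Qed.

Lemma ImZ (r : R) z : complex.Im (r%:C * z) = r * complex.Im z.
Proof. by case: z => a b /=; rewrite mul0r addr0. Qed.

Lemma Re_conjc z : complex.Re z^* = complex.Re z.
Proof. by case: z. Qed.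

Lemma Im_conjc z : complex.Im z^* = - complex.Im z.
Proof. by case: z. Qed.

Lemma conj_real (r : R) : (r%:C)^* = r%:C :> R[i].
Proof. by rewrite [LHS]conjc_real. Qed.

Lemma Re_le_norm z : complex.Re z <= complex.Re `|z|.
Proof.
rewrite normc_def /=; apply: le_trans (ler_norm _) _.
by rewrite -sqrtr_sqr ler_sqrt ?lerDl ?addr_ge0 ?sqr_ge0.
Qed.

Lemma ge0_real z : 0 <= z -> z = (complex.Re z)%:C.
Proof. by move=> z0; rewrite RRe_real // ger0_real. Qed.

End ComplexFacts.

(** The unit vector keeps the operator algebra from being zero, as its ring structure demands
    ([bone_neq0]). The square roots spell out the norm, which is only named afterwards. *)
Record hilbert (R : realType) := Hilbert {
  hcar :> lmodType R[i] ;
  hip : hcar -> hcar -> R[i] ;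
  hipDr : forall x y z, hip x (y + z) = hip x y + hip x z ;
  hipZr : forall k x y, hip x (k *: y) = k * hip x y ;
  hipC : forall x y, hip y x = (hip x y)^* ;
  hip_ge0 : forall x, 0 <= hip x x ;
  hip_eq0 : forall x, hip x x = 0 -> x = 0 ;
  hilbert_complete : forall x : nat -> hcar,
    (forall e : R, 0 < e -> exists N : nat, forall m n : nat,
       (N <= m)%N -> (N <= n)%N ->
       Num.sqrt (complex.Re (hip (x m - x n) (x m - x n))) < e) ->
    exists l : hcar, forall e : R, 0 < e -> exists N : nat, forall m : nat,
       (N <= m)%N -> Num.sqrt (complex.Re (hip (x m - l) (x m - l))) < e ;
  hilbert_unit : hcar ;
  hip_unit : hip hilbert_unit hilbert_unit = 1
}.

Section HilbertTheory.
Variables (R : realType) (H : hilbert R).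
Implicit Types x y z : H.

Definition hnorm x : R := Num.sqrt (complex.Re (hip x x)).

Lemma hipDl x y z : hip (x + y) z = hip x z + hip y z.
Proof. by rewrite hipC hipDr rmorphD /= -!hipC. Qed.

Lemma hipZl (k : R[i]) x y : hip (k *: x) y = k^* * hip x y.
Proof. by rewrite hipC hipZr rmorphM /= -hipC. Qed.

Lemma hipNr x y : hip x (- y) = - hip x y.
Proof. by rewrite -scaleN1r hipZr mulN1r. Qed.

Lemma hipNl x y : hip (- x) y = - hip x y.
Proof. by rewrite -scaleN1r hipZl rmorphN1 mulN1r. Qed.

Lemma hip0r x : hip x 0 = 0.
Proof. by rewrite -(scale0r (0 : H)) hipZr mul0r. Qed.

Lemma hip0l x : hip 0 x = 0.
Proof. by rewrite hipC hip0r conjC0. Qed.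

Lemma hip_inj x y : (forall z, hip z x = hip z y) -> x = y.
Proof.
move=> e; apply/eqP; rewrite -subr_eq0; apply/eqP/hip_eq0.
by rewrite hipDr hipNr e subrr.
Qed.

Lemma hip_inj_l x y : (forall z, hip x z = hip y z) -> x = y.
Proof. by move=> e; apply: hip_inj => z; rewrite hipC e -hipC. Qed.

Lemma hnorm_ge0 x : 0 <= hnorm x.
Proof. exact: sqrtr_ge0. Qed.

Lemma Re_hip_ge0 x : 0 <= complex.Re (hip x x).
Proof. by have := hip_ge0 x; rewrite lecE => /andP[]. Qed.

Lemma hnorm_sqr x : hnorm x ^+ 2 = complex.Re (hip x x).
Proof. by rewrite sqr_sqrtr // Re_hip_ge0. Qed.

Lemma hip_xx x : hip x x = (hnorm x ^+ 2)%:C.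
Proof. by rewrite hnorm_sqr -ge0_real // hip_ge0. Qed.

Lemma hnorm0_eq0 x : hnorm x = 0 -> x = 0.
Proof. by move=> x0; apply: hip_eq0; rewrite hip_xx x0 expr0n. Qed.

Lemma hnorm0 : hnorm 0 = 0.
Proof. by rewrite /hnorm hip0r sqrtr0. Qed.

Lemma hnormZ (k : R[i]) x : hnorm (k *: x) = complex.Re `|k| * hnorm x.
Proof.
have k0 : 0 <= complex.Re `|k| by have := normr_ge0 k; rewrite lecE => /andP[].
apply/eqP; rewrite -(@eqrXn2 _ 2) // ?mulr_ge0 ?hnorm_ge0 //.
rewrite hnorm_sqr hipZr hipZl mulrA -normCK hip_xx normc_Re -rmorphXn -rmorphM /=.
by rewrite exprMn.
Qed.

Lemma hnormN x : hnorm (- x) = hnorm x.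
Proof. by rewrite /hnorm hipNr hipNl opprK. Qed.

Lemma hip_CS x y : complex.Re `|hip x y| <= hnorm x * hnorm y.
Proof.
have [y0|yN0] := eqVneq (hnorm y) 0.
  by rewrite y0 mulr0 (hnorm0_eq0 y0) hip0r normr0.
have yp : 0 < hnorm y by rewrite lt_def yN0 hnorm_ge0.
have n0 : 0 <= complex.Re `|hip x y|.
  by have := normr_ge0 (hip x y); rewrite lecE => /andP[].
rewrite -(@ler_pXn2r _ 2) ?nnegrE ?mulr_ge0 ?hnorm_ge0 //.
(* [c *: y] is the orthogonal projection of [x] onto the line of [y]; the product is
   conjugate-linear on the left. *)
pose c := hip y x / (hnorm y ^+ 2)%:C.
have yi : (hnorm y ^+ 2)%:C != 0 :> R[i] by rewrite fmorph_eq0 sqrf_eq0.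
have cJ : c^* = hip x y / (hnorm y ^+ 2)%:C.
  by rewrite /c rmorphM /= -hipC fmorphV /= conj_real.
have e : hip y x * hip x y = (complex.Re `|hip x y| ^+ 2)%:C.
  by rewrite (hipC x y) mulrC -normCK normc_Re -rmorphXn.
have := Re_hip_ge0 (x - c *: y).
rewrite !hipDl !hipDr !hipNl !hipNr !hipZl !hipZr !hip_xx cJ.
rewrite (_ : _ + _ = (hnorm x ^+ 2 - complex.Re `|hip x y| ^+ 2 / hnorm y ^+ 2)%:C).
  by rewrite /= subr_ge0 ler_pdivrMr ?exprn_gt0 // -exprMn.
rewrite rmorphB (rmorphM _ _ (_^-1)) fmorphV /= -e /c; field.
by rewrite /= fmorph_eq0.
Qed.

Lemma ler_hnormD x y : hnorm (x + y) <= hnorm x + hnorm y.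
Proof.
rewrite -(@ler_pXn2r _ 2) ?nnegrE ?addr_ge0 ?hnorm_ge0 //.
rewrite hnorm_sqr hipDl !hipDr !ReD -!hnorm_sqr sqrrD.
have := le_trans (Re_le_norm _) (hip_CS x y).
rewrite [hip y x]hipC Re_conjc; lra.
Qed.

End HilbertTheory.

(* The adjoint is part of the data, so that the Riesz representation theorem is
   not needed; it is determined by [bfun], see [bopE]. *)
Record bop (R : realType) (H : hilbert R) := Bop {
  bfun :> H -> H ;
  badj : H -> H ;
  badjP : forall x y, hip (bfun x) y = hip x (badj y) ;
  bopP : exists2 K : R, 0 <= K & forall x, hnorm (bfun x) <= K * hnorm x
}.

Section BoundedOperators.
Variables (R : realType) (H : hilbert R).
Implicit Types (x y : H) (S T : bop H).

Lemma badjPl T x y : hip (badj T x) y = hip x (T y).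
Proof. by rewrite hipC -badjP -hipC. Qed.

Lemma bopE S T : S =1 T -> S = T.
Proof.
case: S T => [f f' fP fb] [g g' gP gb] /= fg.
have e : f = g by exact: funext.
subst g; have e' : f' = g'.
  apply: funext => y; apply: hip_inj => x; by rewrite -fP -gP.
subst g'; by rewrite (Prop_irrelevance fP gP) (Prop_irrelevance fb gb).
Qed.

Lemma bopD T x y : T (x + y) = T x + T y.
Proof. by apply: hip_inj_l => z; rewrite badjP !hipDl !badjP. Qed.

Lemma bopZ T k x : T (k *: x) = k *: T x.
Proof. by apply: hip_inj_l => z; rewrite badjP !hipZl !badjP. Qed.

Lemma bop0 T : T 0 = 0.
Proof. by rewrite -(scale0r (0 : H)) bopZ !scale0r. Qed.

Lemma badj_bounded T : exists2 K : R, 0 <= K & forall x, hnorm (badj T x) <= K * hnorm x.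
Proof.
have [K K0 TK] := bopP T; exists K => // x.
have [z|nz] := eqVneq (hnorm (badj T x)) 0; first by rewrite z mulr_ge0 ?hnorm_ge0.
have p : 0 < hnorm (badj T x) by rewrite lt_def nz hnorm_ge0.
rewrite -(ler_pM2r p) -expr2 hnorm_sqr badjPl.
apply: le_trans (Re_le_norm _) _; apply: le_trans (hip_CS _ _) _.
by rewrite [K * _]mulrC -mulrA ler_wpM2l ?hnorm_ge0.
Qed.

HB.instance Definition _ := gen_eqMixin (bop H).
HB.instance Definition _ := gen_choiceMixin (bop H).

Fact bzero_adj x y : hip (0 : H) y = hip x 0.
Proof. by rewrite hip0l hip0r. Qed.
Fact bzero_bd : exists2 K : R, 0 <= K & forall x, hnorm (0 : H) <= K * hnorm x.
Proof. by exists 0 => // x; rewrite hnorm0 mul0r. Qed.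
Definition bzero : bop H := @Bop R H (fun=> 0) (fun=> 0) bzero_adj bzero_bd.

Fact bone_bd : exists2 K : R, 0 <= K & forall x, hnorm x <= K * hnorm x.
Proof. by exists 1 => // x; rewrite mul1r. Qed.
Definition bone : bop H := @Bop R H id id (fun x y => erefl) bone_bd.

Fact badd_adj S T x y : hip (S x + T x) y = hip x (badj S y + badj T y).
Proof. by rewrite hipDl hipDr !badjP. Qed.
Fact badd_bd S T : exists2 K : R, 0 <= K & forall x, hnorm (S x + T x) <= K * hnorm x.
Proof.
have [K K0 KS] := bopP S; have [L L0 LT] := bopP T.
exists (K + L) => [|x]; first exact: addr_ge0.
by rewrite mulrDl (le_trans (ler_hnormD _ _)) // lerD.
Qed.
Definition badd S T : bop H :=
  @Bop R H (fun x => S x + T x) (fun x => badj S x + badj T x) (badd_adj S T) (badd_bd S T).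

Fact bscale_adj (k : R[i]) T x y : hip (k *: T x) y = hip x (k^* *: badj T y).
Proof. by rewrite hipZl hipZr badjP. Qed.
Fact bscale_bd (k : R[i]) T : exists2 K : R, 0 <= K & forall x, hnorm (k *: T x) <= K * hnorm x.
Proof.
have [K K0 KT] := bopP T.
have k0 : 0 <= complex.Re `|k| by have := normr_ge0 k; rewrite lecE => /andP[].
exists (complex.Re `|k| * K) => [|x]; first exact: mulr_ge0.
by rewrite hnormZ -mulrA ler_wpM2l.
Qed.
Definition bscale (k : R[i]) T : bop H :=
  @Bop R H (fun x => k *: T x) (fun x => k^* *: badj T x) (bscale_adj k T) (bscale_bd k T).

Fact bmul_adj S T x y : hip (S (T x)) y = hip x (badj T (badj S y)).
Proof. by rewrite !badjP. Qed.
Fact bmul_bd S T : exists2 K : R, 0 <= K & forall x, hnorm (S (T x)) <= K * hnorm x.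
Proof.
have [K K0 KS] := bopP S; have [L L0 LT] := bopP T.
exists (K * L) => [|x]; first exact: mulr_ge0.
by rewrite (le_trans (KS _)) // -mulrA ler_wpM2l.
Qed.
Definition bmul S T : bop H :=
  @Bop R H (fun x => S (T x)) (fun x => badj T (badj S x)) (bmul_adj S T) (bmul_bd S T).

Definition bstar T : bop H := @Bop R H (badj T) T (badjPl T) (badj_bounded T).

Fact baddA : associative badd.
Proof. by move=> S T U; apply: bopE => x /=; rewrite addrA. Qed.
Fact baddC : commutative badd.
Proof. by move=> S T; apply: bopE => x /=; rewrite addrC. Qed.
Fact badd0 : left_id bzero badd.
Proof. by move=> S; apply: bopE => x /=; rewrite add0r. Qed.
Fact baddN : left_inverse bzero (bscale (-1)) badd.
Proof. by move=> S; apply: bopE => x /=; rewrite scaleN1r addNr. Qed.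

HB.instance Definition _ := GRing.isZmodule.Build (bop H) baddA baddC badd0 baddN.

Fact bmulA : associative bmul.
Proof. by move=> S T U; apply: bopE. Qed.
Fact bmul1l : left_id bone bmul.
Proof. by move=> S; apply: bopE. Qed.
Fact bmul1r : right_id bone bmul.
Proof. by move=> S; apply: bopE. Qed.
Fact bmulDl : left_distributive bmul badd.
Proof. by move=> S T U; apply: bopE. Qed.
Fact bmulDr : right_distributive bmul badd.
Proof. by move=> S T U; apply: bopE => x /=; rewrite bopD. Qed.
Fact bone_neq0 : bone != 0.
Proof.
apply/eqP => e; have : bone (@hilbert_unit R H) = bzero (@hilbert_unit R H) by rewrite e.
by move=> /= u0; have := hip_unit H; rewrite u0 hip0r => /esym/eqP; rewrite oner_eq0.
Qed.

HB.instance Definition _ := GRing.Zmodule_isNzRing.Build (bop H)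
  bmulA bmul1l bmul1r bmulDl bmulDr bone_neq0.

Fact bscaleA k l T : bscale k (bscale l T) = bscale (k * l) T.
Proof. by apply: bopE => x /=; rewrite scalerA. Qed.
Fact bscale1 : left_id 1 bscale.
Proof. by move=> T; apply: bopE => x /=; rewrite scale1r. Qed.
Fact bscaleDr : right_distributive bscale +%R.
Proof. by move=> k S T; apply: bopE => x /=; rewrite scalerDr. Qed.
Fact bscaleDl T : {morph bscale^~ T : k l / k + l}.
Proof. by move=> k l; apply: bopE => x /=; rewrite scalerDl. Qed.

HB.instance Definition _ := GRing.Zmodule_isLmodule.Build R[i] (bop H)
  bscaleA bscale1 bscaleDr bscaleDl.

Fact bscaleAl (k : R[i]) (S T : bop H) : k *: (S * T) = (k *: S) * T.
Proof. by apply: bopE. Qed.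
HB.instance Definition _ := GRing.Lmodule_isLalgebra.Build R[i] (bop H) bscaleAl.
Fact bscaleAr (k : R[i]) (S T : bop H) : k *: (S * T) = S * (k *: T).
Proof. by apply: bopE => x /=; rewrite bopZ. Qed.
HB.instance Definition _ := GRing.Lalgebra_isAlgebra.Build R[i] (bop H) bscaleAr.

Definition bnorm T : R := inf [set K | 0 <= K /\ forall x, hnorm (T x) <= K * hnorm x].

Lemma bnorm_has_inf T : has_inf [set K : R | 0 <= K /\ forall x, hnorm (T x) <= K * hnorm x].
Proof.
split; first by have [K K0 KT] := bopP T; exists K.
by exists 0 => K [].
Qed.

Lemma bnorm_ge0 T : 0 <= bnorm T.
Proof. apply: lb_le_inf; [exact: (bnorm_has_inf T).1 | by move=> K []]. Qed.

Lemma bnorm_le T K : 0 <= K -> (forall x, hnorm (T x) <= K * hnorm x) -> bnorm T <= K.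
Proof. by move=> K0 KT; apply: (ge_inf (bnorm_has_inf T).2). Qed.

Lemma bnormP T x : hnorm (T x) <= bnorm T * hnorm x.
Proof.
have [x0|xN0] := eqVneq (hnorm x) 0.
  by rewrite (hnorm0_eq0 x0) bop0 hnorm0 mulr0.
have xp : 0 < hnorm x by rewrite lt_def xN0 hnorm_ge0.
rewrite -ler_pdivrMr //; apply: lb_le_inf; first exact: (bnorm_has_inf T).1.
by move=> K [K0 KT]; rewrite ler_pdivrMr.
Qed.

Fact bstarD S T : bstar (S + T) = bstar S + bstar T.
Proof. by apply: bopE. Qed.
Fact bstarZ k T : bstar (k *: T) = k^* *: bstar T.
Proof. by apply: bopE. Qed.
Fact bstarM S T : bstar (S * T) = bstar T * bstar S.
Proof. by apply: bopE. Qed.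
Fact bstarK T : bstar (bstar T) = T.
Proof. by apply: bopE. Qed.
Fact bnorm0_eq0 T : bnorm T = 0 -> T = 0.
Proof.
move=> T0; apply: bopE => x /=; apply: hnorm0_eq0; apply/eqP.
by rewrite eq_le hnorm_ge0 andbT; have := bnormP T x; rewrite T0 mul0r.
Qed.
Fact ler_bnormD S T : bnorm (S + T) <= bnorm S + bnorm T.
Proof.
apply: bnorm_le => [|x]; first by rewrite addr_ge0 ?bnorm_ge0.
by rewrite mulrDl (le_trans (ler_hnormD _ _)) // lerD ?bnormP.
Qed.
Fact ler_bnormM S T : bnorm (S * T) <= bnorm S * bnorm T.
Proof.
apply: bnorm_le => [|x]; first by rewrite mulr_ge0 ?bnorm_ge0.
by rewrite (le_trans (bnormP S _)) // -mulrA ler_wpM2l ?bnorm_ge0 ?bnormP.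
Qed.
Fact bnormZ (k : R[i]) T : (bnorm (k *: T))%:C = `|k| * (bnorm T)%:C.
Proof.
have le (l : R[i]) S : bnorm (l *: S) <= complex.Re `|l| * bnorm S.
  have l0 : 0 <= complex.Re `|l| by have := normr_ge0 l; rewrite lecE => /andP[].
  apply: bnorm_le => [|x]; first by rewrite mulr_ge0 ?bnorm_ge0.
  by rewrite [_ x]/= hnormZ -mulrA ler_wpM2l ?bnormP.
rewrite normc_Re -rmorphM; congr (_ %:C).
apply/eqP; rewrite eq_le le andTb.
have [->|k0] := eqVneq k 0; first by rewrite normr0 mul0r bnorm_ge0.
have kp : 0 < complex.Re `|k|.
  by move: (k0); rewrite -normr_gt0 ltcE => /andP[].
have := le k^-1 (k *: T); rewrite scalerA mulVf // scale1r.
rewrite normrV ?unitfE // {1}normc_Re -fmorphV /=.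
by rewrite mulrC ler_pdivlMr // mulrC.
Qed.
(** Cauchy-Schwarz applied to the square of |Tx|, which equals the product of x with (star T) T x.
    With submultiplicativity this inequality yields both the equality of the norms of T and its
    adjoint and the C*-identity. *)
Lemma bnorm_star_le T : bnorm T ^+ 2 <= bnorm (bstar T * T).
Proof.
have s0 := sqrtr_ge0 (bnorm (bstar T * T)).
rewrite -[X in _ <= X]sqr_sqrtr ?bnorm_ge0 // ler_pXn2r ?nnegrE ?bnorm_ge0 //.
apply: bnorm_le => // x.
rewrite -(@ler_pXn2r _ 2) ?nnegrE ?mulr_ge0 ?hnorm_ge0 //.
rewrite exprMn hnorm_sqr badjP sqr_sqrtr ?bnorm_ge0 //.
apply: le_trans (Re_le_norm _) _; apply: le_trans (hip_CS _ _) _.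
by rewrite mulrC expr2 mulrA ler_wpM2r ?hnorm_ge0 // (bnormP (bstar T * T)).
Qed.
Lemma bnorm_star_ge T : bnorm T <= bnorm (bstar T).
Proof.
have [->|T0] := eqVneq (bnorm T) 0; first exact: bnorm_ge0.
have p : 0 < bnorm T by rewrite lt_def T0 bnorm_ge0.
by rewrite -(ler_pM2r p) -expr2 (le_trans (bnorm_star_le T)) // ler_bnormM.
Qed.
Fact bnorm_starM T : bnorm (bstar T * T) = bnorm T ^+ 2.
Proof.
apply/eqP; rewrite eq_le bnorm_star_le andbT (le_trans (ler_bnormM _ _)) //.
rewrite expr2 ler_wpM2r ?bnorm_ge0 //.
by have := bnorm_star_ge (bstar T); rewrite bstarK.
Qed.
Lemma bnorm_star T : bnorm (bstar T) = bnorm T.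
Proof.
apply/eqP; rewrite eq_le; apply/andP; split; last exact: bnorm_star_ge.
by have := bnorm_star_ge (bstar T); rewrite bstarK.
Qed.

Lemma badj_bnormP T x : hnorm (badj T x) <= bnorm T * hnorm x.
Proof. by rewrite -bnorm_star; exact: (bnormP (bstar T)). Qed.

Lemma bopBE S T x : (S - T) x = S x - T x.
Proof. by rewrite [LHS]/= scaleN1r. Qed.

Lemma badjBE S T x : badj (S - T) x = badj S x - badj T x.
Proof. by rewrite [LHS]/= rmorphN1 scaleN1r. Qed.

Fact bnorm_complete (a : nat -> bop H) :
  (forall e : R, 0 < e -> exists N : nat, forall m n : nat,
     (N <= m)%N -> (N <= n)%N -> bnorm (a m - a n) < e) ->
  exists l : bop H, bnorm (a n - l) @[n --> \oo] --> (0 : R).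
Proof.
move=> ca.
(* Stated for an arbitrary [f] so that it produces the pointwise limits of the operators and of
   their adjoints alike. *)
have pw (f : bop H -> H -> H) :
    (forall S T x, hnorm (f S x - f T x) <= bnorm (S - T) * hnorm x) ->
    forall x, exists l : H, forall e : R, 0 < e ->
      exists N : nat, forall m, (N <= m)%N -> hnorm (f (a m) x - l) < e.
  move=> fP x; apply: hilbert_complete => e e0.
  have d0 : 0 < e / (hnorm x + 1) by rewrite divr_gt0 ?ltr_wpDl ?hnorm_ge0.
  have [N NP] := ca _ d0; exists N => m n Nm Nn.
  apply: le_lt_trans (fP _ _ _) _.
  apply: (@le_lt_trans _ _ (bnorm (a m - a n) * (hnorm x + 1))).
    by rewrite ler_wpM2l ?bnorm_ge0 // lerDl.
  by rewrite -ltr_pdivlMr ?NP // ltr_wpDl ?hnorm_ge0.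
have bP S T x : hnorm (S x - T x) <= bnorm (S - T) * hnorm x.
  by rewrite -bopBE bnormP.
have aP S T x : hnorm (badj S x - badj T x) <= bnorm (S - T) * hnorm x.
  by rewrite -badjBE badj_bnormP.
have [l lP] := choice (pw (@bfun R H) bP).
have [l' lP'] := choice (pw (@badj R H) aP).
(* The rank [N] is independent of [x]: the comparison index [k] may depend on [x], but it disappears
   from the estimate. This uniformity turns pointwise convergence into norm convergence. *)
have near_l e : 0 < e -> exists N, forall m x, (N <= m)%N ->
    hnorm (a m x - l x) <= e * hnorm x.
  move=> e0; have [N NP] := ca _ e0; exists N => m x Nm.
  apply/ler_addgt0Pr => d d0; have [N' NP'] := lP x d d0.
  have := NP' _ (leq_maxr N N'); set k := maxn N N' => kd.
  rewrite -(subrK (a k x) (a m x)) -addrA (le_trans (ler_hnormD _ _)) // lerD //.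
    rewrite (le_trans (bP _ _ _)) // ler_wpM2r ?hnorm_ge0 // ltW // NP //.
    exact: leq_maxl.
  exact: ltW.
(* Adding 1 to the norm in the denominators below avoids treating the zero vector apart. *)
have shrink (t d : R) : 0 <= t -> 0 < d -> d / (t + 1) * t <= d.
  move=> t0 d0; rewrite mulrAC ler_pdivrMr ?ltr_wpDl // ler_wpM2l ?lerDl //.
  exact: ltW.
have adj x y : hip (l x) y = hip x (l' y).
  apply/eqP; rewrite -subr_eq0 -normr_eq0 normc_Re fmorph_eq0.
  rewrite eq_le; apply/andP; split; last first.
    by have := normr_ge0 (hip (l x) y - hip x (l' y)); rewrite lecE => /andP[].
  apply/ler_addgt0Pr => e e0; rewrite add0r.
  have dy : 0 < e / 2 / (hnorm y + 1) by rewrite !divr_gt0 ?ltr_wpDl ?hnorm_ge0.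
  have dx : 0 < e / 2 / (hnorm x + 1) by rewrite !divr_gt0 ?ltr_wpDl ?hnorm_ge0.
  have [N NP] := lP x _ dy; have [N' NP'] := lP' y _ dx.
  have := NP _ (leq_maxl N N'); have := NP' _ (leq_maxr N N').
  set k := maxn N N' => ky kx.
  have -> : hip (l x) y - hip x (l' y) =
      hip x (badj (a k) y - l' y) - hip (a k x - l x) y.
    rewrite hipDl hipNl hipDr hipNr badjP; ring.
  have tri u v : complex.Re `|u - v : R[i]| <= complex.Re `|u| + complex.Re `|v|.
    by rewrite -ReD; have := ler_normB u v; rewrite lecE => /andP[].
  apply: le_trans (tri _ _) _.
  apply: le_trans (lerD (hip_CS _ _) (hip_CS _ _)) _.
  rewrite [leRHS]splitr; apply: lerD.
    rewrite mulrC; apply: le_trans (ler_wpM2r (hnorm_ge0 _) (ltW ky)) _.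
    by apply: shrink; rewrite ?hnorm_ge0 ?divr_gt0.
  apply: le_trans (ler_wpM2r (hnorm_ge0 _) (ltW kx)) _.
  by apply: shrink; rewrite ?hnorm_ge0 ?divr_gt0.
have bd : exists2 K : R, 0 <= K & forall x, hnorm (l x) <= K * hnorm x.
  have [N NP] := near_l 1 ltr01; exists (bnorm (a N) + 1) => [|x].
    by rewrite addr_ge0 ?bnorm_ge0.
  rewrite -(subKr (a N x) (l x)) (le_trans (ler_hnormD _ _)) // hnormN.
  by rewrite mulrDl lerD ?bnormP ?NP.
exists (@Bop R H l l' adj bd); apply/cvgrPdist_le => e e0.
have [N NP] := near_l e e0; exists N => // m /= Nm.
rewrite sub0r normrN ger0_norm ?bnorm_ge0 //; apply: bnorm_le; first exact: ltW.
by move=> x; rewrite bopBE NP.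
Qed.

HB.instance Definition _ := Algebra_isCStarAlgebra.Build R (bop H)
  bstarD bstarZ bstarM bstarK bnorm_ge0 bnorm0_eq0 ler_bnormD bnormZ ler_bnormM
  bnorm_starM bnorm_complete.

End BoundedOperators.

(** * Square-summable sequences of matrices *)

Notation "M ^H" := (map_mx Num.conj M^T) (at level 8, format "M ^H") : ring_scope.

Section MatrixInnerProduct.
Variable R : realType.
Notation C := R[i].

Lemma adjmxD m n (X Y : 'M[C]_(m, n)) : (X + Y)^H = X^H + Y^H.
Proof. by apply/matrixP => i j; rewrite !mxE rmorphD. Qed.

Lemma adjmxM m n p (X : 'M[C]_(m, n)) (Y : 'M[C]_(n, p)) : (X *m Y)^H = Y^H *m X^H.
Proof. by rewrite trmx_mul map_mxM. Qed.

Lemma adjmxK m n (X : 'M[C]_(m, n)) : X^H^H = X.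
Proof. by apply/matrixP => i j; rewrite !mxE conjCK. Qed.

Lemma adjmxZ m n k (X : 'M[C]_(m, n)) : (k *: X)^H = k^* *: X^H.
Proof. by apply/matrixP => i j; rewrite !mxE rmorphM. Qed.

Lemma adjmx_sum m n (I : Type) (r : seq I) (P : pred I) (F : I -> 'M[C]_(m, n)) :
  (\sum_(i <- r | P i) F i)^H = \sum_(i <- r | P i) (F i)^H.
Proof.
apply: (big_morph (fun M : 'M[C]_(m, n) => M^H) (@adjmxD m n)).
by apply/matrixP => i j; rewrite !mxE conjC0.
Qed.

Definition mip m n (X Y : 'M[C]_(m, n)) : C := \tr (X^H *m Y).

Lemma mipE m n (X Y : 'M[C]_(m, n)) : mip X Y = \sum_j \sum_i (X i j)^* * Y i j.
Proof.
by apply: eq_bigr => j _; rewrite mxE; apply: eq_bigr => i _; rewrite !mxE.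
Qed.

Lemma mipDr m n (X Y Z : 'M[C]_(m, n)) : mip X (Y + Z) = mip X Y + mip X Z.
Proof. by rewrite /mip mulmxDr mxtraceD. Qed.

Lemma mipZr m n k (X Y : 'M[C]_(m, n)) : mip X (k *: Y) = k * mip X Y.
Proof. by rewrite /mip -scalemxAr mxtraceZ. Qed.

Lemma mipC m n (X Y : 'M[C]_(m, n)) : mip Y X = (mip X Y)^*.
Proof.
rewrite !mipE rmorph_sum; apply: eq_bigr => j _; rewrite rmorph_sum.
by apply: eq_bigr => i _; rewrite rmorphM /= conjCK mulrC.
Qed.

Lemma mipDl m n (X Y Z : 'M[C]_(m, n)) : mip (X + Y) Z = mip X Z + mip Y Z.
Proof. by rewrite mipC mipDr rmorphD /= -!mipC. Qed.

Lemma mip_adjl m n p (A : 'M[C]_(m, n)) (X : 'M[C]_(n, p)) Y :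
  mip (A *m X) Y = mip X (A^H *m Y).
Proof. by rewrite /mip adjmxM mulmxA. Qed.

Lemma mip_adjr m n p (A : 'M[C]_(n, p)) (X : 'M[C]_(m, n)) Y :
  mip (X *m A) Y = mip X (Y *m A^H).
Proof. by rewrite /mip adjmxM -mulmxA mxtrace_mulC mulmxA. Qed.

Definition sqm m n (X : 'M[C]_(m, n)) : R := complex.Re (mip X X).

Lemma Re_sum (I : Type) (r : seq I) (P : pred I) (F : I -> C) :
  complex.Re (\sum_(i <- r | P i) F i) = \sum_(i <- r | P i) complex.Re (F i).
Proof. exact: (big_morph _ (@ReD R)). Qed.

Lemma Im_sum (I : Type) (r : seq I) (P : pred I) (F : I -> C) :
  complex.Im (\sum_(i <- r | P i) F i) = \sum_(i <- r | P i) complex.Im (F i).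
Proof. exact: (big_morph _ (@ImD R)). Qed.

Lemma sqmE m n (X : 'M[C]_(m, n)) :
  sqm X = \sum_j \sum_i (complex.Re (X i j) ^+ 2 + complex.Im (X i j) ^+ 2).
Proof.
rewrite /sqm mipE Re_sum; apply: eq_bigr => j _; rewrite Re_sum.
by apply: eq_bigr => i _; case: (X i j) => a b /=; rewrite mulNr opprK.
Qed.

Lemma sqm_ge0 m n (X : 'M[C]_(m, n)) : 0 <= sqm X.
Proof. by rewrite sqmE; do 2!apply: sumr_ge0 => ? _; rewrite addr_ge0 ?sqr_ge0. Qed.

Lemma mip_real m n (X : 'M[C]_(m, n)) : mip X X = (sqm X)%:C.
Proof.
rewrite mipE sqmE rmorph_sum; apply: eq_bigr => j _.
rewrite rmorph_sum; apply: eq_bigr => i _; rewrite mulrC -normCK.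
by rewrite -add_Re2_Im2.
Qed.

Lemma entry_le_sqm m n (X : 'M[C]_(m, n)) i j :
  complex.Re (X i j) ^+ 2 + complex.Im (X i j) ^+ 2 <= sqm X.
Proof.
rewrite sqmE (bigD1 j) //= (bigD1 i) //= -addrA lerDl addr_ge0 //.
  by apply: sumr_ge0 => ? _; rewrite addr_ge0 ?sqr_ge0.
by do 2!apply: sumr_ge0 => ? _; rewrite addr_ge0 ?sqr_ge0.
Qed.

Lemma sqm_eq0 m n (X : 'M[C]_(m, n)) : sqm X <= 0 -> X = 0.
Proof.
move=> X0; apply/matrixP => i j; rewrite mxE.
have := le_trans (entry_le_sqm X i j) X0.
case: (X i j) => a b /= ab; apply/eqP; rewrite eq_complex /=.
have a2 := sqr_ge0 a; have b2 := sqr_ge0 b.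
by rewrite -[a == 0]sqrf_eq0 -[b == 0]sqrf_eq0; apply/andP; split; apply/eqP; lra.
Qed.

Lemma sqmZ m n k (X : 'M[C]_(m, n)) : sqm (k *: X) = complex.Re `|k| ^+ 2 * sqm X.
Proof.
rewrite /sqm mipZr (mipC _ (k *: X)) mipZr rmorphM mulrA -normCK mip_real [X in _ * X]conj_real.
by rewrite normc_Re -rmorphXn -rmorphM.
Qed.

Lemma sqmN m n (X : 'M[C]_(m, n)) : sqm (- X) = sqm X.
Proof. by rewrite -scaleN1r sqmZ normrN normr1 /= expr1n mul1r. Qed.

Lemma sqmD m n (X Y : 'M[C]_(m, n)) :
  sqm (X + Y) = sqm X + sqm Y + 2 * complex.Re (mip X Y).
Proof.
rewrite /sqm mipDl !mipDr !ReD (mipC X Y) Re_conjc; lra.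
Qed.

Lemma mipNr m n (X Y : 'M[C]_(m, n)) : mip X (- Y) = - mip X Y.
Proof. by rewrite -scaleN1r mipZr mulN1r. Qed.

Lemma sqmD_le m n (X Y : 'M[C]_(m, n)) : sqm (X + Y) <= 2 * (sqm X + sqm Y).
Proof.
have := sqm_ge0 (X - Y); rewrite !sqmD sqmN mipNr ReN; lra.
Qed.

Lemma norm_Re_mip m n (X Y : 'M[C]_(m, n)) : `|complex.Re (mip X Y)| <= sqm X + sqm Y.
Proof.
have := sqm_ge0 (X - Y); have := sqm_ge0 (X + Y).
have := sqm_ge0 X; have := sqm_ge0 Y.
rewrite !sqmD sqmN mipNr ReN ler_norml => *; apply/andP; split; lra.
Qed.

(** The product of X with iY has real part minus the imaginary part wanted, and iY has the size of
    Y. *)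
Lemma norm_Im_mip m n (X Y : 'M[C]_(m, n)) : `|complex.Im (mip X Y)| <= sqm X + sqm Y.
Proof.
have := norm_Re_mip X ('i%C *: Y); rewrite mipZr mulrC ReiNIm normrN.
by rewrite sqmZ normc_def /= expr0n expr1n add0r sqrtr1 expr1n mul1r.
Qed.

End MatrixInnerProduct.

(** * Convergence of complex sequences through real and imaginary parts *)

Section ComplexLimits.
Variable R : realType.
Notation C := R[i].
Implicit Types (u v : nat -> C) (l k : C).

(** Coordinatewise convergence lets the real theory of series apply; [ccvg_cvg] returns to the
    topology of [R[i]^o] where [csum] requires it. *)
Definition ccvg u l :=
  (complex.Re (u n) @[n --> \oo] --> complex.Re l) /\
  (complex.Im (u n) @[n --> \oo] --> complex.Im l).

Lemma ccvg_unique u l k : ccvg u l -> ccvg u k -> l = k.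
Proof.
case: l k => a b [c d] [/= ua ub] [/= uc ud].
by rewrite (cvg_unique _ ua uc) // (cvg_unique _ ub ud).
Qed.

Lemma ccvgD u v l k : ccvg u l -> ccvg v k -> ccvg (fun n => u n + v n) (l + k).
Proof.
move=> [ul ul'] [vk vk']; split.
  by rewrite ReD; under eq_cvg do rewrite ReD; exact: cvgD.
by rewrite ImD; under eq_cvg do rewrite ImD; exact: cvgD.
Qed.

Lemma ReM k l : complex.Re (k * l) =
  complex.Re k * complex.Re l - complex.Im k * complex.Im l.
Proof. by case: k; case: l. Qed.

Lemma ImM k l : complex.Im (k * l) =
  complex.Re k * complex.Im l + complex.Im k * complex.Re l.
Proof. by case: k; case: l. Qed.

Lemma ccvgZ u l k : ccvg u l -> ccvg (fun n => k * u n) (k * l).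
Proof.
move=> [ul ul']; split.
  rewrite ReM; under eq_cvg do rewrite ReM.
  by apply: cvgB; apply: cvgMr.
rewrite ImM; under eq_cvg do rewrite ImM.
by apply: cvgD; apply: cvgMr.
Qed.

Lemma ccvgJ u l : ccvg u l -> ccvg (fun n => (u n)^*) l^*.
Proof.
move=> [ul ul']; split.
  by rewrite Re_conjc; under eq_cvg do rewrite Re_conjc.
by rewrite Im_conjc; under eq_cvg do rewrite Im_conjc; exact: cvgN.
Qed.

Lemma dominated_series_cvg (a b : nat -> R) K :
  (forall j : nat, `|a j| <= b j) -> (forall N : nat, \sum_(j < N) b j <= K) ->
  cvgn (fun N => \sum_(j < N) a j).
Proof.
move=> ab bK.
have -> : (fun N => \sum_(j < N) a j) = series a.
  by apply: funext => N; rewrite /series /= big_mkord.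
apply: normed_cvg; apply: nondecreasing_is_cvgn.
  by apply: nondecreasing_series => n *; rewrite /= normr_ge0.
exists K => _ [N _ <-]; apply: le_trans (bK N).
rewrite (_ : [normed series a] N = \sum_(j < N) `|a j|); last first.
  by rewrite -(big_mkord xpredT (fun j => `|a j|)).
by apply: ler_sum => j _; exact: ab.
Qed.

Lemma cvg_sum_ord (I : finType) (f : nat -> I -> R) (g : I -> R) :
  (forall i, f n i @[n --> \oo] --> g i) ->
  (\sum_i f n i) @[n --> \oo] --> \sum_i g i.
Proof.
move=> fg; elim: (index_enum I) => [|i s IH].
  by rewrite big_nil; under eq_cvg do rewrite big_nil; exact: cvg_cst.
by rewrite big_cons; under eq_cvg do rewrite big_cons; exact: cvgD.
Qed.

Lemma cvg_sqrB_sum (a b : R) (f g : nat -> R) (s t : R) :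
  f n @[n --> \oo] --> s -> g n @[n --> \oo] --> t ->
  ((a - f n) ^+ 2 + (b - g n) ^+ 2) @[n --> \oo] -->
    (a - s) * (a - s) + (b - t) * (b - t).
Proof.
move=> fs gt; apply: cvgD; apply: cvgM; apply: cvgB => //; exact: cvg_cst.
Qed.

Lemma cauchy_real_cvg (a : nat -> R) :
  (forall e : R, 0 < e -> exists N, forall m n, (N <= m)%N -> (N <= n)%N ->
     `|a m - a n| < e) ->
  exists b : R, a n @[n --> \oo] --> b.
Proof.
move=> ca; suff : cvgn a by move=> c; exists (limn a).
apply/cauchy_cvgP; apply: cauchy_exP => e e0.
have [N NP] := ca e e0; exists (a N), N => // m /= Nm.
by rewrite /ball /=; exact: NP.
Qed.

End ComplexLimits.

(** A square matrix of size [d k], with the Hilbert-Schmidt product, stands for a vector of the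
    tensor product of a [d k]-dimensional space with its conjugate. Bounded partial sums are how
    square-summability is expressed. *)
Record l2sum (R : realType) (d : nat -> nat) := L2sum {
  l2fun :> forall k, 'M[R[i]]_(d k) ;
  l2P : exists K : R, forall N, \sum_(k < N) sqm (l2fun k) <= K
}.

Section L2Sum.
Variables (R : realType) (d : nat -> nat).
Notation C := R[i].
Notation l2 := (l2sum R d).
Implicit Types x y z : l2.

Lemma l2E x y : (forall k, x k = y k) -> x = y.
Proof.
case: x y => [f fP] [g gP] /= fg.
have e : f = g by exact: functional_extensionality_dep.
by subst g; rewrite (Prop_irrelevance fP gP).
Qed.

HB.instance Definition _ := gen_eqMixin l2.
HB.instance Definition _ := gen_choiceMixin l2.

Fact l2zeroP : exists K : R, forall N, \sum_(k < N) sqm (0 : 'M[C]_(d k)) <= K.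
Proof.
exists 0 => N; rewrite big1 // => k _.
by rewrite sqmE; do 2!(apply: big1 => ? _); rewrite mxE /= expr0n addr0.
Qed.
Definition l2zero : l2 := @L2sum R d (fun k => 0) l2zeroP.

Fact l2addP x y : exists K : R, forall N, \sum_(k < N) sqm (x k + y k) <= K.
Proof.
have [K xK] := l2P x; have [L yL] := l2P y; exists (2 * (K + L)) => N.
apply: (@le_trans _ _ (\sum_(k < N) 2 * (sqm (x k) + sqm (y k)))).
  by apply: ler_sum => k _; exact: sqmD_le.
by rewrite -mulr_sumr ler_wpM2l // big_split lerD.
Qed.
Definition l2add x y : l2 := @L2sum R d (fun k => x k + y k) (l2addP x y).

Fact l2scaleP (c : C) x : exists K : R, forall N, \sum_(k < N) sqm (c *: x k) <= K.
Proof.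
have [K xK] := l2P x; exists (complex.Re `|c| ^+ 2 * K) => N.
under eq_bigr do rewrite sqmZ.
by rewrite -mulr_sumr ler_wpM2l // sqr_ge0.
Qed.
Definition l2scale c x : l2 := @L2sum R d (fun k => c *: x k) (l2scaleP c x).

Fact l2addA : associative l2add.
Proof. by move=> x y z; apply: l2E => k /=; rewrite addrA. Qed.
Fact l2addC : commutative l2add.
Proof. by move=> x y; apply: l2E => k /=; rewrite addrC. Qed.
Fact l2add0 : left_id l2zero l2add.
Proof. by move=> x; apply: l2E => k /=; rewrite add0r. Qed.
Fact l2addN : left_inverse l2zero (l2scale (-1)) l2add.
Proof. by move=> x; apply: l2E => k /=; rewrite scaleN1r addNr. Qed.
HB.instance Definition _ := GRing.isZmodule.Build l2 l2addA l2addC l2add0 l2addN.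

Fact l2scaleA c e x : l2scale c (l2scale e x) = l2scale (c * e) x.
Proof. by apply: l2E => k /=; rewrite scalerA. Qed.
Fact l2scale1 : left_id 1 l2scale.
Proof. by move=> x; apply: l2E => k /=; rewrite scale1r. Qed.
Fact l2scaleDr : right_distributive l2scale +%R.
Proof. by move=> c x y; apply: l2E => k /=; rewrite scalerDr. Qed.
Fact l2scaleDl x : {morph l2scale^~ x : c e / c + e}.
Proof. by move=> c e; apply: l2E => k /=; rewrite scalerDl. Qed.
HB.instance Definition _ := GRing.Zmodule_isLmodule.Build C l2
  l2scaleA l2scale1 l2scaleDr l2scaleDl.

Lemma l2BE x y k : (x - y) k = x k - y k.
Proof. by rewrite [LHS]/= scaleN1r. Qed.

Definition l2ip x y : C :=
  limn (fun N => \sum_(k < N) complex.Re (mip (x k) (y k))) +i*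
  limn (fun N => \sum_(k < N) complex.Im (mip (x k) (y k))).

Lemma l2ipP x y : ccvg (fun N => \sum_(k < N) mip (x k) (y k)) (l2ip x y).
Proof.
have [K xK] := l2P x; have [L yL] := l2P y.
have b N : \sum_(k < N) (sqm (x k) + sqm (y k)) <= K + L by rewrite big_split lerD.
split; rewrite /=.
  under eq_cvg do rewrite Re_sum.
  apply: (@dominated_series_cvg _ (fun k => complex.Re (mip (x k) (y k))) _ _ _ b) => k.
  exact: norm_Re_mip.
under eq_cvg do rewrite Im_sum.
apply: (@dominated_series_cvg _ (fun k => complex.Im (mip (x k) (y k))) _ _ _ b) => k.
exact: norm_Im_mip.
Qed.

Lemma eq_ccvg (u v : nat -> C) l : u =1 v -> ccvg u l -> ccvg v l.
Proof. by move=> /funext ->. Qed.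

Lemma l2ip_eq x y l : ccvg (fun N => \sum_(k < N) mip (x k) (y k)) l -> l2ip x y = l.
Proof. by move=> h; apply: ccvg_unique (l2ipP x y) h. Qed.

Fact l2ipDr x y z : l2ip x (y + z) = l2ip x y + l2ip x z.
Proof.
apply: l2ip_eq; apply: eq_ccvg (ccvgD (l2ipP x y) (l2ipP x z)) => N /=.
by rewrite -big_split; apply: eq_bigr => k _; exact/esym/mipDr.
Qed.
Fact l2ipZr c x y : l2ip x (c *: y) = c * l2ip x y.
Proof.
apply: l2ip_eq; apply: eq_ccvg (ccvgZ c (l2ipP x y)) => N /=.
by rewrite mulr_sumr; apply: eq_bigr => k _; exact/esym/mipZr.
Qed.
Fact l2ipC x y : l2ip y x = (l2ip x y)^*.
Proof.
apply: l2ip_eq; apply: eq_ccvg (ccvgJ (l2ipP x y)) => N /=.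
by rewrite rmorph_sum; apply: eq_bigr => k _; rewrite [RHS]mipC.
Qed.

Lemma l2sq_cvg x : (\sum_(k < N) sqm (x k)) @[N --> \oo] --> complex.Re (l2ip x x).
Proof.
rewrite (_ : (fun N => _) = fun N => complex.Re (\sum_(k < N) mip (x k) (x k))).
  by have [] := l2ipP x x.
by apply: funext => N; rewrite Re_sum.
Qed.

Lemma sum_sqm_homo x : {homo (fun N => \sum_(k < N) sqm (x k)) : m n / (m <= n)%N >-> m <= n}.
Proof.
move=> m n mn; rewrite -!(big_mkord xpredT (fun k => sqm (x k))).
rewrite (@big_cat_nat _ _ _ m 0 n) //= lerDl.
by apply: sumr_ge0 => k _; exact: sqm_ge0.
Qed.

Lemma sum_sqm_le x N : \sum_(k < N) sqm (x k) <= complex.Re (l2ip x x).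
Proof.
have h := @l2sq_cvg x; rewrite -(cvg_lim _ h) //.
by apply: (nondecreasing_cvgn_le (@sum_sqm_homo x)); apply/cvg_ex; eexists; exact: h.
Qed.

Lemma sqm_le x k : sqm (x k) <= complex.Re (l2ip x x).
Proof.
apply: le_trans (sum_sqm_le x k.+1); rewrite big_ord_recr /= lerDr.
by apply: sumr_ge0 => j _; exact: sqm_ge0.
Qed.

Lemma l2sq_le x K : (forall N, \sum_(k < N) sqm (x k) <= K) ->
  complex.Re (l2ip x x) <= K.
Proof.
move=> xK; have h := @l2sq_cvg x; rewrite -(cvg_lim _ h) //.
by apply: limr_le; [apply/cvg_ex; eexists; exact: h | exact: nearW].
Qed.

Lemma l2ip_real x : l2ip x x = (complex.Re (l2ip x x))%:C.
Proof.
have [_ h] := l2ipP x x; apply/eqP; rewrite eq_complex /= eqxx /=; apply/eqP.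
suff h0 : complex.Im (\sum_(k < n) mip (x k) (x k)) @[n --> \oo] --> (0 : R).
  exact: (cvg_unique _ h h0).
rewrite (_ : (fun N => _) = fun=> 0); first exact: cvg_cst.
apply: funext => N; rewrite Im_sum.
by apply: big1 => k _; rewrite mip_real.
Qed.

Fact l2ip_ge0 x : 0 <= l2ip x x.
Proof.
rewrite l2ip_real ler0c; apply: le_trans (sum_sqm_le x 0).
by rewrite big_ord0.
Qed.
Fact l2ip_eq0 x : l2ip x x = 0 -> x = 0.
Proof.
move=> x0; apply: l2E => k; apply: sqm_eq0; apply: le_trans (sqm_le x k) _.
by rewrite x0.
Qed.

Fact l2_complete (x : nat -> l2) :
  (forall e : R, 0 < e -> exists N : nat, forall m n : nat,
     (N <= m)%N -> (N <= n)%N ->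
     Num.sqrt (complex.Re (l2ip (x m - x n) (x m - x n))) < e) ->
  exists l : l2, forall e : R, 0 < e -> exists N : nat, forall m : nat,
     (N <= m)%N -> Num.sqrt (complex.Re (l2ip (x m - l) (x m - l))) < e.
Proof.
move=> cx.
have ip0 y : 0 <= complex.Re (l2ip y y).
  by have := l2ip_ge0 y; rewrite lecE => /andP[].
have entry k i j m n : (complex.Re (x m k i j) - complex.Re (x n k i j)) ^+ 2 +
    (complex.Im (x m k i j) - complex.Im (x n k i j)) ^+ 2 <=
    complex.Re (l2ip (x m - x n) (x m - x n)).
  apply: le_trans (sqm_le _ k); rewrite l2BE.
  apply: le_trans (entry_le_sqm _ i j).
  by rewrite !mxE; case: (x m k i j) => a b; case: (x n k i j).
have small (t s e : R) : t ^+ 2 <= s -> Num.sqrt s < e -> `|t| < e.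
  move=> ts; apply: le_lt_trans; rewrite -sqrtr_sqr ler_sqrt //.
  exact: le_trans (sqr_ge0 _) ts.
have cvRe k i j : cvgn (fun m => complex.Re (x m k i j)).
  have [e e0|b ab] := @cauchy_real_cvg _ (fun m => complex.Re (x m k i j)).
    have [N NP] := cx e e0; exists N => m n Nm Nn; apply: small (NP m n Nm Nn).
    by apply: le_trans (entry k i j m n); rewrite lerDl sqr_ge0.
  by apply/cvg_ex; exists b.
have cvIm k i j : cvgn (fun m => complex.Im (x m k i j)).
  have [e e0|b ab] := @cauchy_real_cvg _ (fun m => complex.Im (x m k i j)).
    have [N NP] := cx e e0; exists N => m n Nm Nn; apply: small (NP m n Nm Nn).
    by apply: le_trans (entry k i j m n); rewrite lerDr sqr_ge0.
  by apply/cvg_ex; exists b.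
pose L k : 'M[C]_(d k) := \matrix_(i, j)
  (limn (fun m => complex.Re (x m k i j)) +i* limn (fun m => complex.Im (x m k i j))).
(* Only finitely many levels are sent to the limit; the resulting bounds do not depend on [N], which
   then goes to infinity, as in Fatou's lemma. *)
have limsq m N : (\sum_(k < N) sqm (x m k - x n k)) @[n --> \oo] -->
    \sum_(k < N) sqm (x m k - L k).
  apply: (@cvg_sum_ord R 'I_N (fun n (k : 'I_N) => sqm (x m k - x n k))) => k.
  rewrite sqmE (_ : (fun n => _) = fun n =>
    \sum_j \sum_i ((complex.Re (x m k i j) - complex.Re (x n k i j)) ^+ 2 +
                   (complex.Im (x m k i j) - complex.Im (x n k i j)) ^+ 2)); last first.
    apply: funext => n; rewrite sqmE.
    apply: eq_bigr => j _; apply: eq_bigr => i _; rewrite !mxE.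
    by case: (x m k i j) => a b; case: (x n k i j).
  apply: cvg_sum_ord => j; apply: cvg_sum_ord => i.
  rewrite !mxE ReD ImD !expr2 /=; case: (x m k i j) => a b /=.
  exact: (@cvg_sqrB_sum R a b _ _ _ _ (cvRe k i j) (cvIm k i j)).
have bound e : 0 < e -> exists N0, forall m, (N0 <= m)%N -> forall N,
    \sum_(k < N) sqm (x m k - L k) <= e ^+ 2.
  move=> e0; have [N0 NP] := cx e e0; exists N0 => m Nm N.
  rewrite -(cvg_lim _ (@limsq m N)) //; apply: limr_le.
    by apply/cvg_ex; eexists; exact: limsq.
  exists N0 => // n /= Nn.
  rewrite (_ : \sum_(k < N) _ = \sum_(k < N) sqm ((x m - x n) k)); last first.
    by apply: eq_bigr => k _; rewrite l2BE.
  apply: le_trans (sum_sqm_le _ _) _; rewrite -[leLHS]sqr_sqrtr //.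
  by rewrite ler_pXn2r ?nnegrE ?sqrtr_ge0 ?ltW //; exact: NP.
have LP : exists K : R, forall N, \sum_(k < N) sqm (L k) <= K.
  have [N0 NP] := bound 1 ltr01; have [K xK] := l2P (x N0).
  exists (2 * (K + 1)) => N.
  apply: (@le_trans _ _ (\sum_(k < N) 2 * (sqm (x N0 k) + sqm (x N0 k - L k)))).
    apply: ler_sum => k _; rewrite -[sqm (x N0 k - _)]sqmN.
    by apply: le_trans (sqmD_le _ _); rewrite opprB addrC subrK.
  rewrite -mulr_sumr ler_wpM2l // big_split /= lerD ?xK //.
  by have := NP _ (leqnn _) N; rewrite expr1n.
exists (@L2sum R d L LP) => e e0.
(* Limits preserve only weak inequalities; half of [e] restores the strict one. *)
have e20 : 0 < e / 2 by rewrite divr_gt0.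
have [N0 NP] := bound _ e20; exists N0 => m Nm.
apply: (@le_lt_trans _ _ (e / 2)); last by rewrite ltr_pdivrMr // ltr_pMr // ltr1n.
rewrite -(ger0_norm (ltW e20)) -sqrtr_sqr ler_sqrt ?sqr_ge0 //.
apply: l2sq_le => N; apply: le_trans (NP m Nm N).
by apply: ler_sum => k _; rewrite l2BE.
Qed.

Hypothesis d0 : d 0 = 1%N.

Definition l2unit_fun k : 'M[C]_(d k) := if k == 0%N then 1%:M else 0.

Lemma sqm0 m n : sqm (0 : 'M[C]_(m, n)) = 0.
Proof. by rewrite /sqm /mip mulmx0 mxtrace0. Qed.

Lemma sqm_l2unit k : sqm (l2unit_fun k) = (k == 0%N)%:R.
Proof.
rewrite /l2unit_fun; case: k => [|k] /=; last exact: sqm0.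
by rewrite /sqm /mip mulmx1 trmx1 map_mx1 mxtrace1 d0.
Qed.

Fact l2unitP : exists K : R, forall N, \sum_(k < N) sqm (l2unit_fun k) <= K.
Proof.
exists 1 => -[|N]; first by rewrite big_ord0.
rewrite big_ord_recl sqm_l2unit /= big1 ?addr0 // => k _.
by rewrite sqm_l2unit.
Qed.
Definition l2unit : l2 := L2sum l2unitP.

Fact l2ip_unit : l2ip l2unit l2unit = 1.
Proof.
rewrite l2ip_real (_ : complex.Re _ = 1) //.
apply/eqP; rewrite eq_le; apply/andP; split.
  apply: l2sq_le => -[|N]; first by rewrite big_ord0.
  rewrite big_ord_recl sqm_l2unit /= big1 ?addr0 // => k _.
  by rewrite sqm_l2unit.
by have := sqm_le l2unit 0; rewrite sqm_l2unit.
Qed.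

Definition l2hilbert : hilbert R :=
  Hilbert l2ipDr l2ipZr l2ipC l2ip_ge0 l2ip_eq0 l2_complete l2ip_unit.

End L2Sum.

(** * The Temperley-Lieb Fock space *)

Section OrthonormalComplement.
Variables (R : realType) (p m : nat) (V : 'M[R[i]]_(p, m)).

(** The rows form an orthonormal basis of the row vectors orthogonal to the rows of [V]; [row_base]
    makes the rows independent, so that Gram-Schmidt meets no zero vector. *)
Definition compl_basis := schmidt (row_base (kermx V^H)).

Lemma compl_basis_unitary : compl_basis *m compl_basis^H = 1%:M.
Proof. by apply/unitarymxP/schmidt_unitarymx; exact: rank_leq_col. Qed.

Lemma compl_basis_eq : (compl_basis :=: kermx V^H)%MS.
Proof.
apply: eqmx_trans (eq_row_base _).
by apply: eqmx_schmidt_free; exact: row_base_free.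
Qed.

Lemma compl_basis_ortho : compl_basis *m V^H = 0.
Proof. by apply/sub_kermxP; rewrite compl_basis_eq. Qed.

(** Both sides are the orthogonal projection onto the complement of the row space of [V]: under the
    hypothesis, V^H V / mu is the projection onto that row space. Writing P and M for the two sides,
    MP = M and PM = P, and taking adjoints of the latter gives P = M. *)
Lemma compl_basis_proj (mu : R) : mu != 0 -> V *m V^H = (mu%:C)%:M ->
  compl_basis^H *m compl_basis = 1%:M - (mu^-1)%:C *: (V^H *m V).
Proof.
move=> mu0 VV; set M := 1%:M - _; set Z := compl_basis.
have MH : M^H = M.
  rewrite /M adjmxD -scaleN1r adjmxZ adjmxZ adjmxM adjmxK trmx1 map_mx1.
  by rewrite rmorphN1 conj_real scaleN1r.
have MV : M *m V^H = 0.
  rewrite mulmxBl mul1mx -scalemxAl -mulmxA VV mul_mx_scalar scalerA.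
  by rewrite -rmorphM mulVf // scale1r subrr.
(* The rows of [M] are orthogonal to those of [V], hence combinations of the rows of [Z], and these
   are fixed by Z^H Z. *)
have MZ : M *m (Z^H *m Z) = M.
  have /submxP[D MD] : (M <= Z)%MS by rewrite compl_basis_eq; exact/sub_kermxP.
  by rewrite MD !mulmxA -(mulmxA D) compl_basis_unitary mulmx1.
have ZM : Z^H *m Z *m M = Z^H *m Z.
  rewrite -mulmxA mulmxBr mulmx1 -scalemxAr mulmxA compl_basis_ortho.
  by rewrite mul0mx scaler0 subr0.
have : (Z^H *m Z *m M)^H = M by rewrite adjmxM MH adjmxM adjmxK.
by rewrite ZM adjmxM adjmxK.
Qed.

End OrthonormalComplement.

Section FreeFock.
Variables (R : realType) (n : nat) (lam : nat -> R).
Notation C := R[i].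

(** The dimension of a level is the rank of a kernel computed from the operators below it. Two
    consecutive dimensions and the [n] operators from the upper level to the lower one are therefore
    built in a single recursion. *)
Record step := Step { sdom : nat ; scod : nat ; sop : 'I_n -> 'M[C]_(sdom, scod) }.

Definition step_row (s : step) : 'M[C]_(sdom s, n * scod s) :=
  \matrix_(b, x) mxvec (\matrix_(i, a) sop s i b a) 0 x.

(* Up to scaling, [step_row s] is the adjoint of an isometry of the level [sdom s]
   into C^n (x) the level [scod s]; the next level is the orthogonal complement of
   its range, and [sop] the inclusion, cut into [n] blocks. *)
Definition step_next (s : step) : step :=
  @Step (scod s) _ (fun i => \matrix_(a, b)
    (compl_basis (step_row s) b (mxvec_index i a))^*).

Definition step0 : step := @Step 1 n (fun i => delta_mx 0 i).

Definition fock k := iter k step_next step0.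

Definition fdim k := sdom (fock k).

Definition annih k (i : 'I_n) : 'M[C]_(fdim k, fdim k.+1) := sop (fock k) i.

Lemma step_rowE s b i a : step_row s b (mxvec_index i a) = sop s i b a.
Proof. by rewrite mxE mxvecE mxE. Qed.

Lemma sum_mxvec_index m (F : 'I_(n * m) -> C) :
  \sum_x F x = \sum_i \sum_a F (mxvec_index i a).
Proof.
rewrite pair_bigA /= (reindex (uncurry (@mxvec_index n m))) /=.
  by apply: eq_bigr => -[].
exact: curry_mxvec_bij.
Qed.

Lemma step_row_mul s : step_row s *m (step_row s)^H = \sum_i sop s i *m (sop s i)^H.
Proof.
apply/matrixP => b c; rewrite mxE summxE sum_mxvec_index; apply: eq_bigr => i _.
by rewrite mxE; apply: eq_bigr => a _; rewrite !mxE !mxvecE !mxE.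
Qed.

(** This is the orthogonality of [compl_basis] to [step_row]: the vectors kept in the next level are
    those killed by the contraction. *)
Lemma step_next_row0 s : \sum_i sop s i *m sop (step_next s) i = 0.
Proof.
have : step_row s *m (compl_basis (step_row s))^H = 0.
  by rewrite -[LHS]adjmxK adjmxM adjmxK compl_basis_ortho trmx0 map_mx0.
move=> /matrixP e; apply/matrixP => b c.
rewrite -(e b c) summxE [RHS]mxE sum_mxvec_index; apply: eq_bigr => i _.
by rewrite mxE; apply: eq_bigr => a _; rewrite step_rowE !mxE.
Qed.

Lemma step_next_isometry s :
  \sum_i (sop (step_next s) i)^H *m sop (step_next s) i = 1%:M.
Proof.
rewrite -(compl_basis_unitary (step_row s)); apply/matrixP => b c.
rewrite summxE [RHS]mxE sum_mxvec_index; apply: eq_bigr => i _.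
by rewrite mxE; apply: eq_bigr => a _; rewrite !mxE conjCK.
Qed.

(** Block (i, j) of the projection formula [compl_basis_proj], with [mu] the scale of the row of
    operators. *)
Lemma step_next_comm s (mu : R) i j : mu != 0 ->
  \sum_k sop s k *m (sop s k)^H = (mu%:C)%:M ->
  sop (step_next s) i *m (sop (step_next s) j)^H =
  (i == j)%:R%:M - (mu^-1)%:C *: ((sop s i)^H *m sop s j).
Proof.
move=> mu0; rewrite -step_row_mul => /(compl_basis_proj mu0) /matrixP e.
apply/matrixP => a c; have := e (mxvec_index i a) (mxvec_index j c).
rewrite !mxE => e'; rewrite (eq_bigr (fun b => (compl_basis (step_row s))^H (mxvec_index i a) b *
  compl_basis (step_row s) b (mxvec_index j c))); last first.
  by move=> b _; rewrite !mxE conjCK.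
rewrite e'; congr (_ - _ * _); last first.
  by apply: eq_bigr => b _; rewrite !mxE !mxvecE !mxE.
(* Injectivity of [mxvec_index] splits the entry of the large identity matrix into a delta in (i, j)
   times a delta in (a, c). *)
rewrite (can_eq (@cast_ordK _ _ _)) (can_eq enum_rankK) xpair_eqE.
by case: (i == j); rewrite //= mul0rn.
Qed.

Hypothesis lam0 : lam 0 = 0.
Hypothesis lamS : forall k, lam k.+1 * (n%:R - lam k) = 1.

Lemma lam_neq0 k : n%:R - lam k != 0.
Proof. by apply/eqP => e; have := lamS k; rewrite e mulr0 => /esym/eqP; rewrite oner_eq0. Qed.

Lemma lamSE k : lam k.+1 = (n%:R - lam k)^-1.
Proof. by rewrite -[LHS]mulr1 -[in LHS](divff (lam_neq0 k)) mulrA lamS mul1r. Qed.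

Lemma annih_isometry k : \sum_i (annih k i)^H *m annih k i = 1%:M.
Proof.
case: k => [|k]; last exact: (step_next_isometry (fock k)).
apply/matrixP => b c; rewrite summxE mxE (bigD1 b) //= big1 ?addr0 => [|i ib].
  rewrite mxE big_ord1 !mxE !eqxx /= conjC1 mul1r.
  by rewrite eq_sym.
by rewrite mxE big_ord1 !mxE eqxx /= [b == i]eq_sym (negbTE ib) conjC0 mul0r.
Qed.

(** Putting i = j in the commutation relation and summing leaves n minus [lam] times the isometry
    sum. The value n - lam_k = [k+2]/[k+1] is the [mu] of the next step, and its inverse is
    lam_(k+1), which closes the recursion. *)
Lemma annih_trace k : \sum_i annih k i *m (annih k i)^H = (n%:R - lam k)%:C%:M.
Proof.
elim: k => [|k IH].
  apply/matrixP => b c; rewrite !ord1 summxE !mxE eqxx mulr1n.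
  rewrite lam0 subr0 rmorph_nat -[in RHS](card_ord n) -sum1_card natr_sum.
  apply: eq_bigr => i _; rewrite mxE (bigD1 i) //= big1 ?addr0 => [|j ji].
    by rewrite !mxE !eqxx conjC1 mul1r.
  by rewrite !mxE (negbTE ji) andbF mul0r.
rewrite (eq_bigr (fun i => (1%:M - ((n%:R - lam k)^-1)%:C *:
  ((annih k i)^H *m annih k i)))); last first.
  by move=> i _; rewrite (step_next_comm i i (lam_neq0 k) IH) eqxx.
rewrite sumrB -scaler_sumr annih_isometry sumr_const card_ord lamSE.
by rewrite scalemx1 rmorphB rmorph_nat raddfB -scaler_nat scalemx1.
Qed.

Lemma annih0 k : \sum_i annih k i *m annih k.+1 i = 0.
Proof. exact: (step_next_row0 (fock k)). Qed.

Lemma annih_commS k i j : annih k.+1 i *m (annih k.+1 j)^H =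
  (i == j)%:R%:M - (lam k.+1)%:C *: ((annih k i)^H *m annih k j).
Proof. by rewrite lamSE; exact: (step_next_comm i j (lam_neq0 k) (annih_trace k)). Qed.

Lemma annih_comm0 i j : annih 0 i *m (annih 0 j)^H = (i == j)%:R%:M.
Proof.
apply/matrixP => b c; rewrite !ord1 !mxE (bigD1 i) //= big1 ?addr0 => [|k ki].
  by rewrite !mxE !eqxx mul1r eq_sym; case: (j == i); rewrite ?conjC1 ?conjC0.
by rewrite !mxE (negbTE ki) andbF mul0r.
Qed.

End FreeFock.

Section Contractions.
Variable R : realType.
Notation C := R[i].

Lemma sqm_adj m n (X : 'M[C]_(m, n)) : sqm X^H = sqm X.
Proof.
rewrite !sqmE exchange_big; apply: eq_bigr => i _; apply: eq_bigr => j _.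
by rewrite !mxE Re_conjc Im_conjc sqrrN.
Qed.

Lemma sqm_isometry_le (I : finType) m n p (A : I -> 'M[C]_(m, n)) (X : 'M[C]_(n, p)) i :
  \sum_i (A i)^H *m A i = 1%:M -> sqm (A i *m X) <= sqm X.
Proof.
move=> A1; have -> : sqm X = \sum_i sqm (A i *m X).
  rewrite -Re_sum [in LHS]/sqm -[in X in mip _ X](mul1mx X) -A1 mulmx_suml.
  rewrite (big_morph (mip X) (mipDr X) (_ : mip X 0 = 0)); last first.
    by rewrite /mip mulmx0 mxtrace0.
  by congr complex.Re; apply: eq_bigr => j _; rewrite mip_adjl mulmxA.
by rewrite (bigD1 i) //= lerDl; apply: sumr_ge0 => j _; exact: sqm_ge0.
Qed.

(** With Y = A^H X, the product of X and AY is the squared size of Y; expanding the squared size of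
    X - AY and bounding that of AY gives the claim. *)
Lemma sqm_contraction_adj m n p (A : 'M[C]_(m, n)) (X : 'M[C]_(m, p)) :
  (forall Y : 'M[C]_(n, p), sqm (A *m Y) <= sqm Y) -> sqm (A^H *m X) <= sqm X.
Proof.
move=> hA; set Y := A^H *m X.
have e : sqm Y = complex.Re (mip X (A *m Y)).
  by rewrite {1}/sqm {1}/Y mip_adjl adjmxK.
have := sqm_ge0 (X - A *m Y); rewrite sqmD sqmN mipNr ReN -e.
have := hA Y; lra.
Qed.

End Contractions.

(** * The operators v_ij on the doubled Fock space *)

Section Generators.
Variables (R : realType) (n : nat) (lam : nat -> R).
Notation C := R[i].
Hypothesis lam0 : lam 0 = 0.
Hypothesis lamS : forall k, lam k.+1 * (n%:R - lam k) = 1.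
Hypothesis lam_ge0 : forall k, 0 <= lam k.
Hypothesis lam_le1 : forall k, lam k <= 1.

Notation A := (@annih R n).
Notation fd := (@fdim R n).
Notation l2 := (l2sum R fd).

Definition wt k : C := (Num.sqrt (lam k.+1))%:C.

Lemma wt_sqr k : wt k * wt k = (lam k.+1)%:C.
Proof. by rewrite -rmorphM -expr2 sqr_sqrtr. Qed.

Lemma wtJ k : (wt k)^* = wt k.
Proof. exact: conj_real. Qed.

Lemma annih_contraction k i p (X : 'M[C]_(_, p)) : sqm (A k i *m X) <= sqm X.
Proof. exact: sqm_isometry_le (annih_isometry R n k). Qed.

Lemma annihH_contraction k i p (X : 'M[C]_(_, p)) : sqm ((A k i)^H *m X) <= sqm X.
Proof. apply: sqm_contraction_adj => Y; exact: annih_contraction. Qed.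

Lemma annih_contraction_r k i p (X : 'M[C]_(p, _)) : sqm (X *m (A k i)^H) <= sqm X.
Proof. by rewrite -sqm_adj adjmxM adjmxK -(sqm_adj X); exact: annih_contraction. Qed.

Lemma annihH_contraction_r k i p (X : 'M[C]_(p, _)) : sqm (X *m A k i) <= sqm X.
Proof. by rewrite -sqm_adj adjmxM -(sqm_adj X); exact: annihH_contraction. Qed.

(* Locked: unification would otherwise unfold the recursion defining [annih]. *)
Fact ladder_key : unit. Proof. exact: tt. Qed.

(** On x y^H, standing for x (x) conj(y), the map X -> A_i X A_j^H applies a_i to x and a_j to y. *)
Definition lower := locked_with ladder_key
  (fun i j (X : forall k, 'M[C]_(fd k)) k =>
     wt k *: (A k i *m X k.+1 *m (A k j)^H) : 'M[C]_(fd k)).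

Definition raise := locked_with ladder_key
  (fun i j (X : forall k, 'M[C]_(fd k)) k =>
  match k return 'M[C]_(fd k) with
  | 0 => 0
  | k'.+1 => wt k' *: ((A k' i)^H *m X k' *m A k' j)
  end).

Lemma lowerE i j X k : lower i j X k = wt k *: (A k i *m X k.+1 *m (A k j)^H).
Proof. by rewrite /lower unlock. Qed.

Lemma raise0 i j X : raise i j X 0 = 0.
Proof. by rewrite /raise unlock. Qed.

Lemma raiseS i j X k :
  raise i j X k.+1 = wt k *: ((A k i)^H *m X k *m A k j).
Proof. by rewrite /raise unlock. Qed.

Lemma sqm_wt k m p (X : 'M[C]_(m, p)) : sqm (wt k *: X) <= sqm X.
Proof.
rewrite sqmZ /wt normc_def /= expr0n addr0 sqrtr_sqr.
rewrite real_normK ?num_real // sqr_sqrtr //.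
by rewrite ler_piMl ?sqm_ge0.
Qed.

Lemma sqm_lower i j X k : sqm (lower i j X k) <= sqm (X k.+1).
Proof.
rewrite lowerE.
apply: le_trans (sqm_wt _ _) _; apply: le_trans (annih_contraction_r _ _) _.
exact: annih_contraction.
Qed.

Lemma sqm_raise i j X k : sqm (raise i j X k.+1) <= sqm (X k).
Proof.
rewrite raiseS.
apply: le_trans (sqm_wt _ _) _; apply: le_trans (annihH_contraction_r _ _) _.
exact: annihH_contraction.
Qed.

Lemma lower_sum_le i j (x : l2) N :
  \sum_(k < N) sqm (lower i j x k) <= complex.Re (l2ip x x).
Proof.
apply: le_trans (sum_sqm_le x N.+1); rewrite big_ord_recl ler_wpDl ?sqm_ge0 //.
by apply: ler_sum => k _; exact: sqm_lower.
Qed.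

Lemma raise_sum_le i j (x : l2) N :
  \sum_(k < N) sqm (raise i j x k) <= complex.Re (l2ip x x).
Proof.
case: N => [|N].
  by rewrite big_ord0; apply: le_trans (sum_sqm_le x 0); rewrite big_ord0.
rewrite big_ord_recl raise0 sqm0 add0r; apply: le_trans (sum_sqm_le x N).
by apply: ler_sum => k _; exact: sqm_raise.
Qed.

Definition lower_l2 i j (x : l2) : l2 :=
  @L2sum R fd (lower i j x) (ex_intro _ _ (lower_sum_le i j x)).

Definition raise_l2 i j (x : l2) : l2 :=
  @L2sum R fd (raise i j x) (ex_intro _ _ (raise_sum_le i j x)).

Lemma lower_raise_adj i j (X Y : forall k, 'M[C]_(fd k)) k :
  mip (lower i j X k) (Y k) = mip (X k.+1) (raise i j Y k.+1).
Proof.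
rewrite lowerE raiseS mipC mipZr rmorphM /= wtJ -mipC mip_adjr mip_adjl adjmxK.
by rewrite mulmxA mipZr.
Qed.

Lemma ccvgS (u : nat -> C) l : ccvg u l -> ccvg (fun N => u N.+1) l.
Proof.
by move=> [h h']; split;
  [rewrite -(cvg_shiftS (fun N => complex.Re (u N))) in h |
   rewrite -(cvg_shiftS (fun N => complex.Im (u N))) in h'].
Qed.

(** Level k on the left matches level k + 1 on the right, and [raise] vanishes on level 0, so the
    partial sums agree after a shift of index. *)
Lemma l2ip_lower i j x y : l2ip (lower_l2 i j x) y = l2ip x (raise_l2 i j y).
Proof.
apply: l2ip_eq; apply: eq_ccvg (ccvgS (l2ipP x (raise_l2 i j y))) => N.
rewrite big_ord_recl /= raise0 {1}/mip mulmx0 mxtrace0 add0r.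
by apply: eq_bigr => k _; rewrite -lower_raise_adj.
Qed.

Definition fd0 : fd 0 = 1%N := erefl.
Notation H := (l2hilbert R fd0).

Fact lower_bd i j : exists2 K : R, 0 <= K &
  forall x : H, hnorm (lower_l2 i j x : H) <= K * hnorm x.
Proof.
exists 1 => // x; rewrite mul1r ler_sqrt ?Re_hip_ge0 //.
by apply: l2sq_le => N; exact: lower_sum_le.
Qed.

Definition lower_op i j : bop H :=
  @Bop R H (lower_l2 i j) (raise_l2 i j) (l2ip_lower i j) (lower_bd i j).

Definition gen i j : bop H := lower_op i j + star (lower_op i j).

Lemma star_gen i j : star (gen i j) = gen i j.
Proof. by rewrite starD starK addrC. Qed.

End Generators.

Lemma sum_addr4 (V : zmodType) (I : finType) (a b c d : I -> V) :
  \sum_i (a i + b i + (c i + d i)) =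
  \sum_i a i + \sum_i b i + (\sum_i c i + \sum_i d i).
Proof. by rewrite !big_split. Qed.

(** * Orthogonality of the matrix of generators *)

Section Relations.
Variables (R : realType) (n : nat) (lam : nat -> R).
Notation C := R[i].
Hypothesis lam0 : lam 0 = 0.
Hypothesis lamS : forall k, lam k.+1 * (n%:R - lam k) = 1.
Hypothesis lam_ge0 : forall k, 0 <= lam k.
Hypothesis lam_le1 : forall k, lam k <= 1.

Notation A := (@annih R n).
Notation fd := (@fdim R n).
Notation l2 := (l2sum R fd).
Notation H := (l2hilbert R (@fd0 R n)).
Notation lower := (@lower R n lam).
Notation raise := (@raise R n lam).
Notation gen := (@gen R n lam lam_ge0 lam_le1).
Notation seqs := (forall k, 'M[C]_(fd k)).

Definition genf i j (X : seqs) k := lower i j X k + raise i j X k.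

Lemma lowerD i j (X Y : seqs) k :
  lower i j (fun l => X l + Y l) k = lower i j X k + lower i j Y k.
Proof. by rewrite !lowerE mulmxDr mulmxDl scalerDr. Qed.

Lemma raiseD i j (X Y : seqs) k :
  raise i j (fun l => X l + Y l) k = raise i j X k + raise i j Y k.
Proof. by case: k => [|k]; rewrite ?raise0 ?addr0 // !raiseS mulmxDr mulmxDl scalerDr. Qed.

Lemma sum_lower_lower i i' (X : seqs) k :
  \sum_j lower i j (lower i' j X) k = 0.
Proof.
rewrite (eq_bigr (fun j => (wt lam k * wt lam k.+1) *:
    (A k i *m (A k.+1 i' *m X k.+2) *m (A k j *m A k.+1 j)^H))); last first.
  move=> j _; rewrite !lowerE -scalemxAr -scalemxAl scalerA adjmxM.
  by rewrite !mulmxA.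
by rewrite -scaler_sumr -mulmx_sumr -adjmx_sum annih0 trmx0 map_mx0 mulmx0 scaler0.
Qed.

Lemma sum_raise_raise i i' (X : seqs) k :
  \sum_j raise i j (raise i' j X) k = 0.
Proof.
case: k => [|[|k]].
- by rewrite big1 // => j _; rewrite raise0.
- by rewrite big1 // => j _; rewrite raiseS raise0 mulmx0 mul0mx scaler0.
rewrite (eq_bigr (fun j => (wt lam k.+1 * wt lam k) *:
    ((A k.+1 i)^H *m ((A k i')^H *m X k) *m (A k j *m A k.+1 j)))); last first.
  by move=> j _; rewrite !raiseS -scalemxAr -scalemxAl scalerA !mulmxA.
by rewrite -scaler_sumr -mulmx_sumr annih0 mulmx0 scaler0.
Qed.

Lemma sum_lower_raise i i' (X : seqs) k :
  \sum_j lower i j (raise i' j X) k = A k i *m (A k i')^H *m X k.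
Proof.
rewrite (eq_bigr (fun j => (lam k.+1)%:C *:
    (A k i *m (A k i')^H *m X k *m (A k j *m (A k j)^H)))); last first.
  move=> j _; rewrite lowerE raiseS -scalemxAr -scalemxAl scalerA wt_sqr //.
  by rewrite !mulmxA.
rewrite -scaler_sumr -mulmx_sumr (annih_trace lam0 lamS) mul_mx_scalar scalerA.
by rewrite -rmorphM lamS scale1r.
Qed.

Lemma sum_raise_lower i i' (X : seqs) k :
  \sum_j raise i j (lower i' j X) k.+1 = (lam k.+1)%:C *: ((A k i)^H *m A k i' *m X k.+1).
Proof.
rewrite (eq_bigr (fun j => (lam k.+1)%:C *:
    ((A k i)^H *m A k i' *m X k.+1 *m ((A k j)^H *m A k j)))); last first.
  move=> j _; rewrite raiseS lowerE -scalemxAr -scalemxAl scalerA wt_sqr //.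
  by rewrite !mulmxA.
by rewrite -scaler_sumr -mulmx_sumr annih_isometry mulmx1.
Qed.

(** Lowering twice and raising twice contribute sum_j a_j a_j = 0 or its adjoint. In lowering after
    raising, the squared weight cancels the trace n - lam_k; in raising after lowering it survives
    as lam_(k+1). The two remainders are the two sides of the commutation relation, so they add up
    to a delta. *)
Lemma sum_genf_l i i' (X : seqs) k :
  \sum_j genf i j (genf i' j X) k = (i == i')%:R *: X k.
Proof.
transitivity (\sum_j (lower i j (lower i' j X) k + lower i j (raise i' j X) k +
   (raise i j (lower i' j X) k + raise i j (raise i' j X) k))).
  by apply: eq_bigr => j _; rewrite -lowerD -raiseD.
rewrite sum_addr4 sum_lower_lower sum_raise_raise sum_lower_raise add0r addr0.
case: k => [|k].
  rewrite big1 => [|j _]; last exact: raise0.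
  by rewrite addr0 annih_comm0 mul_scalar_mx.
rewrite sum_raise_lower (annih_commS lam0 lamS) mulmxBl mul_scalar_mx.
by rewrite -scalemxAl subrK.
Qed.

Lemma genf_adj i j (X : seqs) k : (genf i j X k)^H = genf j i (fun l => (X l)^H) k.
Proof.
rewrite /genf adjmxD !lowerE adjmxZ wtJ !adjmxM adjmxK mulmxA; congr (_ + _).
case: k => [|k]; first by rewrite !raise0 trmx0 map_mx0.
by rewrite !raiseS adjmxZ wtJ !adjmxM adjmxK mulmxA.
Qed.

(** Hermitian conjugation of each component exchanges the two tensor factors, hence the two indices
    of v_ij; the column relation is the row relation read on adjoints. *)
Lemma sum_genf_r j j' (X : seqs) k :
  \sum_i genf i j (genf i j' X) k = (j == j')%:R *: X k.
Proof.
rewrite -[LHS]adjmxK adjmx_sum.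
rewrite (eq_bigr (fun i => genf j i (genf j' i (fun l => (X l)^H)) k)); last first.
  move=> i _; rewrite genf_adj.
  rewrite (_ : (fun l => _) = genf j' i (fun l => (X l)^H)) //.
  by apply: functional_extensionality_dep => l; rewrite genf_adj.
by rewrite sum_genf_l adjmxZ adjmxK conjC_nat.
Qed.

Lemma l2sum_sumE (I : Type) (r : seq I) (P : pred I) (F : I -> l2) k :
  (\sum_(i <- r | P i) F i) k = \sum_(i <- r | P i) F i k.
Proof. exact: (big_morph (fun x : l2 => x k)). Qed.

Lemma bop_sumE (K : hilbert R) (I : Type) (r : seq I) (P : pred I) (F : I -> bop K) x :
  (\sum_(i <- r | P i) F i) x = \sum_(i <- r | P i) F i x.
Proof. exact: (big_morph (fun T : bop K => T x)). Qed.

Definition gen_mx : 'M[bop H]_n := \matrix_(i, j) gen i j.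

Lemma gen_relations : Ao_relations gen_mx.
Proof.
split=> [i j||]; first by rewrite mxE star_gen.
- apply/matrixP => i i'; rewrite !mxE; apply: bopE => x; apply: l2E => k.
  rewrite bop_sumE l2sum_sumE (eq_bigr (fun j => genf i j (genf i' j x) k)).
    by rewrite sum_genf_l; case: (i == i'); rewrite ?scale1r ?scale0r.
  by move=> j _; rewrite !mxE.
- apply/matrixP => i i'; rewrite !mxE; apply: bopE => x; apply: l2E => k.
  rewrite bop_sumE l2sum_sumE (eq_bigr (fun j => genf j i (genf j i' x) k)).
    by rewrite sum_genf_r; case: (i == i'); rewrite ?scale1r ?scale0r.
  by move=> j _; rewrite !mxE.
Qed.

End Relations.

(** * Haar moments as vacuum expectations *)

Section HaarMoments.
Variables (R : realType) (n : nat) (lam : nat -> R).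
Notation C := R[i].
Hypothesis lam0 : lam 0 = 0.
Hypothesis lamS : forall k, lam k.+1 * (n%:R - lam k) = 1.
Hypothesis lam_ge0 : forall k, 0 <= lam k.
Hypothesis lam_le1 : forall k, lam k <= 1.

Notation An := (@annih R n).
Notation fd := (@fdim R n).
Notation l2 := (l2sum R fd).
Notation H := (l2hilbert R (@fd0 R n)).
Notation gen := (@gen R n lam lam_ge0 lam_le1).

Variables (A : cstarAlgType R) (u : 'M[A]_n).
Hypothesis urel : Ao_relations u.

Definition emb p m (M : 'M[C]_(p, m)) : 'M[A]_(p, m) := map_mx (in_alg A) M.

Lemma embM p m r (M : 'M[C]_(p, m)) (N : 'M[C]_(m, r)) : emb (M *m N) = emb M *m emb N.
Proof. exact: map_mxM. Qed.

Lemma embD p m (M N : 'M[C]_(p, m)) : emb (M + N) = emb M + emb N.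
Proof. exact: map_mxD. Qed.

Lemma emb_sum p m (I : Type) (r : seq I) (P : pred I) (F : I -> 'M[C]_(p, m)) :
  emb (\sum_(i <- r | P i) F i) = \sum_(i <- r | P i) emb (F i).
Proof. by apply: (big_morph _ (@embD p m)); exact: map_mx0. Qed.

Lemma embZ p m (k : C) (M : 'M[C]_(p, m)) : emb (k *: M) = k%:A *: emb M.
Proof. exact: map_mxZ. Qed.

(** Entries of [emb M] are scalars, hence central; this is what lets coefficients u_ij, which do not
    commute with each other, move out to the left in their order. *)
Lemma scale_emb_mull p m r (a : A) (M : 'M[C]_(p, m)) (N : 'M[A]_(m, r)) :
  a *: (emb M *m N) = emb M *m (a *: N).
Proof.
apply/matrixP => i j; rewrite !mxE mulr_sumr; apply: eq_bigr => k _.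
by rewrite !mxE -!scalerAl !mul1r -scalerAr.
Qed.

Lemma u_rows i i' : \sum_k u i k * u i' k = (i == i')%:R.
Proof.
have [_ /matrixP/(_ i i') e _] := urel; move: e; rewrite !mxE => <-.
by apply: eq_bigr => k _; rewrite mxE.
Qed.

Lemma u_cols k k' : \sum_i u i k * u i k' = (k == k')%:R.
Proof.
have [_ _ /matrixP/(_ k k') e] := urel; move: e; rewrite !mxE => <-.
by apply: eq_bigr => i _; rewrite mxE.
Qed.

(* The irreducible corepresentation carried by the level [k] of the Fock space,
   which [corep_create] and [corep_annih] intertwine with the levels around it. *)
Fixpoint corep k : 'M[A]_(fd k) :=
  match k return 'M[A]_(fd k) with
  | 0 => 1%:M
  | k'.+1 => \sum_i \sum_j u i j *: (emb (An k' j)^H *m corep k' *m emb (An k' i))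
  end.

Arguments corep : simpl never.

Lemma corepS k : corep k.+1 =
  \sum_i \sum_j u i j *: (emb (An k j)^H *m corep k *m emb (An k i)).
Proof. by []. Qed.

Lemma sum_delta (V : lmodType A) (I : finType) (F : I -> V) i :
  \sum_j (i == j)%:R *: F j = F i.
Proof.
rewrite (bigD1 i) //= eqxx scale1r big1 ?addr0 // => j /negbTE.
by rewrite eq_sym => ->; rewrite scale0r.
Qed.

Lemma embN p m (M : 'M[C]_(p, m)) : emb (- M) = - emb M.
Proof. exact: map_mxN. Qed.

Lemma mulmx_emb_delta p m (M : 'M[A]_(p, m)) (b : bool) :
  M *m emb b%:R%:M = b%:R *: M.
Proof.
case: b; last by rewrite /emb raddf0 map_mx0 mulmx0 scale0r.
by rewrite /emb map_mx1 mulmx1 scale1r.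
Qed.

Lemma sum_u_cols (p r : nat) (V : 'I_n -> 'I_n -> 'M[A]_(p, r)) :
  \sum_i \sum_j u i j *: (\sum_j' u i j' *: V j j') = \sum_j V j j.
Proof.
rewrite exchange_big; apply: eq_bigr => j _.
under eq_bigr do rewrite scaler_sumr.
rewrite exchange_big /= -[RHS](sum_delta (V j) j); apply: eq_bigr => j' _.
by under eq_bigr do rewrite scalerA; rewrite -scaler_suml u_cols.
Qed.

Lemma sum_u_rows (p r : nat) i (V : 'I_n -> 'M[A]_(p, r)) :
  \sum_j u i j *: (\sum_i' u i' j *: V i') = V i.
Proof.
under eq_bigr do rewrite scaler_sumr.
rewrite exchange_big -[RHS](sum_delta V i); apply: eq_bigr => i' _ /=.
by under eq_bigr do rewrite scalerA; rewrite -scaler_suml u_rows.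
Qed.

(** [D] is the correction to a_i' a_i^* = delta, zero on level 0. The two cases of [corep_create]
    differ only in why its contribution vanishes. *)
Lemma corep_create_aux k i (D : 'I_n -> 'M[C]_(fd k)) :
    (forall i', An k i' *m (An k i)^H = (i == i')%:R%:M - D i') ->
    \sum_i' \sum_j u i' j *: (emb (An k j)^H *m (corep k *m emb (D i'))) = 0 ->
    \sum_j u i j *: (emb (An k j)^H *m corep k) = corep k.+1 *m emb (An k i)^H.
Proof.
move=> AD D0; rewrite corepS mulmx_suml.
rewrite -[LHS](sum_delta (fun i' => \sum_j u i' j *: (emb (An k j)^H *m corep k)) i).
rewrite -[LHS]subr0 -[X in _ - X]D0 -sumrB; apply: eq_bigr => i' _.
rewrite mulmx_suml scaler_sumr -sumrB; apply: eq_bigr => j _.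
rewrite -scalemxAl -[_ *m emb (An k i)^H]mulmxA -embM AD embD embN mulmxDr mulmxN.
rewrite mulmx_emb_delta mulmxA scalerBr; congr (_ - _).
by case: (i == i'); rewrite ?scale1r // !scale0r scaler0.
Qed.

Lemma corep_create k i :
  \sum_j u i j *: (emb (An k j)^H *m corep k) = corep k.+1 *m emb (An k i)^H.
Proof.
elim: k i => [|k IH] i.
  apply: (corep_create_aux (D := fun=> 0)) => [i'|]; first by rewrite annih_comm0 subr0 eq_sym.
  by apply: big1 => i' _; apply: big1 => j _; rewrite /emb map_mx0 !mulmx0 scaler0.
apply: (corep_create_aux (D := fun i' => (An k i')^H *m ((lam k.+1)%:C *: An k i))) => [i'|].
  by rewrite (annih_commS lam0 lamS) eq_sym -scalemxAr.
(* The induction hypothesis brings out a second factor u_i'j'; the column relation forces j' = j,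
   which leaves the adjoint of sum_j a_j a_j = 0. *)
transitivity (\sum_i' \sum_j u i' j *: \sum_j' u i' j' *:
    (emb (An k.+1 j)^H *m (emb (An k j')^H *m corep k *m emb ((lam k.+1)%:C *: An k i)))).
  apply: eq_bigr => i' _; apply: eq_bigr => j _; congr (_ *: _).
  rewrite embM [corep k.+1 *m _]mulmxA -IH // mulmx_suml mulmx_sumr; apply: eq_bigr => j' _.
  by rewrite -scalemxAl scale_emb_mull.
rewrite sum_u_cols.
under eq_bigr do rewrite !mulmxA -embM -adjmxM.
by rewrite -!mulmx_suml -emb_sum -adjmx_sum annih0 /emb trmx0 !map_mx0 !mul0mx.
Qed.

(** Counterpart of [corep_create_aux] for annihilation: the delta part of a_j a_j'^* collapses by
    the row relation of [u]. *)
Lemma corep_annih_aux k i (D : 'I_n -> 'I_n -> 'M[C]_(fd k)) :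
    (forall j j', An k j *m (An k j')^H = (j == j')%:R%:M - D j j') ->
    \sum_j u i j *: \sum_i' \sum_j' u i' j' *:
       (emb (D j j') *m (corep k *m emb (An k i'))) = 0 ->
    \sum_j u i j *: (emb (An k j) *m corep k.+1) = corep k *m emb (An k i).
Proof.
move=> AD D0; rewrite -[RHS](sum_u_rows i (fun i' => corep k *m emb (An k i'))).
rewrite -[RHS]subr0 -[X in _ = _ - X]D0 -sumrB; apply: eq_bigr => j _.
rewrite -scalerBr -sumrB corepS mulmx_sumr; congr (_ *: _).
apply: eq_bigr => i' _; rewrite mulmx_sumr.
rewrite -(sum_delta (fun j' => u i' j' *: (corep k *m emb (An k i'))) j) -sumrB.
apply: eq_bigr => j' _.
rewrite -scale_emb_mull !mulmxA -embM AD embD embN !mulmxDl !mulNmx scalerBr.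
congr (_ - _).
case: (j == j'); rewrite /emb ?map_mx1 ?mul1mx ?scale1r //.
by rewrite raddf0 map_mx0 !mul0mx scaler0 scale0r.
Qed.

Lemma corep_annih k i :
  \sum_j u i j *: (emb (An k j) *m corep k.+1) = corep k *m emb (An k i).
Proof.
elim: k i => [|k IH] i.
  apply: (corep_annih_aux (D := fun _ _ => 0)) => [j j'|]; first by rewrite annih_comm0 subr0.
  apply: big1 => j _; rewrite big1 ?scaler0 // => i' _; apply: big1 => j' _.
  by rewrite /emb map_mx0 mul0mx scaler0.
apply: (corep_annih_aux (D := fun j j' => ((lam k.+1)%:C *: (An k j)^H) *m An k j')) => [j j'|].
  by rewrite (annih_commS lam0 lamS) -scalemxAl.
apply: big1 => j _.
rewrite (_ : \sum_i' _ = 0) ?scaler0 //.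
(* Here the induction hypothesis absorbs the inner u_i'j', and the sum over i' becomes sum_i' a_i'
   a_i' = 0 on the right. *)
transitivity (\sum_i' emb ((lam k.+1)%:C *: (An k j)^H) *m
    ((corep k *m emb (An k i')) *m emb (An k.+1 i'))).
  apply: eq_bigr => i' _; rewrite -IH //.
  rewrite [RHS](congr1 (mulmx _) (mulmx_suml _ _ _ _)) [RHS]mulmx_sumr.
  apply: eq_bigr => j' _.
  by rewrite -[in RHS]scalemxAl -[in RHS]scale_emb_mull embM !mulmxA.
under eq_bigr do rewrite -[_ *m emb (An k.+1 _)]mulmxA -embM.
by rewrite -!mulmx_sumr -emb_sum annih0 /emb map_mx0 !mulmx0.
Qed.

Fixpoint words m : seq (seq 'I_n) :=
  if m is m'.+1 then [seq k :: K | k <- enum 'I_n, K <- words m'] else [:: [::]].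

Lemma sum_words0 (V : nmodType) (F : seq 'I_n -> V) : \sum_(K <- words 0) F K = F [::].
Proof. by rewrite big_seq1. Qed.

Lemma sum_wordsS (V : nmodType) m (F : seq 'I_n -> V) :
  \sum_(K <- words m.+1) F K = \sum_k \sum_(K <- words m) F (k :: K).
Proof. by rewrite big_allpairs_dep /= big_enum. Qed.

Notation Om := (@l2unit R fd (@fd0 R n) : H).
Notation word_gen j K := (\prod_(k <- K) gen k j).

Lemma genf_genE i j (x : H) k : (gen i j x : l2) k = genf lam i j (x : l2) k.
Proof. by []. Qed.

Lemma mulmx_embZ p m r (N : 'M[A]_(p, m)) (c : C) (M : 'M[C]_(m, r)) :
  N *m emb (c *: M) = c%:A *: (N *m emb M).
Proof.
apply/matrixP => i j; rewrite !mxE mulr_sumr; apply: eq_bigr => k _.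
by rewrite !mxE /= !mulr_algr mulr_algl scalerA.
Qed.

Lemma scale_centralZ p m (a : A) (c : C) (M : 'M[A]_(p, m)) :
  a *: (c%:A *: M) = c%:A *: (a *: M).
Proof. by rewrite !scalerA -scalerAr -scalerAl mulr1 mul1r. Qed.

(** By induction on [m]: the first letter of a word either lowers or raises, and [corep_annih] or
    [corep_create] absorbs its factor u_il, turning v_lj into v_ij. *)
Lemma corep_word i j m k :
  \sum_(K <- words m) (\prod_(l <- K) u i l) *: emb ((word_gen j K Om : l2) k) =
  corep k *m emb (((gen i j ^+ m) Om : l2) k).
Proof.
elim: m k => [|m IH] k.
  rewrite sum_words0 !big_nil scale1r expr0 /=.
  case: k => [|k]; first by rewrite mul1mx.
  by rewrite /l2unit_fun /= /emb map_mx0 mulmx0.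
(* Serves the lowering and the raising part. The letter being summed occurs only in the left factor
   [M]; the right factor [N] carries the fixed index [j]. *)
have pull p l (c : C) (M : 'M[C]_(p, _)) q (N : 'M[C]_(_, q)) :
    \sum_(K <- words m) (\prod_(l <- K) u i l) *:
      emb (c *: (M *m (word_gen j K Om : l2) l *m N)) =
    c%:A *: (emb M *m corep l *m emb (((gen i j ^+ m) Om : l2) l) *m emb N).
  rewrite -[emb M *m _ *m _]mulmxA -IH mulmx_sumr mulmx_suml scaler_sumr.
  apply: eq_bigr => K _.
  by rewrite embZ !embM scale_centralZ -scale_emb_mull -scalemxAl.
rewrite sum_wordsS.
transitivity (\sum_l u i l *: (\sum_(K <- words m) (\prod_(l <- K) u i l) *:
     emb (lower lam l j (word_gen j K Om : l2) k) +
   \sum_(K <- words m) (\prod_(l <- K) u i l) *: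
     emb (raise lam l j (word_gen j K Om : l2) k))).
  apply: eq_bigr => l _; rewrite -big_split scaler_sumr; apply: eq_bigr => K _ /=.
  by rewrite !big_cons -scalerDr -embD scalerA.
rewrite exprS (_ : (gen i j * gen i j ^+ m) Om = gen i j ((gen i j ^+ m) Om)) //.
rewrite genf_genE /genf embD mulmxDr.
under eq_bigr do rewrite scalerDr.
rewrite big_split; congr (_ + _).
  under eq_bigr do under eq_bigr do rewrite lowerE.
  under eq_bigr do rewrite pull scale_centralZ scalemxAl scalemxAl.
  rewrite -scaler_sumr -!mulmx_suml corep_annih lowerE mulmx_embZ !embM.
  by rewrite !mulmxA.
case: k => [|k].
  rewrite raise0 /emb map_mx0 mulmx0 big1 // => l _.
  by rewrite big1 ?scaler0 // => K _; rewrite raise0 map_mx0 scaler0.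
under eq_bigr do under eq_bigr do rewrite raiseS.
under eq_bigr do rewrite pull scale_centralZ scalemxAl scalemxAl.
rewrite -scaler_sumr -!mulmx_suml corep_create raiseS mulmx_embZ !embM.
by rewrite !mulmxA.
Qed.

Definition vacuum (T : bop H) : C := (T Om : l2) 0%N ord0 ord0.

Lemma vacuumZ k T : vacuum (k *: T) = k * vacuum T.
Proof. by rewrite /vacuum /= mxE. Qed.

Lemma vacuum_sum (I : Type) (r : seq I) (P : pred I) (F : I -> bop H) :
  vacuum (\sum_(i <- r | P i) F i) = \sum_(i <- r | P i) vacuum (F i).
Proof.
apply: (big_morph vacuum); first by move=> S T; rewrite /vacuum /= mxE.
by rewrite /vacuum /= mxE.
Qed.

Lemma vacuum1 : vacuum 1 = 1.
Proof. by rewrite /vacuum /= /l2unit_fun /= mxE eqxx. Qed.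

(* The vacuum expectations of the words of length [m] form a vector fixed by the
   [m]-th tensor power of [u]. *)
Lemma vacuum_fixed i j m :
  \sum_(K <- words m) vacuum (word_gen j K) *: (\prod_(l <- K) u i l) =
  vacuum (gen i j ^+ m) *: 1.
Proof.
have /matrixP/(_ ord0 ord0) := corep_word i j m 0.
rewrite mul1mx summxE => e; apply: etrans (etrans e _); last by rewrite mxE.
apply: eq_bigr => K _.
by rewrite !mxE -scalerAr mulr1.
Qed.

Section Haar.
Variables (AA : cstarAlgType R) (tens : A -> A -> AA) (Delta : {lrmorphism A -> AA}).
Variable haar : {scalar A}.
Hypothesis uAo : is_Ao u.
Hypothesis ten : is_cstar_tensor tens.
Hypothesis comul : is_comul u tens Delta.
Hypothesis Haar : is_Haar tens Delta haar.

Lemma Delta_pow i j m : Delta (u i j ^+ m) =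
  \sum_(K <- words m) tens (\prod_(l <- K) u i l) (\prod_(l <- K) u l j).
Proof.
elim: m => [|m IH].
  by rewrite sum_words0 !big_nil expr0 rmorph1 (tensor1 ten).
rewrite exprS rmorphM /= IH (comul.2 i j) sum_wordsS mulr_suml.
apply: eq_bigr => k _; rewrite mulr_sumr; apply: eq_bigr => K _.
by rewrite !big_cons (tensorM ten).
Qed.

(* Apply the vacuum state to the invariance of [haar] and [haar] to [vacuum_fixed]:
   both sides equal the sum over words [K] of haar(u_iK) vacuum(v_Kj). *)
Lemma haar_moment i j m : haar (u i j ^+ m) = vacuum (gen i j ^+ m).
Proof.
have [hstate _ [El [_ Etens EDelta]]] := Haar.
have [_ h1 _] := hstate.
have [f [_ fu]] := Ao_universal uAo (gen_relations lam0 lamS lam_ge0 lam_le1).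
have := congr1 (fun a => vacuum (f a)) (EDelta (u i j ^+ m)).
rewrite /= linearZ /= rmorph1 vacuumZ vacuum1 mulr1 Delta_pow => <-.
rewrite !linear_sum vacuum_sum /= .
have /(congr1 haar) := vacuum_fixed i j m.
rewrite linear_sum !linearZ /= h1 mulr1 => <-; apply: eq_bigr => K _.
rewrite Etens linearZ vacuumZ rmorph_prod /= linearZ /= [LHS]mulrC; congr (vacuum _ * _).
by apply: eq_bigr => k _; rewrite fu mxE.
Qed.

End Haar.
End HaarMoments.

(** * The Jacobi matrix of a generator *)

Section QIdentities.
Variables (R : realFieldType) (q : R).
Hypothesis q_gtN1 : -1 < q.
Hypothesis q_lt0 : q < 0.

Lemma q_neq0 : q != 0. Proof. by rewrite lt_eqF. Qed.

Lemma norm_q_lt1 : `|q| < 1.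
Proof. by rewrite ltr0_norm // ltrNl. Qed.

Lemma norm_qX k : `|q ^+ k| <= 1.
Proof. by rewrite normrX exprn_ile1 ?normr_ge0 ?ltW ?norm_q_lt1. Qed.

Lemma norm_qXS k : `|q ^+ k.+1| < 1.
Proof.
rewrite exprS normrM; apply: le_lt_trans norm_q_lt1.
by rewrite ler_piMr ?norm_qX.
Qed.

Lemma qX1B k : 1 - q ^+ k.+1 != 0.
Proof. by have := norm_qXS k; rewrite ltr_norml => /andP[a b]; apply: lt0r_neq0; lra. Qed.

Lemma qX1D_gt0 k : 0 < 1 + q ^+ k.
Proof.
case: k => [|k]; first by rewrite expr0; lra.
by have := norm_qXS k; rewrite ltr_norml => /andP[a b]; lra.
Qed.

Lemma qX1D k : 1 + q ^+ k != 0.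
Proof. exact/lt0r_neq0/qX1D_gt0. Qed.

(* [lamq k] is [k]/[k+1], where [k] is the quantum dimension of level [k - 1]:
   [1] = 1, [2] = n and n [k] = [k+1] + [k-1]. *)
Definition lamq k := - q * (1 - q ^+ (2 * k)) / (1 - q ^+ (2 * k).+2).

Lemma lamq0 : lamq 0 = 0.
Proof. by rewrite /lamq muln0 expr0 subrr mulr0 mul0r. Qed.

Lemma lamqS (n : R) k : q + q^-1 = - n -> lamq k.+1 * (n - lamq k) = 1.
Proof.
move=> nq; have -> : n = - (q + q^-1) by rewrite nq opprK.
rewrite /lamq mulnS !addSn add0n.
have h1 := qX1B (2 * k).+1; have h2 := qX1B (2 * k).+3; have q0 := q_neq0.
move: h1 h2; rewrite !exprS; set x := q ^+ (2 * k) => h1 h2.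
by field; rewrite q0 h1 h2.
Qed.

Lemma qX_even_bounds k : 0 <= q ^+ (2 * k) <= 1.
Proof.
have p : 0 <= q ^+ (2 * k) by rewrite exprM exprn_ge0 // sqr_ge0.
by rewrite p /=; have := norm_qX (2 * k); rewrite ger0_norm.
Qed.

Lemma lamq_ge0 k : 0 <= lamq k.
Proof.
have /andP[_ h1] := qX_even_bounds k; have /andP[_ h2] := qX_even_bounds k.+1.
rewrite /lamq -mulrA; apply: mulr_ge0; first by rewrite oppr_ge0 ltW.
by apply: divr_ge0; rewrite subr_ge0 // -[_.+2]addn2 addnC -mulnS.
Qed.

Lemma lamq_le1 k : lamq k <= 1.
Proof.
have /andP[x0 x1] := qX_even_bounds k.
have := qX1B (2 * k).+1; have /andP[_ h2] := qX_even_bounds k.+1.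
rewrite mulnS !addSn add0n in h2.
move=> d; have d0 : 0 < 1 - q ^+ (2 * k).+2 by rewrite lt_def d subr_ge0.
rewrite /lamq ler_pdivrMr // mul1r; move: d0; rewrite !exprS.
set x := q ^+ (2 * k) in x0 x1 *.
move=> d0; rewrite -subr_ge0.
have -> : 1 - q * (q * x) - - q * (1 - x) = (1 + q) * (1 - x * q) by ring.
apply: mulr_ge0; first by rewrite -lerBlDl sub0r ltW.
by rewrite subr_ge0; apply: le_trans ler01; rewrite mulr_ge0_le0 // ltW.
Qed.

Definition rq k := (1 - q ^+ k.+1) / ((1 - q) * (1 + q ^+ k)).

Lemma q1B : 1 - q != 0.
Proof. by have := qX1B 0; rewrite expr1. Qed.

Lemma rq1 : rq 1 = 1.
Proof.
rewrite /rq expr1 expr2; have := q1B; have := qX1D 1; rewrite expr1 => h1 h2.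
by field; rewrite h1 h2.
Qed.

Lemma rqSS k : rq k.+2 = 1 - lamq k.+1 * rq k.+1.
Proof.
rewrite /rq /lamq mulnS !addSn add0n.
have h1 := q1B; have h2 := qX1D k.+2; have h3 := qX1D k.+1.
have h4 := qX1B (2 * k).+3.
move: h2 h3 h4; rewrite !exprS mulnC exprM; set x := q ^+ k => h2 h3 h4.
by field; rewrite h1 h2 h3 h4.
Qed.

Definition betaq k :=
  (1 - q ^+ k) * (1 - q ^+ k.+1) / ((1 + q ^+ k) * (1 + q ^+ k.+1)).

(** Origin of the factors: n + 2 from the normalisation of w, [lamq] from the squared weight, and
    one [rq] from each tensor factor. *)
Lemma betaqE (n : R) k : q + q^-1 = - n ->
  betaq k.+1 = (n + 2) * lamq k.+1 * rq k.+1 ^+ 2.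
Proof.
move=> nq; have -> : n = - (q + q^-1) by rewrite nq opprK.
rewrite /betaq /rq /lamq mulnS !addSn add0n.
have h1 := q1B; have h2 := qX1D k.+2; have h3 := qX1D k.+1; have q0 := q_neq0.
have h4 := qX1B (2 * k).+3.
move: h2 h3 h4; rewrite !exprS mulnC exprM; set x := q ^+ k => h2 h3 h4.
by field; rewrite h1 h2 h3 h4 q0.
Qed.

(* Coordinates, in the basis of monic orthogonal polynomials with recurrence
   coefficients [betaq], of the polynomials [z^m + z^-m] of [z + z^-1]. *)
Fixpoint chebX m : nat -> R :=
  match m with
  | 0 => fun k => if k is 0 then 2 else 0
  | m'.+1 => fun k =>
    match m' with
    | 0 => (k == 1%N)%:R
    | m''.+1 => (if k is k'.+1 then chebX m' k' else 0)
                + betaq k.+1 * chebX m' k.+1 - chebX m'' k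
    end
  end.

Lemma chebXSS m k : chebX m.+2 k =
  (if k is k'.+1 then chebX m.+1 k' else 0) + betaq k.+1 * chebX m.+1 k.+1 - chebX m k.
Proof. by []. Qed.

(** The three products are the q-shifted factorials (q; q)_m, (-q; q)_m and (-1/q; q)_m. *)
Fixpoint qfactB m : R := if m is m'.+1 then qfactB m' * (1 - q ^+ m) else 1.
Fixpoint qfactD m : R := if m is m'.+1 then qfactD m' * (1 + q ^+ m) else 1.
Fixpoint qpochNV m : R := if m is m'.+1 then qpochNV m' * (1 + q ^+ m' / q) else 1.

Lemma qfactBS m : qfactB m.+1 = qfactB m * (1 - q ^+ m.+1). Proof. by []. Qed.
Lemma qfactDS m : qfactD m.+1 = qfactD m * (1 + q ^+ m.+1). Proof. by []. Qed.
Lemma qpochNVS m : qpochNV m.+1 = qpochNV m * (1 + q ^+ m / q). Proof. by []. Qed.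

Lemma qfactB_neq0 m : qfactB m != 0.
Proof. by elim: m => [|m IH] /=; rewrite ?oner_neq0 // mulf_neq0 // qX1B. Qed.

Lemma qfactD_neq0 m : qfactD m != 0.
Proof. by elim: m => [|m IH] /=; rewrite ?oner_neq0 // mulf_neq0 // qX1D. Qed.

(* The product formula for the coordinate [k] of [z^(k+2l) + z^-(k+2l)],
   a connection coefficient between q-ultraspherical polynomials. *)
Definition xi k l : R :=
  (- q) ^+ l * qpochNV l * qfactB (k + l).-1 * (1 - q ^+ (k + 2 * l)) * qfactD k.+1 /
  (qfactB l * qfactB k * qfactD (k + l).+1).

Lemma xi0r k : xi k.+1 0 = 1.
Proof.
rewrite /xi muln0 !addn0 expr0 [k.+1.-1]/= -[qfactB 0]/1 -[qpochNV 0]/1.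
rewrite !qfactDS !qfactBS.
have h1 := qX1B k; have h2 := qfactB_neq0 k; have h3 := qfactD_neq0 k.
have h4 := qX1D k.+1; have h5 := qX1D k.+2.
by field; rewrite ?h1 ?h2 ?h3 ?h4 ?h5.
Qed.

(** After the factorials are unrolled to common arguments, a rational identity in q, q^k and q^l
    remains. At k = 0 the first term drops out, which gives [xi_rec0S]. *)
Lemma xi_recS k l :
  xi k.+1 l.+1 = xi k l.+1 + betaq k.+2 * xi k.+2 l - xi k.+1 l.
Proof.
have neq := (q_neq0, qfactB_neq0, qfactD_neq0).
have h1 := qX1B k; have h2 := qX1B k.+1; have h3 := qX1B l.
have h4 := qX1D k.+2; have h5 := qX1D k.+3; have h6 := qX1D (k + l).+3.
have h7 := qX1D (k + l).+1; have h8 := qX1D (k + l).+2.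
rewrite /xi /betaq !mulnS !addSn !addnS add0n.
rewrite ![_.+1.-1]/= !qfactDS !qfactBS !qpochNVS.
move: h1 h2 h3 h4 h5 h6 h7 h8; rewrite !exprS [(2 * l)%N]mulnC !exprD exprM.
set x := q ^+ k; set y := q ^+ l => h1 h2 h3 h4 h5 h6 h7 h8.
by field; rewrite ?neq ?h1 ?h2 ?h3 ?h4 ?h5 ?h6 ?h7 ?h8.
Qed.

Lemma xi_rec0S l : xi 0 l.+2 = betaq 1 * xi 1 l.+1 - xi 0 l.+1.
Proof.
have neq := (q_neq0, qfactB_neq0, qfactD_neq0).
have h1 := q1B; have h2 := qX1B l; have h3 := qX1B l.+1.
have h4 := qX1D 1; have h5 := qX1D 2; have h6 := qX1D l.+3.
have h7 := qX1D l.+1; have h8 := qX1D l.+2.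
rewrite /xi /betaq !mulnS !addSn !addnS !add0n.
rewrite ![_.+1.-1]/= !qfactDS !qfactBS !qpochNVS.
move: h1 h2 h3 h4 h5 h6 h7 h8; rewrite !exprS ?expr0 ?mulr1 [(2 * l)%N]mulnC exprM.
set y := q ^+ l => h1 h2 h3 h4 h5 h6 h7 h8.
rewrite -[qfactD 0]/1 -[qfactB 0]/1.
by field; rewrite ?neq ?h1 ?h2 ?h3 ?h4 ?h5 ?h6 ?h7 ?h8.
Qed.

Lemma xi_rec01 : xi 0 1 = betaq 1 - 2.
Proof.
have q0 := q_neq0; have h1 := qX1B 0; have h4 := qX1D 1; have h5 := qX1D 2.
rewrite /xi /betaq /=; move: h1 h4 h5; rewrite !exprS !expr0 ?mulr1 => h1 h4 h5.
by field; rewrite ?q0 ?h1 ?h4 ?h5.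
Qed.

(** The degree m = 0 is excluded because [xi 0 0] vanishes through 1 - q^0 while the coordinate is
    2; for the same reason [xi_rec01] stands apart. Coordinates vanish off the parity of m and above
    degree m. *)
Lemma chebX_xi m :
  (forall k l, (k + 2 * l)%N = m -> (0 < m)%N -> chebX m k = xi k l) /\
  (forall k, odd (m + k) || (m < k)%N -> chebX m k = 0).
Proof.
suff: (forall k l, (k + 2 * l)%N = m -> (0 < m)%N -> chebX m k = xi k l) /\
  (forall k, odd (m + k) || (m < k)%N -> chebX m k = 0) /\
  (forall k l, (k + 2 * l)%N = m.+1 -> chebX m.+1 k = xi k l) /\
  (forall k, odd (m.+1 + k) || (m.+1 < k)%N -> chebX m.+1 k = 0).
  by move=> [a [b _]].
elim: m => [|m [IH1 [IH2 [IH3 IH4]]]].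
  split; first by move=> k l _; rewrite ltnn.
  split; first by case.
  split=> [k l|[|[|k]]] //.
  case: l => [|l]; last by rewrite mulnS addnCA; case: k l => [|k] [].
  by rewrite muln0 addn0 => ->; rewrite xi0r.
split=> [k l e _|]; first exact: IH3.
split=> //; split=> [k l|k].
  case: l => [|l].
    rewrite muln0 addn0 => -> {k}; rewrite chebXSS.
    have -> : chebX m.+1 m.+1 = xi m.+1 0 by apply: IH3; rewrite muln0 addn0.
    have -> : chebX m.+1 m.+3 = 0 by apply: IH4; rewrite ltnS leqnSn orbT.
    have -> : chebX m m.+2 = 0 by apply: IH2; rewrite ltnS leqnSn orbT.
    by rewrite !xi0r mulr0 addr0 subr0.
  case: k => [|k] e.
    have e' : (2 * l)%N = m by move: e; rewrite mulnS => -[].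
    have X1 : chebX m.+1 1 = xi 1 l by apply: IH3; rewrite e' add1n.
    rewrite chebXSS add0r X1; case: l e e' {X1} => [|l] e e'.
      by rewrite -e' xi0r mulr1 xi_rec01.
    have -> : chebX m 0 = xi 0 l.+1 by apply: IH1; rewrite ?add0n // -e' mulnS.
    by rewrite xi_rec0S.
  have e' : (k + 2 * l)%N.+1 = m by move: e; rewrite mulnS addnCA => -[].
  have X1 : chebX m.+1 k = xi k l.+1 by apply: IH3; rewrite -e' mulnS addnCA.
  have X2 : chebX m.+1 k.+2 = xi k.+2 l by apply: IH3; rewrite -e' !addSn.
  have X3 : chebX m k.+1 = xi k.+1 l by apply: IH1; rewrite -e' ?addSn.
  by rewrite chebXSS X1 X2 X3 xi_recS.
move=> h.
have X1 : chebX m k = 0.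
  apply: IH2; move: h; rewrite !addSn /= negbK => /orP[->//|h].
  by rewrite (ltn_trans _ h) ?orbT // ltnS leqnSn.
have X2 : chebX m.+1 k.+1 = 0.
  apply: IH4; move: h; rewrite !addnS !addSn /= negbK => /orP[->//|h].
  by rewrite ltnS ltnW ?orbT // ltnW.
rewrite chebXSS X1 X2 mulr0 addr0 subr0.
case: k h {X1 X2} => [|k] // h; apply: IH4; move: h.
by rewrite !addnS !addSn /= ltnS !negbK.
Qed.

Definition coefG r : R :=
  (-1) ^+ r * (q ^+ r.-1 * (1 + q) ^+ 2 / ((1 + q ^+ r.+1) * (1 + q ^+ r.-1))).

(** [qpochNV] is [qfactD] shifted by two places: its extra leading factors are 1 + 1/q and 2. *)
Lemma qpochNVE l : qpochNV l.+1 * (q * (1 + q ^+ l)) = 2 * (1 + q) * qfactD l.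
Proof.
have q0 := q_neq0; elim: l => [|l IH].
  by rewrite /= expr0; field; rewrite q0.
rewrite qpochNVS qfactDS [RHS]mulrA -IH; set p := qpochNV l.+1; rewrite exprS.
by field; rewrite q0.
Qed.

Lemma xi_coefG r : xi 0 r.+1 = 2 * coefG r.+1.
Proof.
have neq := (q_neq0, qfactB_neq0, qfactD_neq0).
have h1 := qX1B r; have h2 := qX1D r.+1; have h3 := qX1D r.+2; have h4 := qX1D r.
have e : qpochNV r.+1 = 2 * (1 + q) * qfactD r / (q * (1 + q ^+ r)).
  by rewrite -qpochNVE mulfK // mulf_neq0 // q_neq0.
rewrite /xi e /coefG !mulnS !addSn !add0n ![_.+1.-1]/= !qfactDS !qfactBS.
rewrite -[qfactD 0]/1 -[qfactB 0]/1 [(- q) ^+ _]exprNn.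
move: h1 h2 h3 h4; rewrite !exprS expr0 ?mulr1 [(2 * r)%N]mulnC exprM.
set y := q ^+ r => h1 h2 h3 h4.
by field; rewrite ?neq ?h1 ?h2 ?h3 ?h4.
Qed.

Lemma chebX_even r : chebX (2 * r.+1) 0 = 2 * coefG r.+1.
Proof. by rewrite -xi_coefG; apply: (chebX_xi _).1. Qed.

Lemma chebX_odd m : odd m -> chebX m 0 = 0.
Proof. by move=> om; apply: (chebX_xi _).2; rewrite addn0 om. Qed.

End QIdentities.

(** The polynomial 2 T_m(X/2), with T_m the Chebyshev polynomial: it sends z + 1/z to z^m + z^-m. *)
Fixpoint cheb (K : nzRingType) m : {poly K} :=
  match m with
  | 0 => 2%:P
  | m'.+1 => if m' is m''.+1 then 'X * cheb K m' - cheb K m'' else 'X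
  end.

Lemma chebSS (K : nzRingType) m : cheb K m.+2 = 'X * cheb K m.+1 - cheb K m.
Proof. by []. Qed.

Lemma map_cheb (K L : nzRingType) (f : {rmorphism K -> L}) m :
  map_poly f (cheb K m) = cheb L m.
Proof.
suff: map_poly f (cheb K m) = cheb L m /\ map_poly f (cheb K m.+1) = cheb L m.+1 by case.
elim: m => [|m [IH IH']]; first by rewrite /= map_polyC /= rmorph_nat map_polyX.
by rewrite !chebSS rmorphB rmorphM /= map_polyX IH IH'.
Qed.

(** * The cyclic subspace of one generator *)

Section Jacobi.
Variables (R : realType) (n : nat) (q : R).
Notation C := R[i].
Hypothesis q_gtN1 : -1 < q.
Hypothesis q_lt0 : q < 0.
Hypothesis nq : q + q^-1 = - n%:R.

Notation An := (@annih R n).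
Notation fd := (@fdim R n).
Notation l2 := (l2sum R fd).
Notation H := (l2hilbert R (@fd0 R n)).
Notation lam := (lamq q).
Notation lam0 := (lamq0 q).
Notation lamS := (fun k => lamqS q_gtN1 q_lt0 k nq).
Notation gen := (@gen R n lam (lamq_ge0 q_gtN1 q_lt0) (lamq_le1 q_gtN1 q_lt0)).
Notation Om := (@l2unit R fd (@fd0 R n) : H).

Fixpoint created (i : 'I_n) k : 'cV[C]_(fd k) :=
  match k return 'cV[C]_(fd k) with
  | 0 => const_mx 1
  | k'.+1 => (An k' i)^H *m created i k'
  end.
Arguments created : simpl never.

Lemma createdS i k : created i k.+1 = (An k i)^H *m created i k. Proof. by []. Qed.

Lemma annih_created i k : An k i *m created i k.+1 = (rq q k.+1)%:C *: created i k.
Proof.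
elim: k => [|k IH]; rewrite createdS mulmxA.
  by rewrite annih_comm0 eqxx mul1mx rq1 // scale1r.
rewrite (annih_commS lam0 lamS) eqxx mulmxBl mul1mx -scalemxAl -mulmxA IH.
rewrite -scalemxAr scalerA -createdS -[X in X - _]scale1r -scalerBl.
rewrite rqSS // rmorphB rmorph1; congr ((_ - _) *: _).
by rewrite -rmorphM.
Qed.

(** One vector per level; together they span a subspace that v_ij preserves, and this reduces v_ij
    to a Jacobi matrix. *)
Definition diagv i j k : 'M[C]_(fd k) := created i k *m (created j k)^H.

Lemma lower_diagv i j (X : forall k, 'M[C]_(fd k)) k (c : C) :
  X k.+1 = c *: diagv i j k.+1 ->
  lower lam i j X k = (wt lam k * c * (rq q k.+1 ^+ 2)%:C) *: diagv i j k.
Proof.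
move=> Xk; rewrite lowerE Xk -scalemxAr -scalemxAl scalerA /diagv.
rewrite mulmxA annih_created -mulmxA -adjmxM annih_created adjmxZ conj_real.
rewrite -scalemxAl -scalemxAr !scalerA; congr (_ *: _).
by rewrite -!mulrA -rmorphM.
Qed.

Lemma raise_diagv i j (X : forall k, 'M[C]_(fd k)) k (c : C) :
  X k = c *: diagv i j k ->
  raise lam i j X k.+1 = (wt lam k * c) *: diagv i j k.+1.
Proof.
move=> Xk; rewrite raiseS Xk -scalemxAr -scalemxAl scalerA /diagv !createdS.
by rewrite adjmxM adjmxK !mulmxA.
Qed.

Definition sn : R := Num.sqrt (n + 2)%N%:R.

Lemma sn_sqr : sn ^+ 2 = n%:R + 2.
Proof. by rewrite sqr_sqrtr // natrD. Qed.

(** Normalisation making the raising coefficient 1: [gq k] times [diagv i j k] is the image of the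
    vacuum under the monic orthogonal polynomial of degree k in w. *)
Fixpoint gq k : R := if k is k'.+1 then sn * Num.sqrt (lam k) * gq k' else 1.

Lemma gqS k : gq k.+1 = sn * Num.sqrt (lam k.+1) * gq k. Proof. by []. Qed.

Definition genW i j : bop H := sn%:C *: gen i j.

Lemma genW_diagv i j (x : l2) (c : nat -> R) k :
  (forall l, x l = (gq l * c l)%:C *: diagv i j l) ->
  (genW i j x : l2) k =
  (gq k * ((if k is k'.+1 then c k' else 0) + betaq q k.+1 * c k.+1))%:C *: diagv i j k.
Proof.
move=> xc; rewrite (_ : (genW i j x : l2) k = sn%:C *: genf lam i j x k) //.
rewrite /genf (lower_diagv (xc k.+1)).
rewrite (betaqE q_gtN1 q_lt0 k nq) -sn_sqr.
have l0 := lamq_ge0 q_gtN1 q_lt0.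
case: k => [|k].
  rewrite raise0 addr0 add0r scalerA; congr (_ *: _).
  rewrite /wt -!rmorphM; congr (_ %:C).
  rewrite gqS; set t := Num.sqrt _; have e : lamq q 1 = t ^+ 2 by rewrite sqr_sqrtr.
  by rewrite e; ring.
rewrite (raise_diagv (xc k)) -scalerDl scalerA; congr (_ *: _).
rewrite /wt -!rmorphM -rmorphD -rmorphM; congr (_ %:C).
rewrite !gqS; set s := Num.sqrt (lamq q k.+1); set t := Num.sqrt (lamq q k.+2).
have e : lamq q k.+2 = t ^+ 2 by rewrite sqr_sqrtr.
by rewrite e; ring.
Qed.

Lemma horner_alg_cheb i j m k :
  ((horner_alg (genW i j) (cheb C m)) Om : l2) k =
  (gq k * chebX q m k)%:C *: diagv i j k.
Proof.
suff: (forall k, ((horner_alg (genW i j) (cheb C m)) Om : l2) k =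
  (gq k * chebX q m k)%:C *: diagv i j k) /\
  (forall k, ((horner_alg (genW i j) (cheb C m.+1)) Om : l2) k =
  (gq k * chebX q m.+1 k)%:C *: diagv i j k) by case.
elim: m {k} => [|m [IH IH']].
  have e0 l : (Om : l2) l = (gq l * (l == 0%N)%:R)%:C *: diagv i j l.
    rewrite /= /l2unit_fun; case: l => [|l] /=; last by rewrite mulr0 scale0r.
    rewrite mulr1 scale1r /diagv; apply/matrixP => a b.
    by rewrite !ord1 !mxE big_ord1 !mxE conjC1 mulr1.
  split=> k.
    rewrite horner_algC (_ : (2%:A : bop H) Om = 2 *: Om) //.
    rewrite [LHS]/= -[l2unit_fun _ _ _]/((Om : l2) k) e0 scalerA.
    congr (_ *: _); rewrite -[2 * _]/((2 : C) * _) -(rmorph_nat (real_complex R) 2) -rmorphM.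
    by congr (_ %:C); case: k => [|k] /=; ring.
  rewrite horner_algX (genW_diagv _ e0); congr (_%:C *: _); congr (_ * _).
  by case: k => [|[|k]] /=; ring.
split=> k; first exact: IH'.
rewrite chebSS rmorphB rmorphM [X in X * _]horner_algX bopBE.
rewrite l2BE -[X in X - _]/((genW i j ((horner_alg (genW i j) (cheb C m.+1)) Om) : l2) k).
rewrite (genW_diagv _ IH') IH -scalerBl -rmorphB; congr (_%:C *: _).
rewrite chebXSS -mulrBr; congr (_ * _).
Qed.

Lemma vacuum_cheb i j m :
  vacuum (horner_alg (genW i j) (cheb C m)) = (chebX q m 0)%:C.
Proof.
rewrite /vacuum horner_alg_cheb mul1r /diagv !mxE big_ord1 !mxE conjC1.
by rewrite !mulr1.
Qed.

Lemma horner_algE (B : algType C) (b : B) (p : {poly C}) :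
  horner_alg b p = \sum_(m < size p) p`_m *: b ^+ m.
Proof.
rewrite -{1}[p]coefK poly_def rmorph_sum; apply: eq_bigr => m _ /=.
by rewrite -mul_polyC rmorphM rmorphXn /= horner_algC horner_algX mulr_algl.
Qed.

Section HaarChebyshev.
Variables (A AA : cstarAlgType R) (u : 'M[A]_n) (tens : A -> A -> AA).
Variables (Delta : {lrmorphism A -> AA}) (haar : {scalar A}).
Hypothesis uAo : is_Ao u.
Hypothesis ten : is_cstar_tensor tens.
Hypothesis comul : is_comul u tens Delta.
Hypothesis Haar : is_Haar tens Delta haar.

Lemma haar_horner i j (p : {poly C}) :
  haar (horner_alg (sn%:C *: u i j) p) = vacuum (horner_alg (genW i j) p).
Proof.
rewrite !horner_algE linear_sum vacuum_sum; apply: eq_bigr => m _.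
rewrite !exprZn !linearZ !vacuumZ /= [RHS]mulrCA; congr (_ * (_ * _)).
exact: (haar_moment lam0 lamS (lamq_ge0 q_gtN1 q_lt0) (lamq_le1 q_gtN1 q_lt0)
  (Ao_rel uAo) uAo ten comul Haar).
Qed.

Lemma haar_cheb i j m :
  haar (horner_alg (sn%:C *: u i j) (cheb C m)) = (chebX q m 0)%:C.
Proof. by rewrite haar_horner vacuum_cheb. Qed.

End HaarChebyshev.
End Jacobi.

(** * The two series and the density *)

Section CcvgMore.
Variable R : realType.
Notation C := R[i].
Implicit Types (u v : nat -> C) (l k : C).

Definition nrm (z : C) : R := complex.Re `|z|.

Lemma nrmE z : `|z| = (nrm z)%:C. Proof. exact: normc_Re. Qed.

Lemma nrm_ge0 z : 0 <= nrm z.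
Proof. by rewrite -lecR -nrmE normr_ge0. Qed.

Lemma nrm1 : nrm 1 = 1. Proof. by rewrite /nrm normr1. Qed.

Lemma nrmM z z' : nrm (z * z') = nrm z * nrm z'.
Proof. by apply: (@complexI R); rewrite -nrmE normrM !nrmE rmorphM. Qed.

Lemma nrmV z : nrm z^-1 = (nrm z)^-1.
Proof. by apply: (@complexI R); rewrite -nrmE normfV !nrmE fmorphV. Qed.

Lemma nrmX z m : nrm (z ^+ m) = nrm z ^+ m.
Proof. by apply: (@complexI R); rewrite -nrmE normrX !nrmE rmorphXn. Qed.

Lemma nrmN z : nrm (- z) = nrm z. Proof. by rewrite /nrm normrN. Qed.

Lemma nrmD z z' : nrm (z + z') <= nrm z + nrm z'.
Proof. by rewrite -lecR rmorphD -!nrmE ler_normD. Qed.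

Lemma nrm_real (r : R) : nrm r%:C = `|r|.
Proof. by rewrite /nrm normc_def /= expr0n addr0 sqrtr_sqr. Qed.

Lemma nrm_sum (I : Type) (r : seq I) (P : pred I) (F : I -> C) :
  nrm (\sum_(i <- r | P i) F i) <= \sum_(i <- r | P i) nrm (F i).
Proof.
elim/big_ind2: _ => [|x x' y y' h h'|//]; first by rewrite /nrm normr0.
exact: le_trans (nrmD _ _) (lerD h h').
Qed.

Lemma norm_Re_nrm z : `|complex.Re z| <= nrm z.
Proof. by rewrite -lecR -nrmE normc_ge_Re. Qed.

Lemma norm_Im_nrm z : `|complex.Im z| <= nrm z.
Proof.
rewrite -[nrm z]mul1r -[X in X * _](_ : nrm 'i%C = 1); last first.
  by rewrite /nrm normc_def /= expr0n expr1n add0r sqrtr1.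
rewrite -nrmM mulrC -[`|_|]normrN -ReiNIm; exact: norm_Re_nrm.
Qed.

Lemma nrm_le_ReIm z : nrm z <= `|complex.Re z| + `|complex.Im z|.
Proof.
rewrite {1}[z]complexE; apply: le_trans (nrmD _ _) _.
rewrite nrmM !nrm_real [nrm 'i%C](_ : _ = 1) ?mul1r //.
by rewrite /nrm normc_def /= expr0n expr1n add0r sqrtr1.
Qed.

Lemma ccvg_cvg u l : ccvg u l -> (u : nat -> C^o) @ \oo --> (l : C^o).
Proof.
move=> [uR uI]; apply/cvgrPdist_lt => e e0.
have er : e = (complex.Re e)%:C by apply: ge0_real; exact: ltW.
have e1 : 0 < complex.Re e / 2 by rewrite divr_gt0 // -ltcR -er.
move/cvgrPdist_lt : uR => /(_ _ e1) uR; move/cvgrPdist_lt : uI => /(_ _ e1) uI.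
near=> N; rewrite er nrmE ltcR; apply: le_lt_trans (nrm_le_ReIm _) _.
rewrite (splitr (complex.Re e)) ReD ReN ImD (_ : complex.Im (- u N) = - complex.Im (u N)).
  by apply: ltrD; near: N.
by case: (u N).
Unshelve. all: by end_near. Qed.

Lemma ccvg_squeeze u l (b : nat -> R) : (forall N, nrm (u N - l) <= b N) ->
  b N @[N --> \oo] --> (0 : R) -> ccvg u l.
Proof.
move=> ub b0.
split; apply/cvgrPdist_lt => e e0; move/cvgrPdist_lt : b0 => /(_ _ e0) b0;
  near=> N; (have : `|0 - b N| < e by near: N); rewrite sub0r normrN;
  move/(le_lt_trans (ler_norm _)); apply: le_lt_trans; apply: le_trans (ub N).
  by rewrite distrC -ReN -ReD; exact: norm_Re_nrm.
rewrite distrC (_ : _ - _ = complex.Im (u N - l)); first exact: norm_Im_nrm.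
by rewrite ImD; case: l {ub}.
Unshelve. all: by end_near. Qed.

Lemma ccvg_cst l : ccvg (fun=> l) l.
Proof. by split; exact: cvg_cst. Qed.

Lemma ccvg_sum (I : Type) (r : seq I) (f : nat -> I -> C) (g : I -> C) :
  (forall i, ccvg (f^~ i) (g i)) ->
  ccvg (fun N => \sum_(i <- r) f N i) (\sum_(i <- r) g i).
Proof.
move=> fg; elim: r => [|i r IH].
  rewrite big_nil; apply: eq_ccvg (ccvg_cst 0) => N; by rewrite big_nil.
rewrite big_cons; apply: eq_ccvg (ccvgD (fg i) IH) => N; by rewrite big_cons.
Qed.

(** The factor 2 comes from bounding the real and imaginary parts separately. *)
Lemma ccvg_nrm_le u l b : ccvg u l -> (forall N, nrm (u N) <= b) -> nrm l <= 2 * b.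
Proof.
move=> [uR uI] ub; apply: le_trans (nrm_le_ReIm _) _; rewrite mulrDl mul1r.
have key (a : nat -> R) s : a N @[N --> \oo] --> s -> (forall N, `|a N| <= b) -> `|s| <= b.
  move=> as_ ab; rewrite -(cvg_lim _ (cvg_norm as_)) //.
  by apply: limr_le; [apply/cvg_ex; eexists; exact: (cvg_norm as_) | exact: nearW].
apply: lerD.
  by apply: (key _ _ uR) => N; exact: le_trans (norm_Re_nrm _) (ub N).
by apply: (key _ _ uI) => N; exact: le_trans (norm_Im_nrm _) (ub N).
Qed.

Lemma geometric_sum_le (x : R) N : 0 <= x < 1 -> \sum_(j < N) x ^+ j <= (1 - x)^-1.
Proof.
move=> /andP[x0 x1]; rewrite -[leRHS]mul1r ler_pdivlMr ?subr_gt0 //.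
rewrite mulrC -[leLHS]opprK -mulNr opprB -subrX1 opprB lerBlDr lerDl.
exact: exprn_ge0.
Qed.

Lemma ccvg_series_geometric (a : nat -> C) (x K : R) : 0 <= x < 1 ->
  (forall j, nrm (a j) <= K * x ^+ j) ->
  exists l, ccvg (fun N => \sum_(j < N) a j) l.
Proof.
move=> x01 ab.
have K0 : 0 <= K by have := ab 0%N; rewrite expr0 mulr1; apply: le_trans; exact: nrm_ge0.
have bK N : \sum_(j < N) K * x ^+ j <= K / (1 - x).
  by rewrite -mulr_sumr ler_wpM2l // geometric_sum_le.
have cR : cvgn (fun N => \sum_(j < N) complex.Re (a j)).
  apply: (@dominated_series_cvg _ (fun j => complex.Re (a j)) _ _ _ bK) => j.
  exact: le_trans (norm_Re_nrm _) (ab j).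
have cI : cvgn (fun N => \sum_(j < N) complex.Im (a j)).
  apply: (@dominated_series_cvg _ (fun j => complex.Im (a j)) _ _ _ bK) => j.
  exact: le_trans (norm_Im_nrm _) (ab j).
exists (limn (fun N => \sum_(j < N) complex.Re (a j)) +i*
        limn (fun N => \sum_(j < N) complex.Im (a j))); split => /=.
  by under eq_cvg do rewrite Re_sum.
by under eq_cvg do rewrite Im_sum.
Qed.

Lemma sum1S (V : nmodType) (f : nat -> V) N :
  \sum_(1 <= k < N.+1) f k = \sum_(j < N) f j.+1.
Proof. by rewrite big_add1 /= big_mkord. Qed.

Lemma csumP (f : nat -> C) l : ccvg (fun N => \sum_(j < N) f j.+1) l ->
  csummable f /\ csum f = l.
Proof.
move=> fl; have h : (fun N => \sum_(1 <= k < N.+1) f k : C^o) @ \oo --> (l : C^o).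
  rewrite (_ : (fun N => _) = fun N => \sum_(j < N) f j.+1).
    exact: ccvg_cvg.
  by apply: funext => N; rewrite sum1S.
split; first by apply/cvg_ex; exists l.
exact: (@cvg_lim C^o).
Qed.

Lemma cvg_expr_small (x K : R) : 0 <= x < 1 -> (K * x ^+ N) @[N --> \oo] --> (0 : R).
Proof.
move=> /andP[x0 x1]; rewrite -[X in _ --> X](mulr0 K); apply: cvgMr.
by apply: cvg_expr; rewrite ger0_norm.
Qed.

End CcvgMore.

(** * Equality of the two series for G *)

Section Series.
Variables (R : realType) (q : R).
Notation C := R[i].
Hypothesis q_gtN1 : -1 < q.
Hypothesis q_lt0 : q < 0.

Lemma norm_q01 : 0 <= `|q| < 1.
Proof. by rewrite normr_ge0 norm_q_lt1. Qed.

Lemma qX1D_ge k : 1 + q <= 1 + q ^+ k.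
Proof.
rewrite lerD2l; case: k => [|k]; first by rewrite expr0 ltW // (lt_trans q_lt0).
have : `|q ^+ k.+1| <= `|q|.
  by rewrite exprS normrM ler_piMr ?normr_ge0 // norm_qX.
by rewrite (ltr0_norm q_lt0) ler_norml opprK => /andP[].
Qed.

Lemma norm_coefG r : `|coefG q r.+1| <= `|q| ^+ r.
Proof.
have q1 : 0 < 1 + q by rewrite -ltrBlDl sub0r.
have h a b : 0 < (1 + q ^+ a) * (1 + q ^+ b) by rewrite mulr_gt0 // qX1D_gt0.
rewrite /coefG normrM normrX normrN1 expr1n mul1r /= normf_div normrM normrX.
rewrite (gtr0_norm (h _ _)) ler_pdivrMr // ler_wpM2l ?exprn_ge0 //.
by rewrite ger0_norm ?sqr_ge0 // expr2 ler_pM ?qX1D_ge // ltW.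
Qed.

(** The sum over k >= 1 of (-q^(s+1))^k, that is, the coefficient of (-z^2)^s in the sum of the
    terms of [G1]. *)
Definition coefD s : R := - q ^+ s.+1 / (1 + q ^+ s.+1).

Lemma norm_coefD s : `|coefD s| <= `|q| ^+ s / (1 + q).
Proof.
have q1 : 0 < 1 + q by rewrite -ltrBlDl sub0r.
rewrite /coefD normrM normrN normrX normfV (gtr0_norm (qX1D_gt0 q_gtN1 q_lt0 _)).
apply: ler_pM; rewrite ?exprn_ge0 ?invr_ge0 ?(ltW (qX1D_gt0 _ _ _)) //.
  by rewrite exprS ler_piMl ?exprn_ge0 // ltW // norm_q_lt1.
by rewrite lef_pV2 ?posrE ?qX1D_gt0 // qX1D_ge.
Qed.

(** The factor 1 - z^4 turns the coefficient of (-z^2)^(s+2) into this difference. *)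
Lemma coefD_coefG s : (1 + q) / (1 - q) * (coefD s.+2 - coefD s) =
  q ^+ s.+1 * (1 + q) ^+ 2 / ((1 + q ^+ s.+3) * (1 + q ^+ s.+1)).
Proof.
have h1 := qX1D q_gtN1 q_lt0 s.+3; have h2 := qX1D q_gtN1 q_lt0 s.+1.
have h3 := q1B q_gtN1 q_lt0; rewrite /coefD.
move: h1 h2; rewrite !exprS; set x := q ^+ s => h1 h2.
by field; rewrite h1 h2 h3.
Qed.

Lemma cvg_geom_coefD s :
  (\sum_(j < N) (- q ^+ s.+1) ^+ j.+1) @[N --> \oo] --> coefD s.
Proof.
have h := qX1D q_gtN1 q_lt0 s.+1.
set y := - q ^+ s.+1; have e N : \sum_(j < N) y ^+ j.+1 = coefD s - coefD s * y ^+ N.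
  have h' : 1 - y != 0 by rewrite opprK.
  under eq_bigr do rewrite exprS.
  rewrite -mulr_sumr; apply: (mulfI h').
  have g : (1 - y) * \sum_(j < N) y ^+ j = 1 - y ^+ N.
    by rewrite -[LHS]opprK -mulNr opprB -subrX1 opprB.
  have -> : coefD s = y / (1 - y) by rewrite opprK.
  by rewrite mulrCA g; field.
rewrite (_ : (fun N => _) = fun N => coefD s - coefD s * y ^+ N); last exact: funext.
rewrite -[X in _ --> X]subr0; apply: cvgB; first exact: cvg_cst.
rewrite -[X in _ --> X](mulr0 (coefD s)); apply: cvgMr; apply: cvg_expr.
by rewrite normrN norm_qXS.
Qed.

Variable z : C.
Hypothesis z1 : `|z| = 1.

Lemma nrm_z2 : nrm (z ^+ 2) = 1.
Proof. by rewrite nrmX /nrm z1 expr1n. Qed.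

Lemma nrm_qX k : nrm (q%:C ^+ k) = `|q| ^+ k.
Proof. by rewrite nrmX nrm_real. Qed.

Lemma nrm_1Dqz k : 1 + q <= nrm (1 + q%:C ^+ k.+1 * z ^+ 2).
Proof.
have := nrmD (1 + q%:C ^+ k.+1 * z ^+ 2) (- (q%:C ^+ k.+1 * z ^+ 2)).
rewrite addrK nrm1 nrmN nrmM nrm_qX nrm_z2 mulr1 -lerBlDr; apply: le_trans.
have : `|q| ^+ k.+1 <= `|q|.
  by rewrite exprS ler_piMr // exprn_ile1 // ltW // norm_q_lt1.
rewrite [X in _ <= X](ltr0_norm q_lt0); lra.
Qed.

Lemma q1_gt0 : 0 < 1 + q. Proof. by rewrite -ltrBlDl sub0r. Qed.

Lemma denG_neq0 k : 1 + q%:C ^+ k.+1 * z ^+ 2 != 0.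
Proof.
apply/eqP => e; have := nrm_1Dqz k; rewrite e /nrm normr0 /=.
by have := q1_gt0; lra.
Qed.

Lemma nrm_denGV k : nrm (1 + q%:C ^+ k.+1 * z ^+ 2)^-1 <= (1 + q)^-1.
Proof.
have h := nrm_1Dqz k; have q1 := q1_gt0.
by rewrite nrmV lef_pV2 ?posrE // (lt_le_trans q1).
Qed.

Lemma G1_term_cvg : exists l, ccvg (fun N => \sum_(j < N) G1_term q z j.+1) l.
Proof.
apply: (@ccvg_series_geometric _ (fun j => G1_term q z j.+1) `|q| (1 + q)^-1 norm_q01) => j.
rewrite /G1_term nrmM nrmX nrmN nrm1 expr1n mul1r nrmM nrm_qX mulrC.
apply: ler_pM; rewrite ?nrm_ge0 ?exprn_ge0 ?nrm_denGV //.
by rewrite exprS ler_piMl ?exprn_ge0 // ltW // norm_q_lt1.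
Qed.

Lemma G2_termE r : G2_term q z r = (coefG q r)%:C * (z ^+ 2) ^+ r.
Proof.
rewrite /G2_term /coefG exprM; congr (_ * _); rewrite [RHS]rmorphM.
by rewrite rmorphXn rmorphN1.
Qed.

Lemma nrm_G2_term r : nrm (G2_term q z r.+1) <= 1 * `|q| ^+ r.
Proof.
by rewrite G2_termE nrmM nrmX nrm_z2 expr1n mulr1 nrm_real mul1r norm_coefG.
Qed.

Lemma G2_term_cvg : exists l, ccvg (fun N => \sum_(j < N) G2_term q z j.+1) l.
Proof. exact: (@ccvg_series_geometric _ (fun j => G2_term q z j.+1) _ _ norm_q01 nrm_G2_term). Qed.

(* Expanding each term of [G1] geometrically and summing over [k] first. *)
Definition partE S : C := \sum_(s < S) (- z ^+ 2) ^+ s * (coefD s)%:C.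

Lemma G1_term_expand S k : G1_term q z k.+1 =
  \sum_(s < S) (- z ^+ 2) ^+ s * ((- q ^+ s.+1) ^+ k.+1)%:C +
  (-1) ^+ k.+1 * q%:C ^+ k.+1 * ((- (q%:C ^+ k.+1 * z ^+ 2)) ^+ S
    / (1 + q%:C ^+ k.+1 * z ^+ 2)).
Proof.
have d := denG_neq0 k; set y := - (q%:C ^+ k.+1 * z ^+ 2).
have -> : 1 + q%:C ^+ k.+1 * z ^+ 2 = 1 - y by rewrite opprK.
have d' : 1 - y != 0 by rewrite opprK.
have -> : \sum_(s < S) (- z ^+ 2) ^+ s * ((- q ^+ s.+1) ^+ k.+1)%:C =
    (-1) ^+ k.+1 * q%:C ^+ k.+1 * \sum_(s < S) y ^+ s.
  rewrite mulr_sumr; apply: eq_bigr => s _; rewrite /y rmorphXn rmorphN rmorphXn /=.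
  set p := q%:C; rewrite -[- p ^+ s.+1]mulN1r -[- z ^+ 2]mulN1r.
  rewrite -[- (p ^+ k.+1 * _)]mulN1r !exprMn -!exprM [(s.+1 * _)%N]mulSn mulnC exprD.
  ring.
rewrite /G1_term [LHS]mulrA -mulrDr; congr (_ * _).
have -> : 1 + q%:C ^+ k.+1 * z ^+ 2 = 1 - y by rewrite opprK.
have g : (1 - y) * \sum_(s < S) y ^+ s = 1 - y ^+ S.
  by rewrite -[LHS]opprK -mulNr opprB -subrX1 opprB.
by apply: (mulfI d'); rewrite mulrDr g divff // mulrCA divff // mulr1 subrK.
Qed.

(** The two sums are exchanged on a finite rectangle, with the exact remainder of [G1_term_expand].
    Its bound is uniform in N: 1/(1 + q) controls the denominators and 1/(1 - |q|) the sum over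
    k. *)
Lemma partE_cvg_bound l S : ccvg (fun N => \sum_(j < N) G1_term q z j.+1) l ->
  nrm (l - partE S) <= 2 * (((1 + q)^-1 * (1 - `|q|)^-1) * `|q| ^+ S).
Proof.
move=> Gl.
pose B N : C := \sum_(s < S) (- z ^+ 2) ^+ s * (\sum_(j < N) (- q ^+ s.+1) ^+ j.+1)%:C.
have BE : ccvg B (partE S).
  apply: ccvg_sum => s; apply: ccvgZ; split; last exact: cvg_cst.
  exact: cvg_geom_coefD.
have h := ccvg_nrm_le (ccvgD Gl (ccvgZ (-1) BE)).
rewrite mulN1r in h; apply: h => N; rewrite mulN1r.
have -> : \sum_(j < N) G1_term q z j.+1 - B N = \sum_(j < N)
    ((-1) ^+ j.+1 * q%:C ^+ j.+1 * ((- (q%:C ^+ j.+1 * z ^+ 2)) ^+ S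
    / (1 + q%:C ^+ j.+1 * z ^+ 2))).
  under eq_bigr do rewrite (G1_term_expand S).
  rewrite big_split /= addrAC.
  rewrite (_ : B N = \sum_(j < N) \sum_(s < S) (- z ^+ 2) ^+ s * ((- q ^+ s.+1) ^+ j.+1)%:C).
    by rewrite subrr add0r.
  rewrite exchange_big; apply: eq_bigr => s _.
  by rewrite rmorph_sum mulr_sumr.
apply: le_trans (nrm_sum _ _ _) _.
apply: (@le_trans _ _ (\sum_(j < N) ((1 + q)^-1 * `|q| ^+ S) * `|q| ^+ j)).
  apply: ler_sum => j _; rewrite !nrmM !nrmX nrmN nrm1 expr1n mul1r nrm_real.
  rewrite nrmN nrmM nrm_qX nrm_z2 mulr1 mulrC -!mulrA [leLHS]mulrCA.
  have q0 := norm_q01; have /andP[q0' q1] := q0.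
  apply: ler_pM; rewrite ?nrm_ge0 ?mulr_ge0 ?exprn_ge0 ?nrm_denGV //.
  apply: ler_pM; rewrite ?exprn_ge0 //.
    by rewrite lerXn2r ?nnegrE ?exprn_ge0 // exprS ler_piMr // exprn_ile1 // ltW.
  by rewrite exprS ler_piMl ?exprn_ge0 // ltW.
rewrite -mulr_sumr [leRHS]mulrAC ler_wpM2l ?geometric_sum_le ?norm_q01 //.
by rewrite mulr_ge0 ?exprn_ge0 ?invr_ge0 // ltW // q1_gt0.
Qed.

(** Multiplying a truncated series by 1 - z^4 shifts it by two places, so two boundary terms remain;
    they tend to 0 because [coefD] decays geometrically. *)
Lemma partE_identity S : ((1 + q) / (1 - q))%:C *
    (1 - z ^+ 2 + 2 * (1 - z ^+ 4) * partE S.+2) =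
  1 + 2 * (\sum_(j < S.+1) G2_term q z j.+1) -
  2 * ((1 + q) / (1 - q))%:C * ((- z ^+ 2) ^+ S.+2 * (coefD S)%:C +
     (- z ^+ 2) ^+ S.+3 * (coefD S.+1)%:C).
Proof.
have z4 : z ^+ 4 = (z ^+ 2) ^+ 2 by rewrite -exprM.
have h3 := q1B q_gtN1 q_lt0; have h4 := qX1D q_gtN1 q_lt0 2.
have h5 : 1 + q != 0 by rewrite gt_eqF // q1_gt0.
set A := ((1 + q) / (1 - q))%:C; set w := z ^+ 2.
elim: S => [|S IH].
  (* [e0] and [e1] give the coefficients of 1 and z^2, which the shift by z^4 does not reach. *)
  have e0 : A * (1 + 2 * (coefD 0)%:C) = 1.
    rewrite /A -(rmorph1 (real_complex R)) -(rmorph_nat (real_complex R) 2).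
    rewrite -rmorphM -rmorphD -rmorphM.
    by congr (_%:C); rewrite /coefD expr1; field; rewrite h3 h5.
  have e1 : A * (- 1 - 2 * (coefD 1)%:C) = 2 * (coefG q 1)%:C.
    rewrite /A -(rmorphN1 (real_complex R)) -(rmorph_nat (real_complex R) 2).
    rewrite -!rmorphM -rmorphB -rmorphM.
    congr (_%:C); rewrite /coefD /coefG /= expr0 expr1 mul1r.
    by field; rewrite h4 h3.
  rewrite /partE !big_ord_recr !big_ord0 /= !add0r G2_termE z4 -/w !exprS !expr0.
  set D0 := (coefD 0)%:C in e0 *; set D1 := (coefD 1)%:C in e1 *.
  rewrite [LHS](_ : _ = A * (1 + 2 * D0) + w * (A * (- 1 - 2 * D1)) -
    2 * A * (w * w * D0 - w * w * w * D1)); last by ring.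
  by rewrite e0 e1; ring.
rewrite /partE big_ord_recr -/(partE S.+2) /= z4 -/w.
rewrite [LHS](_ : _ = A * (1 - w + 2 * (1 - w ^+ 2) * partE S.+2) +
  2 * A * (1 - w ^+ 2) * ((- w) ^+ S.+2 * (coefD S.+2)%:C)); last by ring.
rewrite -z4 IH [in RHS]big_ord_recr /= G2_termE z4 -/w.
have e : (coefG q S.+2)%:C = (-1) ^+ S.+2 * (A * ((coefD S.+2)%:C - (coefD S)%:C)).
  rewrite /coefG -rmorphB -rmorphM coefD_coefG rmorphM; congr (_ * _).
  by rewrite rmorphXn rmorphN1.
rewrite e -[- w]mulN1r !exprMn !exprS; ring.
Qed.

Lemma norm_expr_bound S (c : R) (K : R) : `|c| <= K -> nrm ((- z ^+ 2) ^+ S * c%:C) <= K.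
Proof. by move=> cK; rewrite nrmM nrmX nrmN nrm_z2 expr1n mul1r nrm_real. Qed.

Lemma G1_G2 : [/\ csummable (G1_term q z), csummable (G2_term q z) & G1 q z = G2 q z].
Proof.
have [l1 h1] := G1_term_cvg; have [l2 h2] := G2_term_cvg.
have [s1 e1] := csumP h1; have [s2 e2] := csumP h2; split => //.
rewrite /G1 /G2 e1 e2; set A := ((1 + q) / (1 - q))%:C.
have c1 : ccvg (fun S => partE S.+2) l1.
  apply: (@ccvg_squeeze _ _ _ (fun S => 2 * ((1 + q)^-1 * (1 - `|q|)^-1) * `|q| ^+ S)) => [S|].
    rewrite -nrmN opprB; apply: le_trans (partE_cvg_bound _ h1) _.
    rewrite -[leRHS]mulrA ler_wpM2l // ler_wpM2l ?mulr_ge0 ?invr_ge0 ?(ltW q1_gt0) //.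
      by rewrite subr_ge0 ltW // norm_q_lt1.
    by rewrite ler_wiXn2l // ?ltW ?norm_q_lt1 // -addn2 leq_addr.
  exact/cvg_expr_small/norm_q01.
have c2 : ccvg (fun S => A * (1 - z ^+ 2 + 2 * (1 - z ^+ 4) * partE S.+2))
    (A * (1 - z ^+ 2 + 2 * (1 - z ^+ 4) * l1)).
  exact: (ccvgZ A (ccvgD (ccvg_cst (1 - z ^+ 2)) (ccvgZ (2 * (1 - z ^+ 4)) c1))).
have c3 : ccvg (fun S => 1 + 2 * (\sum_(j < S.+1) G2_term q z j.+1)) (1 + 2 * l2).
  apply: (ccvgD (ccvg_cst 1) (ccvgZ 2 _)).
  by case: h2 => a b; split;
    [rewrite -(cvg_shiftS (fun N => complex.Re (\sum_(j < N) G2_term q z j.+1))) in a |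
     rewrite -(cvg_shiftS (fun N => complex.Im (\sum_(j < N) G2_term q z j.+1))) in b].
have c4 : ccvg (fun S => (- z ^+ 2) ^+ S.+2 * (coefD S)%:C +
     (- z ^+ 2) ^+ S.+3 * (coefD S.+1)%:C) 0.
  apply: (@ccvg_squeeze _ _ _ (fun S => (2 / (1 + q)) * `|q| ^+ S)) => [S|]; last first.
    exact/cvg_expr_small/norm_q01.
  rewrite subr0; apply: le_trans (nrmD _ _) _.
  rewrite (_ : 2 / (1 + q) * `|q| ^+ S = `|q| ^+ S / (1 + q) + `|q| ^+ S / (1 + q)); last by ring.
  apply: lerD; apply: norm_expr_bound.
    exact: norm_coefD.
  apply: le_trans (norm_coefD _) _; rewrite ler_wpM2r ?invr_ge0 ?(ltW q1_gt0) //.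
  by rewrite exprS ler_piMl ?exprn_ge0 // ltW // norm_q_lt1.
apply: ccvg_unique c2 _.
have := ccvgD c3 (ccvgZ (- (2 * A)) c4); rewrite mulr0 addr0.
by apply: eq_ccvg => S; rewrite partE_identity mulNr.
Qed.

End Series.

(** * Integration over the circle *)

Section CircleIntegral.
Variable R : realType.
Implicit Types f g : R -> R.

(** A class closed under sums and products and contained in the integrable functions on [0, 2 pi];
    integrability conditions reduce to these closure properties. *)
Definition bounded_measurable f :=
  measurable_fun [set: R] f /\ exists K : R, forall t, `|f t| <= K.

Notation bm := bounded_measurable.

Lemma bm_cst (c : R) : bm (fun=> c).
Proof. by split; [exact: measurable_cst | exists `|c|]. Qed.

Lemma bmD f g : bm f -> bm g -> bm (fun t => f t + g t).
Proof.
move=> [mf [K fK]] [mg [L gL]]; split; first exact: measurable_realfun.measurable_funD.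
by exists (K + L) => t; apply: le_trans (ler_normD _ _) _; exact: lerD.
Qed.

Lemma bmM f g : bm f -> bm g -> bm (fun t => f t * g t).
Proof.
move=> [mf [K fK]] [mg [L gL]]; split; first exact: measurable_realfun.measurable_funM.
by exists (K * L) => t; rewrite normrM ler_pM.
Qed.

Lemma bm_cos (k : R) : bm (fun t => cos (k * t)).
Proof.
split; last by exists 1 => t; rewrite ler_norml cos_geN1 cos_le1.
apply: measurable_realfun.continuous_measurable_fun => x.
apply: continuous_comp; last exact: continuous_cos.
by apply: mulrl_continuous.
Qed.

Notation I := (`[0, 2 * pi]%classic : set R).
Notation mu := (@lebesgue_measure R).

Lemma pi2_gt0 : 0 < 2 * pi :> R.
Proof. by rewrite mulr_gt0 // pi_gt0. Qed.

Lemma lebesgue_circle : mu I = (2 * pi)%:E.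
Proof.
apply: etrans (lebesgue_measure_itv `[0, 2 * pi]) _.
by rewrite /= lte_fin pi2_gt0 sube0.
Qed.

Lemma bm_integrable f : bm f -> mu.-integrable I (EFin \o f).
Proof.
move=> [mf [K fK]]; apply: measurable_bounded_integrable => //.
- by rewrite [X in (X < _)%E]lebesgue_circle ltry.
- exact: measurable_funS mf.
- by exists K; split => [|x Kx y _]; [exact: num_real | exact: le_trans (fK y) (ltW Kx)].
Qed.

Definition cint f : R := (2 * pi)^-1 * \int[mu]_(t in I) f t.


Lemma cintD f g : bm f -> bm g -> cint (fun t => f t + g t) = cint f + cint g.
Proof.
by move=> bf bg; rewrite /cint (RintegralD _ (bm_integrable bf) (bm_integrable bg)) ?mulrDr.
Qed.

Lemma cintZ c f : bm f -> cint (fun t => c * f t) = c * cint f.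
Proof.
by move=> bf; rewrite /cint (RintegralZl _ _ (bm_integrable bf)) // mulrCA.
Qed.

Lemma cint1 c : cint (fun=> c) = c.
Proof.
rewrite /cint Rintegral_cst // [X in fine X]lebesgue_circle /=.
by rewrite mulrCA mulVf ?mulr1 //; exact/lt0r_neq0/pi2_gt0.
Qed.

Lemma eq_cint f g : (forall t, f t = g t) -> cint f = cint g.
Proof. by move=> /funext ->. Qed.

Lemma cint_sum (J : Type) (r : seq J) (F : J -> R -> R) :
  (forall j, bm (F j)) -> bm (fun t => \sum_(j <- r) F j t) /\
  cint (fun t => \sum_(j <- r) F j t) = \sum_(j <- r) cint (F j).
Proof.
move=> bF; elim: r => [|j r [b e]].
  have -> : (fun t => \sum_(j <- [::]) F j t) = fun=> 0.
    by apply: funext => t; rewrite big_nil.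
  by rewrite big_nil cint1; split => //; exact: bm_cst.
have -> : (fun t => \sum_(j <- j :: r) F j t) = fun t => F j t + \sum_(j <- r) F j t.
  by apply: funext => t; rewrite big_cons.
by split; [exact: bmD | rewrite big_cons cintD // e].
Qed.

Lemma cint_le f K : bm f -> (forall t, `|f t| <= K) -> `|cint f| <= K.
Proof.
move=> bf fK; rewrite /cint normrM normfV (gtr0_norm pi2_gt0) mulrC.
rewrite ler_pdivrMr ?pi2_gt0 //.
apply: le_trans (le_normr_Rintegral _ (bm_integrable bf)) _ => //.
have bn : bm (fun t => `|f t|).
  case: bf => mf _; split; last by exists K => t; rewrite normr_id.
  exact: measurableT_comp.
apply: (@le_trans _ _ (\int[mu]_(t in I) K)).
  by apply: le_Rintegral => //; apply: bm_integrable => //; exact: bm_cst.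
by rewrite Rintegral_cst // [X in fine X]lebesgue_circle.
Qed.

Lemma sin_nat_2pi k : sin (k%:R * (2 * pi)) = 0 :> R.
Proof.
elim: k => [|k IH]; first by rewrite mul0r sin0.
rewrite -natr1 mulrDl mul1r [X in sin (_ + X)]mulr_natl.
by rewrite sinD2pi.
Qed.

Lemma cint_cos k : cint (fun t => cos (k%:R * t)) = (k == 0%N)%:R.
Proof.
have [->|k0] := eqVneq k 0%N.
  by rewrite (@eq_cint _ (fun=> 1)) ?cint1 // => t; rewrite mul0r cos0.
have kr : k%:R != 0 :> R by rewrite pnatr_eq0.
pose F : R -> R := fun t => k%:R^-1 * sin (k%:R * t).
have D (x : R) : is_derive x 1 F (cos (k%:R * x)).
  have h1 : is_derive x 1 (fun t : R => k%:R * t) k%:R.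
    have := @is_deriveZ _ _ _ (fun t : R => t) k%:R x 1 1 (is_derive_id _ _).
    by rewrite [_ *: 1]mulr1.
  have h2 := @is_derive1_comp _ sin (fun t : R => k%:R * t) x _ _ (is_derive_sin _) h1.
  have := @is_deriveZ _ _ _ _ k%:R^-1 x 1 _ h2.
  by rewrite [_ *: _]mulrCA mulVf // mulr1.
have cF : continuous F.
  by move=> x; apply: differentiable_continuous; apply/derivable1_diffP; case: (D x).
rewrite /cint /Rintegral (@continuous_FTC2 _ _ F 0 (2 * pi) pi2_gt0).
- by rewrite /F sin_nat_2pi !mulr0 sin0 !mulr0 /= subrr mulr0.
- apply: continuous_subspaceT => x; apply: continuous_comp; last exact: continuous_cos.
  exact: mulrl_continuous.
- split.
  + by move=> x _; case: (D x).
  + exact/cvg_at_right_filter/cF.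
  + exact/cvg_at_left_filter/cF.
- by move=> x _; rewrite derive1E; case: (D x).
Qed.

End CircleIntegral.

(** * Fourier coefficients of the density *)

Section Density.
Variables (R : realType) (q : R).
Notation C := R[i].
Notation bm := (@bounded_measurable R).
Hypothesis q_gtN1 : -1 < q.
Hypothesis q_lt0 : q < 0.

Lemma expiD (s t : R) : expi (s + t) = expi s * expi t.
Proof. by apply/eqP; rewrite eq_complex /= cosD sinD eqxx /= addrC. Qed.

Lemma expiX (t : R) m : expi t ^+ m = expi (m%:R * t).
Proof.
elim: m => [|m IH]; first by rewrite expr0 mul0r /expi cos0 sin0.
by rewrite exprS IH -expiD -natr1 mulrDl mul1r addrC.
Qed.

Lemma norm_expi (t : R) : `|expi t| = 1 :> C.
Proof. by rewrite normc_def /= cos2Dsin2 sqrtr1. Qed.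

Lemma expiV (t : R) : (expi t)^-1 = (expi t)^* :> C.
Proof.
have h : expi t != 0 :> C by rewrite -normr_eq0 norm_expi oner_neq0.
by apply: (mulfI h); rewrite divff // -normCK norm_expi expr1n.
Qed.

(** On the circle 1/z is the conjugate of z and the coefficients are real, so the mean of G(z) and
    G(1/z) is the real part of G. *)
Definition dens (t : R) : R := complex.Re (G2 q (expi t)).

Definition dens_part N (t : R) : R :=
  1 + \sum_(j < N) 2 * coefG q j.+1 * cos ((2 * j.+1)%:R * t).

Lemma G2_conj z : `|z| = 1 -> G2 q z^* = (G2 q z)^*.
Proof.
move=> z1; have [l h] := G2_term_cvg q_gtN1 q_lt0 z1.
rewrite /G2 (csumP h).2.
have h' : ccvg (fun N => \sum_(j < N) G2_term q z^* j.+1) l^*.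
  apply: eq_ccvg (ccvgJ h) => N; rewrite rmorph_sum; apply: eq_bigr => j _ /=.
  by rewrite !G2_termE rmorphM /= conj_real !rmorphXn.
by rewrite (csumP h').2 rmorphD rmorphM /= rmorph1 rmorph_nat.
Qed.

Lemma half_G1_sum t : 2^-1 * (G1 q (expi t) + G1 q (expi t)^-1) = (dens t)%:C :> C.
Proof.
have n1 := norm_expi t; have n2 : `|(expi t)^-1 : C| = 1 by rewrite normfV n1 invr1.
have [_ _ ->] := G1_G2 q_gtN1 q_lt0 n1; have [_ _ ->] := G1_G2 q_gtN1 q_lt0 n2.
rewrite expiV G2_conj // addcJ mulrA mulVf ?mul1r // pnatr_eq0.
Qed.

Lemma dens_tail N t : `|dens t - dens_part N t| <= 2 / (1 - `|q|) * `|q| ^+ N.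
Proof.
have n1 := norm_expi t; have [l h] := G2_term_cvg q_gtN1 q_lt0 n1.
pose a j := coefG q j.+1 * cos ((2 * j.+1)%:R * t).
have aE j : complex.Re (G2_term q (expi t) j.+1) = a j.
  by rewrite G2_termE -exprM ReZ expiX.
have ab j : `|a j| <= `|q| ^+ j.
  rewrite normrM -[leRHS]mulr1 ler_pM //; first exact: norm_coefG.
  by rewrite ler_norml cos_geN1 cos_le1.
have cva : (\sum_(j < M) a j) @[M --> \oo] --> complex.Re l.
  have [hR _] := h; rewrite (_ : (fun M => _) =
    fun M => complex.Re (\sum_(j < M) G2_term q (expi t) j.+1)) //.
  by apply: funext => M; rewrite Re_sum; apply: eq_bigr => j _; rewrite aE.
have -> : dens t - dens_part N t = 2 * (complex.Re l - \sum_(j < N) a j).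
  rewrite /dens /G2 (csumP h).2 ReD /dens_part.
  rewrite (_ : complex.Re (2 * l) = 2 * complex.Re l); last first.
    by rewrite -(rmorph_nat (real_complex R) 2) ReZ.
  have -> : \sum_(j < N) 2 * coefG q j.+1 * cos ((2 * j.+1)%:R * t) =
      2 * \sum_(j < N) a j.
    by rewrite mulr_sumr; apply: eq_bigr => j _; rewrite -mulrA.
  by rewrite /=; ring.
rewrite normrM ger0_norm // -mulrA ler_wpM2l //.
have cvb : `|\sum_(j < M) a j - \sum_(j < N) a j| @[M --> \oo] -->
    `|complex.Re l - \sum_(j < N) a j|.
  by apply: cvg_norm; apply: cvgB => //; exact: cvg_cst.
rewrite -(cvg_lim _ cvb) //; apply: limr_le.
  by apply/cvg_ex; eexists; exact: cvb.
exists N => // M /= NM.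
have -> : \sum_(j < M) a j = \sum_(j < N) a j + \sum_(j < M - N) a (N + j)%N.
  have split k : \sum_(j < N + k) a j = \sum_(j < N) a j + \sum_(j < k) a (N + j)%N.
    by rewrite big_split_ord.
  by rewrite -split subnKC.
rewrite addrC addKr.
apply: le_trans (ler_norm_sum _ _ _) _.
apply: (@le_trans _ _ (\sum_(j < M - N) `|q| ^+ N * `|q| ^+ j)).
  by apply: ler_sum => j _; rewrite -exprD; exact: ab.
rewrite -mulr_sumr mulrC ler_wpM2r ?exprn_ge0 //.
exact/geometric_sum_le/norm_q01.
Qed.

Lemma bm_dens_part N : bm (dens_part N).
Proof.
apply: bmD; first exact: bm_cst.
by apply: (cint_sum _ _).1 => j; apply: bmM; [exact: bm_cst | exact: bm_cos].
Qed.

Lemma dens_part_cvg t : dens_part N t @[N --> \oo] --> dens t.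
Proof.
apply/cvgrPdist_le => e e0.
have /cvgrPdist_le/(_ _ e0) := cvg_expr_small (2 / (1 - `|q|)) (norm_q01 q_gtN1 q_lt0).
apply: filterS => N; rewrite sub0r normrN => h.
exact: le_trans (dens_tail N t) (le_trans (ler_norm _) h).
Qed.

Lemma bm_dens : bm dens.
Proof.
split.
  apply: (@measurable_realfun.measurable_fun_cvg _ _ _ _ dens_part) => [N|t _].
    by have [] := bm_dens_part N.
  exact: dens_part_cvg.
have [_ [K hK]] := bm_dens_part 0; exists (2 / (1 - `|q|) * `|q| ^+ 0 + K) => t.
rewrite -(subrK (dens_part 0 t) (dens t)).
by apply: le_trans (ler_normD _ _) _; rewrite lerD // dens_tail.
Qed.

Lemma cint_coscos (a m : nat) :
  cint (fun t : R => cos (a%:R * t) * (2 * cos (m%:R * t))) =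
  ((a + m == 0)%N)%:R + (a == m)%:R.
Proof.
(* With m at most a, the natural difference a - m is genuine. Both deltas are 1 when a = m = 0. *)
wlog am : a m / (m <= a)%N => [hw|].
  case: (leqP m a) => [/hw//|/ltnW/hw e].
  rewrite addnC [a == m]eq_sym -e; apply: eq_cint => t; ring.
rewrite -(cint_cos R (a + m)) (_ : (a == m) = ((a - m) == 0)%N); last first.
  by rewrite subn_eq0 eqn_leq am andbT.
rewrite -(cint_cos R (a - m)) -cintD; try exact: bm_cos.
apply: eq_cint => t; rewrite (natrD _ a m) natrB // mulrBl cosB (mulrDl a%:R) cosD; ring.
Qed.

Lemma cint_dens_cos m :
  cint (fun t => dens t * (2 * cos (m%:R * t))) = chebX q m 0.
Proof.
have bc : bm (fun t => 2 * cos (m%:R * t)).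
  by apply: bmM; [exact: bm_cst | exact: bm_cos].
(* By orthogonality of cosines a truncation of length at least m already has the exact integral; the
   rest of the proof bounds the tail, times 2 for 2 cos. *)
have part N : (m <= N)%N ->
    cint (fun t => dens_part N t * (2 * cos (m%:R * t))) = chebX q m 0.
  move=> mN.
  rewrite (@eq_cint _ _ (fun t => 2 * cos (m%:R * t) + \sum_(j < N)
     (2 * coefG q j.+1) * (cos ((2 * j.+1)%:R * t) * (2 * cos (m%:R * t))))); last first.
    move=> t; rewrite /dens_part mulrDl mul1r mulr_suml; congr (_ + _).
    by apply: eq_bigr => j _; rewrite !mulrA.
  have bj j : bm (fun t => cos ((2 * j.+1)%:R * t) * (2 * cos (m%:R * t))).
    by apply: bmM => //; exact: bm_cos.
  have bj' j : bm (fun t => 2 * coefG q j.+1 * (cos ((2 * j.+1)%:R * t) * (2 * cos (m%:R * t)))).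
    by apply: bmM => //; exact: bm_cst.
  have [b e] := cint_sum (index_enum 'I_N) (fun j : 'I_N => bj' j).
  rewrite cintD // e cintZ; last exact: bm_cos.
  rewrite cint_cos (eq_bigr (fun j : 'I_N =>
    2 * coefG q j.+1 * ((2 * j.+1)%N == m)%:R)); last first.
    by move=> j _; rewrite cintZ // cint_coscos mulnS add0r.
  case: (boolP (odd m)) => om.
    rewrite chebX_odd // big1 ?addr0 => [|j _].
      by case: m om {bc mN bj bj' b e} => // m _; rewrite mulr0.
    by case: eqP => [jm|]; rewrite ?mulr0 //; move: om; rewrite -jm oddM.
  rewrite -(odd_double_half m) (negbTE om) add0n -mul2n.
  case mh : m./2 => [|r].
    rewrite muln0 big1 ?addr0 ?mulr1 // => j _.
    by rewrite mulr0.
  rewrite chebX_even // [X in 2 * X + _](_ : _ = 0) ?mulr0 ?add0r //.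
  have rN : (r < N)%N.
    have mE : m = (2 * r.+1)%N.
      by rewrite -(odd_double_half m) (negbTE om) mh add0n mul2n.
    by apply: leq_trans mN; rewrite mE mul2n -addnn leq_addr.
  rewrite (bigD1 (Ordinal rN)) //= eqxx mulr1 big1 ?addr0 // => j jr.
  rewrite eqn_mul2l /= eqSS (_ : (j == r :> nat) = false) ?mulr0 //.
  by apply: contraNF jr => /eqP jr; apply/eqP/val_inj.
apply/eqP; rewrite -subr_eq0 -normr_eq0 eq_le normr_ge0 andbT.
apply/ler_addgt0Pr => e e0; rewrite add0r.
have /cvgrPdist_le/(_ _ e0) [N0 _ NP] :=
  cvg_expr_small (2 / (1 - `|q|) * 2) (norm_q01 q_gtN1 q_lt0).
have := NP (maxn N0 m) (leq_maxl _ _); set N := maxn N0 m.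
rewrite sub0r normrN => /(le_trans (ler_norm _)); apply: le_trans.
rewrite -(part N) ?leq_maxr // -[X in _ - X]mul1r -mulNr -cintZ; last first.
  exact: bmM (bm_dens_part N) bc.
rewrite -cintD; first last.
- by apply: bmM; [exact: bm_cst | exact: bmM (bm_dens_part N) bc].
- exact: bmM bm_dens bc.
apply: cint_le => [|t].
  apply: bmD; first exact: bmM bm_dens bc.
  by apply: bmM; [exact: bm_cst | exact: bmM (bm_dens_part N) bc].
rewrite mulN1r -mulrBl normrM mulrAC; apply: ler_pM => //; first exact: dens_tail.
by rewrite normrM ger0_norm // ler_piMr // ler_norml cos_geN1 cos_le1.
Qed.

Lemma horner_cheb_cos m (t : R) : (cheb R m).[2 * cos t] = 2 * cos (m%:R * t).
Proof.
suff: (cheb R m).[2 * cos t] = 2 * cos (m%:R * t) /\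
  (cheb R m.+1).[2 * cos t] = 2 * cos (m.+1%:R * t) by case.
elim: m => [|m [IH IH']]; first by rewrite /= hornerC hornerX mul0r mul1r cos0 mulr1.
split=> //; rewrite chebSS hornerD hornerN hornerM hornerX IH IH'.
have -> : m.+2%:R * t = m.+1%:R * t + t by rewrite -natr1 mulrDl mul1r.
have -> : m%:R * t = m.+1%:R * t - t by rewrite -natr1 mulrDl mul1r addrK.
by rewrite cosB cosD; ring.
Qed.

Definition dens_int (g : R -> R) : R := cint (fun t => dens t * g (2 * cos t)).

Lemma dens_int_cheb m : dens_int (horner (cheb R m)) = chebX q m 0.
Proof.
by rewrite -cint_dens_cos; apply: eq_cint => t; rewrite horner_cheb_cos.
Qed.

End Density.

(** * From moments to continuous functions *)

Section Weierstrass.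
Variable R : realType.
Implicit Types (f g : nat -> R) (x : R).

(* The Bernstein operator, as the expectation of [f] after [m] Bernoulli steps;
   this recursion gives the second moment by induction. *)
Fixpoint bernstein m f : {poly R} :=
  if m is m'.+1 then
    (1 - 'X) * bernstein m' f + 'X * bernstein m' (fun k => f k.+1)
  else (f 0%N)%:P.

Lemma bernsteinS m f x : (bernstein m.+1 f).[x] =
  (1 - x) * (bernstein m f).[x] + x * (bernstein m (fun k => f k.+1)).[x].
Proof. by rewrite /= hornerD !hornerM !hornerE. Qed.

Lemma bernstein_le m f g x : 0 <= x <= 1 -> (forall k, (k <= m)%N -> f k <= g k) ->
  (bernstein m f).[x] <= (bernstein m g).[x].
Proof.
move=> /andP[x0 x1]; elim: m f g => [|m IH] f g fg.
  by rewrite /= !hornerC fg.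
rewrite !bernsteinS lerD // ler_wpM2l ?subr_ge0 //; apply: IH => k km; apply: fg => //.
exact: leqW.
Qed.

Lemma bernsteinD m f g x :
  (bernstein m (fun k => f k + g k)).[x] = (bernstein m f).[x] + (bernstein m g).[x].
Proof.
elim: m f g => [|m IH] f g; first by rewrite /= !hornerC.
by rewrite !bernsteinS !IH; ring.
Qed.

Lemma bernsteinZ m c f x :
  (bernstein m (fun k => c * f k)).[x] = c * (bernstein m f).[x].
Proof.
elim: m f => [|m IH] f; first by rewrite /= !hornerC.
by rewrite !bernsteinS !IH; ring.
Qed.

Lemma bernstein_cst m c x : (bernstein m (fun=> c)).[x] = c.
Proof. by elim: m => [|m IH]; rewrite ?hornerC // bernsteinS IH; ring. Qed.

(** Squared bias plus variance of a binomial variable. The centre [c] is arbitrary because the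
    shifted branch of the recursion recentres at c - 1. *)
Lemma bernstein_moment2 m c x : (bernstein m (fun k => (k%:R - c) ^+ 2)).[x] =
  (m%:R * x - c) ^+ 2 + m%:R * x * (1 - x).
Proof.
elim: m c => [|m IH] c; first by rewrite /= hornerC; ring.
rewrite bernsteinS IH.
have -> : (fun k : nat => (k.+1%:R - c) ^+ 2) = fun k => (k%:R - (c - 1)) ^+ 2.
  by apply: funext => k; rewrite -natr1; ring.
by rewrite IH -natr1; ring.
Qed.

Lemma continuous_uniform_segment (g : R -> R) (a b e : R) : continuous g -> 0 < e ->
  exists2 d : R, 0 < d & forall x y, x \in `[a, b] -> `|x - y| < d -> `|g x - g y| < e.
Proof.
move=> cg e0; have /compact_near_coveringP := @segment_compact R a b.
pose P (d x : R) := forall y, `|x - y| < d -> `|g x - g y| < e.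
move=> /(_ _ (0 : R)^'+ P _) [].
  move=> x _; have e2 : 0 < e / 2 by rewrite divr_gt0.
  have /cvgrPdist_lt/(_ _ e2) /nbhs_ballP[d d0 dP] := cg x.
  exists (ball x (d / 2), [set d' | d' < d / 2]) => /=.
    split; first by apply: nbhsx_ballx; rewrite divr_gt0.
    by apply: nbhs_right_lt; rewrite divr_gt0.
  move=> [x' d'] /= [xx' dd'] y x'y.
  have h1 : `|g x - g x'| < e / 2.
    apply: dP; rewrite /ball /=; apply: lt_trans xx' _.
    by rewrite ltr_pdivrMr // ltr_pMr // ltr1n.
  have h2 : `|g x - g y| < e / 2.
    apply: dP; rewrite /ball /= (splitr d) -(subrK x' x) -addrA.
    by rewrite (le_lt_trans (ler_normD _ _)) // ltrD // (lt_trans x'y).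
  rewrite (splitr e) -(subrK (g x) (g x')) -addrA.
  by rewrite (le_lt_trans (ler_normD _ _)) // ltrD // distrC.
move=> d /= d0 H; exists (d / 2); first by rewrite divr_gt0.
move=> x y xab xy; apply: (H (d / 2)) => //=; last by rewrite divr_gt0.
by rewrite sub0r normrN gtr0_norm ?divr_gt0 // ltr_pdivrMr // ltr_pMr // ltr1n.
Qed.

Lemma bernstein_approx (g : R -> R) (e : R) : continuous g -> 0 < e ->
  exists p : {poly R}, forall x, 0 <= x <= 1 -> `|g x - p.[x]| <= e.
Proof.
move=> cg e0; have e2 : 0 < e / 2 by rewrite divr_gt0.
have [d d0 dP] := continuous_uniform_segment 0 1 cg e2.
have cn : {within `[(0 : R), 1], continuous (fun x => `|g x|)}.
  apply: continuous_subspaceT => x.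
  by apply: (@continuous_comp _ _ _ g (fun y => `|y|)); [exact: cg | exact: norm_continuous].
have [c _ cP] := EVT_max ler01 cn; set B := `|g c| in cP.
have B0 : 0 <= B by exact: normr_ge0.
(* When |x - y| >= d, (y - x)^2 / d^2 is at least 1, so the crude bound 2B on the oscillation is
   absorbed by K (y - x)^2. *)
pose K := 2 * B / d ^+ 2.
have K0 : 0 <= K by apply: divr_ge0; [exact: mulr_ge0 | exact: sqr_ge0].
have osc x y : 0 <= x <= 1 -> 0 <= y <= 1 -> `|g x - g y| <= e / 2 + K * (y - x) ^+ 2.
  move=> x01 y01; case: (ltP `|x - y| d) => xy.
    rewrite (le_trans (ltW (dP x y _ xy))) ?in_itv //= lerDl mulr_ge0 ?sqr_ge0 //.
  apply: (@le_trans _ _ (2 * B)).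
    apply: le_trans (ler_normB _ _) _; rewrite mulr_natl mulr2n; apply: lerD.
      by apply: cP; rewrite in_itv.
    by apply: cP; rewrite in_itv.
  rewrite ler_wpDl ?(ltW e2) // /K mulrAC ler_pdivlMr ?exprn_gt0 //.
  apply: ler_wpM2l; first exact: mulr_ge0.
  rewrite -(real_normK (num_real (y - x))) distrC.
  by rewrite ler_pXn2r ?nnegrE ?normr_ge0 // ltW.
(* The variance of k/m is x (1 - x) / m, at most 1/m, so the quadratic term costs at most K/m. *)
pose m := (Num.bound (K / (e / 2))).+1.
have m0 : 0 < m%:R :> R by rewrite ltr0n.
have Km : K / m%:R <= e / 2.
  rewrite ler_pdivrMr // mulrC -ler_pdivrMr // ltW //.
  have Ke : 0 <= K / (e / 2) by rewrite divr_ge0 // ltW.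
  by apply: lt_trans (archi_boundP Ke) _; rewrite ltr_nat.
exists (bernstein m (fun k => g (k%:R / m%:R))) => x x01.
have x01' := x01; case/andP: x01' => x0 x1.
have kin k : (k <= m)%N -> 0 <= (k%:R / m%:R : R) <= 1.
  move=> km; rewrite divr_ge0 //= ler_pdivrMr // mul1r ler_nat //.
have maj k : (k%:R / m%:R - x) ^+ 2 = m%:R^-2 * (k%:R - m%:R * x) ^+ 2 :> R.
  by field; rewrite gt_eqF.
have moment (s : R) :
    (bernstein m (fun k => s + (K * m%:R^-2) * (k%:R - m%:R * x) ^+ 2)).[x] <= s + e / 2.
  rewrite bernsteinD bernstein_cst bernsteinZ bernstein_moment2 subrr expr0n add0r lerD2l.
  apply: le_trans Km; rewrite -[leLHS]mulrA ler_wpM2l //.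
  rewrite [leLHS](_ : _ = m%:R^-1 * (x * (1 - x))); last by field; rewrite gt_eqF.
  rewrite -[leRHS]mulr1 ler_wpM2l ?invr_ge0 ?ler0n //.
  by rewrite mulr_ile1 ?subr_ge0 // gerBl.
have upper (h : nat -> R) s : (forall k, (k <= m)%N ->
    h k <= s + e / 2 + K * (k%:R / m%:R - x) ^+ 2) -> (bernstein m h).[x] <= s + e.
  move=> hs; rewrite (splitr e) addrA; apply: le_trans (moment _).
  apply: bernstein_le => // k km; rewrite -[K * _ * _]mulrA -maj; exact: hs.
rewrite distrC ler_distl; apply/andP; split; last first.
  apply: upper => k km; rewrite -addrA -lerBlDl.
  by apply: le_trans (ler_norm _) _; rewrite distrC; apply: osc => //; exact: kin.
(* The lower estimate is the upper one for -g. *)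
rewrite -[leRHS]opprK lerNr opprB addrC -mulN1r -bernsteinZ; apply: upper => k km.
rewrite mulN1r -addrA addrC -lerBlDr opprK [leLHS]addrC.
by apply: le_trans (ler_norm _) _; apply: osc => //; exact: kin.
Qed.

Lemma weierstrass (g : R -> R) (M e : R) : continuous g -> 0 < M -> 0 < e ->
  exists p : {poly R}, forall x, `|x| <= M -> `|g x - p.[x]| <= e.
Proof.
move=> cg M0 e0.
have [|p pP] := @bernstein_approx (fun y => g (2 * M * y - M)) e _ e0.
  move=> y; apply: (@continuous_comp _ _ _ (fun y => 2 * M * y - M) g); last exact: cg.
  by apply: continuousB; [exact: mulrl_continuous | exact: cst_continuous].
have MN : M != 0 by rewrite gt_eqF.
exists (p \Po ((2 * M)^-1 *: ('X + M%:P))) => x xM.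
rewrite horner_comp hornerZ hornerD hornerX hornerC.
move: xM; rewrite ler_norml => /andP[x1 x2].
have -> : g x = g (2 * M * ((2 * M)^-1 * (x + M)) - M).
  by congr g; field.
have M2 : 0 < 2 * M by rewrite mulr_gt0.
apply: pP; rewrite mulrC; apply/andP; split.
  by apply: divr_ge0; [rewrite -lerBlDr sub0r | exact: ltW].
rewrite ler_pdivrMr // mul1r [2 * M]mulr_natl mulr2n.
by rewrite lerD2r.
Qed.

End Weierstrass.

(** * The norm bounds the real spectrum *)

Section Neumann.
Variables (R : realType) (A : cstarAlgType R).
Implicit Types a b : A.

Lemma cnormZr (k : R[i]) a : cnorm (k *: a) = nrm k * cnorm a.
Proof. by apply: (@complexI R); rewrite cnormZ nrmE rmorphM. Qed.

Lemma cnorm0 : cnorm (0 : A) = 0.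
Proof. by rewrite -(scale0r (0 : A)) cnormZr /nrm normr0 mul0r. Qed.

Lemma cnormN a : cnorm (- a) = cnorm a.
Proof. by rewrite -scaleN1r cnormZr nrmN nrm1 mul1r. Qed.

Lemma cnorm_sum (I : Type) (r : seq I) (P : pred I) (F : I -> A) :
  cnorm (\sum_(i <- r | P i) F i) <= \sum_(i <- r | P i) cnorm (F i).
Proof.
elim/big_ind2: _ => [|x x' y y' h h'|//]; first by rewrite cnorm0.
exact: le_trans (ler_cnormD _ _) (lerD h h').
Qed.

Lemma cnormX a k : cnorm (a ^+ k) <= cnorm (1 : A) * cnorm a ^+ k.
Proof.
elim: k => [|k IH]; first by rewrite !expr0 mulr1.
rewrite exprS; apply: le_trans (ler_cnormM _ _) _.
by rewrite exprS mulrCA ler_wpM2l ?cnorm_ge0.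
Qed.

Lemma neumann a : cnorm a < 1 -> exists b, b * (1 - a) = 1 /\ (1 - a) * b = 1.
Proof.
move=> a1; set r := cnorm a in a1; have r0 : 0 <= r by exact: cnorm_ge0.
have r01 : 0 <= r < 1 by rewrite r0.
pose S N := \sum_(k < N) a ^+ k.
pose K := cnorm (1 : A) / (1 - r).
have tail n k : cnorm (S (n + k)%N - S n) <= K * r ^+ n.
  rewrite /S big_split_ord /= [X in cnorm X]addrC addKr.
  apply: le_trans (cnorm_sum _ _ _) _.
  apply: (@le_trans _ _ (\sum_(j < k) (cnorm (1 : A) * r ^+ n) * r ^+ j)).
    by apply: ler_sum => j _; rewrite -mulrA -exprD; exact: cnormX.
  rewrite -mulr_sumr /K [leRHS]mulrAC ler_wpM2l ?geometric_sum_le //.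
  by rewrite mulr_ge0 ?cnorm_ge0 ?exprn_ge0.
have Kr := cvg_expr_small K r01.
have [b Sb] : exists b, cnorm (S n - b) @[n --> \oo] --> (0 : R).
  apply: cnorm_complete => e e0.
  move/cvgrPdist_lt : Kr => /(_ _ e0) [N _ NP]; exists N => m n Nm Nn.
  have small p : (N <= p)%N -> K * r ^+ p < e.
    by move=> /NP; rewrite /= sub0r normrN; apply: le_lt_trans; exact: ler_norm.
  wlog mn : m n Nm Nn / (n <= m)%N => [hw|].
    case: (leqP n m) => [/hw->//|/ltnW/hw h].
    by rewrite -cnormN opprB; apply: h.
  by rewrite -(subnKC mn); apply: le_lt_trans (tail _ _) (small _ Nn).
have aS N : S N * (1 - a) = 1 - a ^+ N /\ (1 - a) * S N = 1 - a ^+ N.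
  have h : (1 - a) * S N = 1 - a ^+ N.
    by rewrite -[1 - a]opprB mulNr -subrX1 opprB.
  split=> //; rewrite -h mulrBl mulrBr mul1r mulr1; congr (_ - _).
  rewrite /S mulr_suml mulr_sumr; apply: eq_bigr => k _.
  by rewrite -exprS -exprSr.
(* [f] is multiplication by 1 - a on either side, so one passage to the limit gives both one-sided
   inverses. *)
have lim0 (f : A -> A) : (forall x y, f (x - y) = f x - f y) ->
    (forall x, cnorm (f x) <= cnorm x * cnorm (1 - a)) ->
    (forall N, f (S N) = 1 - a ^+ N) -> f b = 1.
  move=> fB fb fS; apply/eqP; rewrite -subr_eq0; apply/eqP/cnorm0_eq0/eqP.
  rewrite eq_le cnorm_ge0 andbT.
  have bd N : cnorm (f b - 1) <= cnorm (S N - b) * cnorm (1 - a) + cnorm (1 : A) * r ^+ N.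
    have -> : f b - 1 = - f (S N - b) - a ^+ N
      by rewrite fB fS !opprB -addrA [in RHS]addrAC subrr add0r.
    apply: le_trans (ler_cnormD _ _) _; rewrite !cnormN lerD ?cnormX //.
  have cv : (cnorm (S N - b) * cnorm (1 - a) + cnorm (1 : A) * r ^+ N) @[N --> \oo] --> (0 : R).
    rewrite -[X in _ --> X]addr0; apply: cvgD; last exact: cvg_expr_small.
    by rewrite -[X in _ --> X](mul0r (cnorm (1 - a))); exact: cvgMl.
  rewrite -(cvg_lim _ cv) //; apply: limr_ge; first by apply/cvg_ex; exists 0.
  by apply: nearW => N; exact: bd.
exists b; split.
  apply: (lim0 (fun x => x * (1 - a))) => [x y|x|N]; first exact: mulrBl.
    exact: ler_cnormM.
  by have [] := aS N.
apply: (lim0 (fun x => (1 - a) * x)) => [x y|x|N]; first exact: mulrBr.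
  by rewrite mulrC; exact: ler_cnormM.
by have [] := aS N.
Qed.

Lemma real_spectrum_le a x : real_spectrum a x -> `|x| <= cnorm a.
Proof.
move=> ax; rewrite leNgt; apply/negP => xa; apply: ax.
have x0 : x%:C != 0 :> R[i].
  by rewrite fmorph_eq0 -normr_gt0 (le_lt_trans (cnorm_ge0 a)).
have xp : 0 < `|x| by rewrite (le_lt_trans (cnorm_ge0 a)).
have [|b [b1 b2]] := @neumann (x%:C^-1 *: a).
  rewrite cnormZr nrmV nrm_real mulrC ltr_pdivrMr //.
  by rewrite mul1r.
have e : x%:C *: 1 - a = x%:C *: (1 - x%:C^-1 *: a).
  by rewrite scalerBr scalerA divff // scale1r.
exists (x%:C^-1 *: b); rewrite e -!scalerAl -!scalerAr !scalerA.
by rewrite b1 b2 mulVf // divff // !scale1r.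
Qed.

End Neumann.

Section ComplexContinuity.
Variable R : realType.
Notation C := R[i].

Definition toC (g : R -> R) : R -> C^o := fun x => (g x)%:C.

Lemma continuous_toC g : continuous g -> continuous (toC g).
Proof.
move=> cg x; apply/cvgrPdist_lt => e e0.
have er : e = (complex.Re e)%:C by apply: ge0_real; exact: ltW.
have e1 : 0 < complex.Re e by rewrite -ltcR -er.
have /cvgrPdist_lt/(_ _ e1) := cg x; apply: filterS => y h.
by rewrite er /toC -rmorphB nrmE nrm_real ltcR.
Qed.

Lemma continuous_ReC (f : R -> C^o) : continuous f -> continuous (fun x => complex.Re (f x)).
Proof.
move=> cf x; apply/cvgrPdist_lt => e e0.
have e1 : 0 < e%:C :> C by rewrite ltcR.
have /cvgrPdist_lt/(_ _ e1) := cf x; apply: filterS => y.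
rewrite -ReN -ReD nrmE ltcR; apply: le_lt_trans; exact: norm_Re_nrm.
Qed.

Lemma continuous_ImC (f : R -> C^o) : continuous f -> continuous (fun x => complex.Im (f x)).
Proof.
move=> cf x; apply/cvgrPdist_lt => e e0.
have e1 : 0 < e%:C :> C by rewrite ltcR.
have /cvgrPdist_lt/(_ _ e1) := cf x; apply: filterS => y.
have -> : complex.Im (f x) - complex.Im (f y) = complex.Im (f x - f y).
  by rewrite ImD; case: (f y).
rewrite nrmE ltcR; apply: le_lt_trans; exact: norm_Im_nrm.
Qed.

Lemma continuous_poly (p : {poly R}) : continuous (horner p).
Proof. by move=> x; apply: continuous_horner. Qed.

End ComplexContinuity.

(** * A state composed with the functional calculus *)

Section FunctionalCalculus.
Variables (R : realType) (A : cstarAlgType R) (w : A) (Phi : (R -> R[i]^o) -> A).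
Variable h : {scalar A}.
Hypothesis cfc : is_cfc w Phi.
Hypothesis state : is_state h.
Implicit Types g : R -> R.

Let within_toC g : continuous g -> {within real_spectrum w, continuous (toC g)}.
Proof. by move=> cg; apply: continuous_subspaceT; exact: continuous_toC. Qed.

(** On the spectrum g is the square of sqrt g. Since [Num.sqrt] is 0 on negative reals, this root is
    continuous on the whole line, and [cfc_eq] ignores the points where its square is not g. *)
Lemma cfc_ge0 g : continuous g -> (forall x, real_spectrum w x -> 0 <= g x) ->
  0 <= h (Phi (toC g)).
Proof.
move=> cg g0; pose s x := Num.sqrt (g x).
have cs : continuous s.
  by move=> x; apply: (@continuous_comp _ _ _ g Num.sqrt); [exact: cg | exact: sqrt_continuous].
have -> : Phi (toC g) = star (Phi (toC s)) * Phi (toC s).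
  rewrite -(cfc_star cfc (within_toC cs)).
  have -> : (fun x => (toC s x : R[i])^*) = toC s.
    by apply: funext => x; rewrite /toC conj_real.
  rewrite -(cfcM cfc (within_toC cs) (within_toC cs)).
  have ss : (fun x => toC s x * toC s x) = toC (fun x => s x * s x).
    by apply: funext => x; rewrite /toC rmorphM.
  rewrite ss; apply: (cfc_eq cfc).
  - exact: within_toC.
  - by apply: within_toC => x; apply: continuousM; exact: cs.
  - by move=> x wx; rewrite /toC -expr2 sqr_sqrtr // g0.
by have [hpos _ _] := state; exact: hpos.
Qed.

Lemma cfc_toC_lin g g' (c : R) : continuous g -> continuous g' ->
  h (Phi (toC (fun x => g x + c * g' x))) = h (Phi (toC g)) + c%:C * h (Phi (toC g')).
Proof.
move=> cg cg'.
have -> : toC (fun x => g x + c * g' x) = fun x => toC g x + c%:C * toC g' x.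
  by apply: funext => x; rewrite /toC rmorphD rmorphM.
have cc : {within real_spectrum w, continuous (fun x => c%:C * toC g' x : R[i]^o)}.
  have -> : (fun x => c%:C * toC g' x) = toC (fun x => c * g' x).
    by apply: funext => x; rewrite /toC rmorphM.
  apply: within_toC => x; apply: continuousM; first exact: cvg_cst.
  exact: cg'.
rewrite (cfcD cfc (within_toC cg) cc) (cfcZ cfc _ (within_toC cg')).
by rewrite raddfD /= linearZ.
Qed.

Lemma cfc_toC_cst (c : R) : h (Phi (toC (fun=> c))) = c%:C.
Proof.
have -> : toC (fun=> c) = fun x => c%:C * (fun=> 1 : R[i]^o) x.
  by apply: funext => x; rewrite /toC mulr1.
rewrite (cfcZ cfc) ?(cfc1 cfc); last first.
  by apply: continuous_subspaceT => x; exact: cvg_cst.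
by have [_ h1 _] := state; rewrite linearZ /= h1 mulr1.
Qed.

(** Positivity at e + g and e - g suffices: being nonnegative in [R[i]] includes being real, which
    also gives the vanishing imaginary part. *)
Lemma cfc_bound g (e : R) : continuous g -> (forall x, real_spectrum w x -> `|g x| <= e) ->
  complex.Im (h (Phi (toC g))) = 0 /\ `|complex.Re (h (Phi (toC g)))| <= e.
Proof.
move=> cg ge.
have ce : continuous (fun _ : R => e) by move=> x; exact: cvg_cst.
have key (c : R) : `|c| = 1 -> 0 <= e%:C + c%:C * h (Phi (toC g)).
  move=> c1; rewrite -(cfc_toC_cst e) -(cfc_toC_lin _ ce cg).
  apply: cfc_ge0 => [x|x wx].
    by apply: cvgD; [exact: ce | apply: cvgM; [exact: cvg_cst | exact: cg]].
  rewrite -lerBlDl sub0r (le_trans _ (_ : - `|c * g x| <= _)) //.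
    by rewrite normrM c1 mul1r lerN2 ge.
  by rewrite lerNl -normrN ler_norm.
have := key 1 (normr1 _); have := key (-1) (normrN1 _).
rewrite !lecE; case: (h _) => a b /=; rewrite !(mul1r, mul0r, mulN1r, subr0, addr0, add0r).
move=> /andP[/eqP b1 a1] /andP[/eqP b2 a2]; split; first lra.
by rewrite ler_norml; apply/andP; split; lra.
Qed.

Lemma cfc_poly (p : {poly R}) :
  Phi (toC (horner p)) = horner_alg w (map_poly (real_complex R) p).
Proof.
elim/poly_ind: p => [|p c IH].
  rewrite !raddf0.
  have -> : toC (horner (0 : {poly R})) = fun x => 0 * (fun=> 1 : R[i]^o) x.
    by apply: funext => x; rewrite /toC horner0 mul0r.
  rewrite (cfcZ cfc) ?scale0r //.
  by apply: continuous_subspaceT => x; exact: cvg_cst.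
have cid : {within real_spectrum w, continuous (fun x => x%:C : R[i]^o)}.
  by apply: (@within_toC id) => x.
have cp := within_toC (@continuous_poly R p).
have c1 : {within real_spectrum w, continuous (fun=> 1 : R[i]^o)}.
  by apply: continuous_subspaceT => x; exact: cvg_cst.
have -> : toC (horner (p * 'X + c%:P)) =
    fun x => (fun x => toC (horner p) x * x%:C : R[i]^o) x
             + (fun x => c%:C * (fun=> 1 : R[i]^o) x : R[i]^o) x.
  apply: funext => x; rewrite /toC hornerMXaddC rmorphD.
  by rewrite [X in X + _]rmorphM [X in _ = _ + X]mulr1.
rewrite (cfcD cfc) ?(cfcM cfc cp cid) ?(cfcZ cfc _ c1) ?(cfc1 cfc) ?(cfc_id cfc).
- rewrite IH !(rmorphD, rmorphM) /= map_polyX map_polyC /=.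
  by rewrite horner_algX horner_algC.
- have -> : (fun x => toC (horner p) x * x%:C) = toC (horner (p * 'X)).
    by apply: funext => x; rewrite /toC hornerMX rmorphM.
  exact/within_toC/continuous_poly.
- have -> : (fun x => c%:C * 1) = toC (fun=> c).
    by apply: funext => x; rewrite /toC mulr1.
  by apply: within_toC => x; exact: cvg_cst.
Qed.

End FunctionalCalculus.

(** The polynomials z^m + z^-m span. Induction on p shows P for p times every [cheb m], using X
    cheb_(m+1) = cheb_(m+2) + cheb_m; then m = 0 is used, where [cheb] is the constant 2, to be
    inverted. *)
Lemma cheb_ind (K : fieldType) (P : {poly K} -> Prop) : 2%:R != 0 :> K ->
  (forall (c : K) p r, P p -> P r -> P (c *: p + r)) ->
  (forall m, P (cheb K m)) -> forall p, P p.
Proof.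
move=> two0 Plin Pcheb.
have P0 : P 0 by rewrite -(addNr (cheb K 0)) -scaleN1r; apply: (Plin).
have Pmul p m : P (p * cheb K m).
  elim/poly_ind: p m => [|p c IH] m; first by rewrite mul0r.
  rewrite mulrDl mul_polyC -mulrA addrC; apply: (Plin) => //.
  case: m => [|m].
    have -> : p * ('X * cheb K 0) = 2%:R *: (p * cheb K 1) + 0.
      by rewrite addr0 -mul_polyC /=; ring.
    exact: Plin.
  rewrite (_ : 'X * cheb K m.+1 = cheb K m.+2 + cheb K m); last first.
    by rewrite chebSS subrK.
  by rewrite mulrDr -[p * cheb K m.+2]scale1r; apply: (Plin).
move=> p; have -> : p = 2%:R^-1 *: (p * cheb K 0) + 0.
  by rewrite addr0 /= mulrC mul_polyC scalerA mulVf // scale1r.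
by apply: (Plin).
Qed.

Section DensityFunctional.
Variables (R : realType) (q : R).
Hypothesis q_gtN1 : -1 < q.
Hypothesis q_lt0 : q < 0.
Notation bm := (@bounded_measurable R).

Lemma bm_comp_cos (g : R -> R) : continuous g -> bm (fun t => g (2 * cos t)).
Proof.
move=> cg; split.
  apply: measurable_realfun.continuous_measurable_fun => x.
  apply: (@continuous_comp _ _ _ (fun t => 2 * cos t) g); last exact: cg.
  by apply: cvgM; [exact: cvg_cst | exact: continuous_cos].
have cn : {within `[(- 2 : R), 2], continuous (fun x => `|g x|)}.
  apply: continuous_subspaceT => x.
  by apply: (@continuous_comp _ _ _ g (fun y => `|y|)); [exact: cg | exact: norm_continuous].
have [|c _ cP] := EVT_max _ cn; first by rewrite ge0_cp ?ler0n.
exists `|g c| => t; apply: cP; rewrite in_itv /=.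
have := cos_geN1 t; have := cos_le1 t => a b.
by apply/andP; split; lra.
Qed.

Lemma bm_dens_comp g : continuous g -> bm (fun t => dens q t * g (2 * cos t)).
Proof. by move=> cg; apply: bmM; [exact: bm_dens | exact: bm_comp_cos]. Qed.

Lemma dens_int_lin (c : R) g g' : continuous g -> continuous g' ->
  dens_int q (fun x => g x + c * g' x) = dens_int q g + c * dens_int q g'.
Proof.
move=> cg cg'; rewrite /dens_int -cintZ; last exact: bm_dens_comp.
rewrite -cintD; last 2 first.
- exact: bm_dens_comp.
- by apply: bmM; [exact: bm_cst | exact: bm_dens_comp].
by apply: eq_cint => t; ring.
Qed.

Lemma dens_int_bound : exists2 B : R, 0 <= B & forall g (e : R), continuous g ->
  (forall x, `|x| <= 2 -> `|g x| <= e) -> `|dens_int q g| <= B * e.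
Proof.
have [_ [B hB]] := bm_dens q_gtN1 q_lt0; exists B => [|g e cg ge].
  exact: le_trans (normr_ge0 _) (hB 0).
apply: cint_le; first exact: bm_dens_comp.
move=> t; rewrite normrM ler_pM // ge // ler_norml.
have := cos_geN1 t; have := cos_le1 t => a b.
by apply/andP; split; lra.
Qed.

End DensityFunctional.

(** * Identification of the Haar functional with the density *)

Section CircularDensity.
Variables (R : realType) (n : nat) (i j : 'I_n) (q : R).
Hypothesis q_gtN1 : -1 < q.
Hypothesis q_lt0 : q < 0.
Hypothesis nq : q + q^-1 = - n%:R.
Variables (A AA : cstarAlgType R) (u : 'M[A]_n) (tens : A -> A -> AA).
Variables (Delta : {lrmorphism A -> AA}) (haar : {scalar A}).
Hypothesis uAo : is_Ao u.
Hypothesis ten : is_cstar_tensor tens.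
Hypothesis comul : is_comul u tens Delta.
Hypothesis Haar : is_Haar tens Delta haar.

Notation w := ((sn R n)%:C *: u i j).

(** Both sides are linear in [p], and on [cheb m] both equal the vacuum coordinate [chebX q m 0]. *)
Lemma haar_poly (p : {poly R}) :
  haar (horner_alg w (map_poly (real_complex R) p)) = (dens_int q (horner p))%:C.
Proof.
elim/cheb_ind: p => [|c p r hp hr|m]; first by rewrite pnatr_eq0.
  rewrite -mul_polyC rmorphD rmorphM /= map_polyC /= !rmorphD rmorphM /= horner_algC.
  rewrite mulr_algl raddfD /= linearZ /= hp hr.
  have -> : horner (c%:P * p + r) = fun x => r.[x] + c * p.[x].
    by apply: funext => x; rewrite !hornerE addrC.
  rewrite dens_int_lin //; try exact: continuous_poly.
  by rewrite rmorphD [X in _ = _ + X]rmorphM addrC.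
by rewrite map_cheb (haar_cheb q_gtN1 q_lt0 nq uAo ten comul Haar) dens_int_cheb.
Qed.

Variable Phi : (R -> R[i]^o) -> A.
Hypothesis cfc : is_cfc w Phi.

Lemma haar_cfc (g : R -> R) : continuous g ->
  haar (Phi (toC g)) = (dens_int q g)%:C.
Proof.
move=> cg; have [hstate _ _] := Haar.
have [B B0 hB] := dens_int_bound q_gtN1 q_lt0.
(* [-M, M] contains the real spectrum, which governs the Haar side, and [-2, 2], which governs the
   density side; one polynomial must approximate g on both. *)
set M := 2 + cnorm w; have M0 : 0 < M by rewrite ltr_pwDl ?cnorm_ge0.
have approx (e : R) : 0 < e -> complex.Im (haar (Phi (toC g))) = 0 /\
    `|complex.Re (haar (Phi (toC g))) - dens_int q g| <= e + B * e.
  move=> e0; have [p pP] := weierstrass cg M0 e0.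
  have cp := @continuous_poly R p.
  pose r x := g x + -1 * p.[x].
  have cr : continuous r.
    by move=> x; apply: cvgD; [exact: cg | apply: cvgM; [exact: cvg_cst | exact: cp]].
  have re x : `|x| <= M -> `|r x| <= e by move=> xM; rewrite /r mulN1r pP.
  have [|im re'] := cfc_bound cfc hstate (e := e) cr.
    move=> x /real_spectrum_le xw; apply: re; apply: le_trans xw _.
    by rewrite /M lerDr.
  have hr : haar (Phi (toC r)) = haar (Phi (toC g)) + (-1)%:C * haar (Phi (toC (horner p))).
    exact: (cfc_toC_lin haar cfc (-1) cg cp).
  rewrite (cfc_poly cfc) haar_poly -rmorphM mulN1r in hr.
  have dr : dens_int q r = dens_int q g + -1 * dens_int q (horner p).
    exact: dens_int_lin.
  have bd : `|dens_int q r| <= B * e.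
    by apply: hB => // x x2; apply: re; rewrite (le_trans x2) // /M lerDl cnorm_ge0.
  split; first by move: im; rewrite hr ImD /= addr0.
  have -> : complex.Re (haar (Phi (toC g))) - dens_int q g =
      complex.Re (haar (Phi (toC r))) - dens_int q r.
    by rewrite hr dr ReD /=; ring.
  by apply: le_trans (ler_normB _ _) _; exact: lerD.
have [im _] := approx 1 ltr01.
have re : complex.Re (haar (Phi (toC g))) = dens_int q g.
  apply/eqP; rewrite -subr_eq0 -normr_eq0 eq_le normr_ge0 andbT.
  apply/ler_addgt0Pr => e e0; rewrite add0r.
  have B1 : 0 < 1 + B by rewrite ltr_pwDl.
  have [_] := approx (e / (1 + B)) (divr_gt0 e0 B1).
  by rewrite (_ : _ + B * _ = e) //; field; rewrite gt_eqF.
by move: im re; case: (haar _) => a b /= -> ->.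
Qed.

Lemma haar_cfc_complex (phi : R -> R[i]^o) : continuous phi ->
  haar (Phi phi) = dens_int q (fun x => complex.Re (phi x)) +i*
                   dens_int q (fun x => complex.Im (phi x)).
Proof.
move=> cphi; have cRe := continuous_ReC cphi; have cIm := continuous_ImC cphi.
have wRe : {within real_spectrum w, continuous (toC (fun x => complex.Re (phi x)))}.
  by apply: continuous_subspaceT; exact: continuous_toC.
have wIm : {within real_spectrum w, continuous (toC (fun x => complex.Im (phi x)))}.
  by apply: continuous_subspaceT; exact: continuous_toC.
have wIm' : {within real_spectrum w, continuous
    (fun x => 'i%C * toC (fun x => complex.Im (phi x)) x : R[i]^o)}.
  apply: continuous_subspaceT => x; apply: cvgMr; exact: (continuous_toC cIm).
have e : phi = fun x => toC (fun x => complex.Re (phi x)) x +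
    'i%C * toC (fun x => complex.Im (phi x)) x.
  by apply: funext => x; rewrite /toC [LHS]complexE.
rewrite [in LHS]e (cfcD cfc wRe wIm') (cfcZ cfc _ wIm) raddfD /= linearZ /=.
rewrite !haar_cfc //.
by apply/eqP; rewrite eq_complex /=; apply/andP; split; apply/eqP; ring.
Qed.

End CircularDensity.

Theorem theorem5p1 (R : realType) (n : nat) (i j : 'I_n) (q : R)
  (A : cstarAlgType R) (u : 'M[A]_n)
  (AA : cstarAlgType R) (tens : A -> A -> AA) (Delta : {lrmorphism A -> AA})
  (haar : {scalar A}) :
  (2 < n)%N ->
  -1 < q -> q < 0 -> q + q^-1 = - n%:R ->
  is_Ao u ->
  is_min_tensor tens ->
  is_comul u tens Delta ->
  is_Haar tens Delta haar ->
  has_circular_density haar ((Num.sqrt (n + 2)%N%:R : R)%:C *: u i j)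
    (fun z => 2^-1 * (G1 q z + G1 q z^-1)) /\
  (forall z : R[i], `|z| = 1 ->
     [/\ csummable (G1_term q z), csummable (G2_term q z) & G1 q z = G2 q z]).
Proof.
move=> _ q_gtN1 q_lt0 nq uAo [ten _] comul Haar.
split; last by move=> z; exact: G1_G2.
have [urel _ _] := Ao_rel uAo.
split.
- by rewrite starZ urel conj_real.
- by move=> z _; rewrite invrK addrC.
- split.
    rewrite (_ : (fun t => _) = EFin \o dens q).
      exact/bm_integrable/bm_dens.
    by apply: funext => t; rewrite half_G1_sum.
  rewrite (_ : (fun t => _) = EFin \o (fun=> 0)).
    exact/bm_integrable/bm_cst.
  by apply: funext => t; rewrite half_G1_sum.
- move=> Phi cfc phi cphi.
  rewrite (haar_cfc_complex q_gtN1 q_lt0 nq uAo ten comul Haar cfc cphi).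
  have e t : complex.Re (@expi R t + (expi t)^-1) = 2 * cos t.
    by rewrite expiV ReD Re_conjc /= mulr_natl mulr2n.
  rewrite /circle_integral /dens_int /cint; congr (_ +i* _); congr (_ * _).
    apply: eq_Rintegral => t _.
    by rewrite half_G1_sum // e ReZ.
  apply: eq_Rintegral => t _.
  by rewrite half_G1_sum // e ImZ.
Qed.
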